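(* Let $\lambda>0$ and $N\sim\mathrm{Po}(\lambda)$ (Poisson with mean $\lambda$). Let $X_1,X_2,\ldots$ be exchangeable real-valued random variables, independent of $N$, with $\mathbb{E}[X_1^2]>0$ and $\mathbb{E}|X_1|^3<\infty$, which satisfy the equally correlated model with parameter $\rho\in[0,1]$ (see context). Let $X_1',X_2',\ldots$ be IID copies of $X_1$ defined on the same probability space, such that $\big((X_j)_{j\ge1},(X_j')_{j\ge1}\big)$ is independent of $N$ and the pairs $(X_j,X_j')$ have the same law for every $j$. Let $Y=X_1+\cdots+X_N$, $\widetilde{Y}=(Y-\mathbb{E}[Y])/\sqrt{\mathrm{Var}(Y)}$ and $\widetilde{Z}\sim\mathrm{N}(0,1)$. Then $$d_W(\widetilde{Y},\widetilde{Z})\leq\frac{1}{\sqrt{\mathrm{Var}(Y)}}\left(2\sigma\alpha+\frac{(1-\sigma)\,\mathbb{E}|X_1|^3}{\mathbb{E}[X_1^2]}+2\lambda(1-\sigma)\,\mathbb{E}|X_1'-X_1|\right),$$ where $$\sigma=\frac{\rho\left(\mathbb{E}[X_1^2]+\lambda\,\mathrm{Var}(X_1)\right)}{\mathbb{E}[X_1^2]+\lambda\rho\,\mathrm{Var}(X_1)},\qquad \mathrm{Var}(Y)=\lambda\,\mathbb{E}[X_1^2]+\lambda^2\rho\,\mathrm{Var}(X_1),$$ and $$\alpha=\sqrt{\lambda(1+\lambda\rho)\mathbb{E}[X_1^2]+\lambda^2(1-\rho)\mathbb{E}[X_1]^2}+\frac{(\lambda^2+3\lambda+1)\mathbb{E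}|X_1|^3-\lambda(\lambda+1)\mathbb{E}[X_1]\,\mathbb{E}[X_1^2\,\mathrm{sgn}(X_1)]}{2\left(\mathbb{E}[X_1^2]+\lambda\,\mathrm{Var}(X_1)\right)}.$$
   Context: Equally correlated model with parameter $\rho\in[0,1]$: for all $n\in\{1,2,\ldots\}$ and all real $t_1,\ldots,t_n$, $$\mathbb{E}[e^{i(t_1X_1+\cdots+t_nX_n)}]=\rho\,\mathbb{E}[e^{iX_1(t_1+\cdots+t_n)}]+(1-\rho)\prod_{j=1}^n\mathbb{E}[e^{it_jX_j}].$$ Wasserstein distance: $d_W(U,V)=\sup_{h\in\mathcal{H}_W}|\mathbb{E}h(U)-\mathbb{E}h(V)|$, where $\mathcal{H}_W$ is the set of absolutely continuous $h:\mathbb{R}\to\mathbb{R}$ with $\|h'\|\le1$ and $\|\cdot\|$ is the supremum norm. $\mathrm{sgn}(x)=1$ if $x\ge0$ and $\mathrm{sgn}(x)=-1$ otherwise; $\mathbb{E}[X_1]^2$ means $(\mathbb{E}[X_1])^2$. An empty sum is $0$. *)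

(* Defs.v *)
From mathcomp Require Export all_boot all_order all_algebra perm finmap.
From mathcomp Require Export all_classical all_reals all_analysis.
From mathcomp Require Export complex.
Set Implicit Arguments.
Unset Strict Implicit.
Unset Printing Implicit Defensive.
Import Order.TTheory GRing.Theory Num.Theory.
Import numFieldNormedType.Exports.

Local Open Scope classical_set_scope.
Local Open Scope ring_scope.

(* The convention is sgn 0 = 1, unlike Num.sg. *)
Definition sgn1 (R : realType) (x : R) : R := if 0 <= x then 1 else -1.

(* e^{ix} *)
Definition cexpi (R : realType) (x : R) : R[i] := Complex (cos x) (sin x).

Definition cexpectation d (T : measurableType d) (R : realType)
    (P : probability T R) (f : T -> R[i]) : R[i] :=
  Complex (fine 'E_P[fun w => complex.Re (f w)])
          (fine 'E_P[fun w => complex.Im (f w)]).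

(* The variables X_1, X_2, ... are X 0, X 1, ... throughout. *)
Definition equally_correlated d (T : measurableType d) (R : realType)
    (P : probability T R) (rho : R) (X : nat -> T -> R) : Prop :=
  forall (n : nat) (t : 'I_n -> R), (0 < n)%N ->
    cexpectation P (fun w => cexpi (\sum_(j < n) t j * X j w)) =
      real_complex R rho *
        cexpectation P (fun w => cexpi (X 0%N w * \sum_(j < n) t j)) +
      real_complex R (1 - rho) *
        \prod_(j < n) cexpectation P (fun w => cexpi (t j * X j w)).

Definition same_law d (T : measurableType d) d' (S : measurableType d')
    (R : realType) (P : probability T R) (U V : T -> S) : Prop :=
  forall A : set S, measurable A -> pushforward P U A = pushforward P V A.

Definition exchangeable d (T : measurableType d) (R : realType)
    (P : probability T R) (X : nat -> T -> R) : Prop :=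
  forall (n : nat) (s : 'S_n),
    same_law P (fun w => [tuple X (s i) w | i < n])
               (fun w => [tuple X i w | i < n]).

Definition mutually_independent d (T : measurableType d) (R : realType)
    (P : probability T R) (X : nat -> T -> R) : Prop :=
  forall (J : {fset nat}) (A : nat -> set R), (forall j, measurable (A j)) ->
    fine (P (\bigcap_(j in [set` J]) X j @^-1` A j)) =
    \prod_(j <- J) fine (P (X j @^-1` A j)).

Definition iid_copies d (T : measurableType d) (R : realType)
    (P : probability T R) (X' : nat -> T -> R) (X1 : T -> R) : Prop :=
  mutually_independent P X' /\ forall j, same_law P (X' j) X1.

Definition sigma_generated d (T : measurableType d) d' (S : measurableType d')
    (I : Type) (X : I -> T -> S) : set (set T) :=
  <<s \bigcup_i preimage_set_system setT (X i) measurable >>.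

Definition independent_of_process d (T : measurableType d)
    d1 (S1 : measurableType d1) d2 (S2 : measurableType d2)
    (R : realType) (P : probability T R)
    (N : T -> S1) (X : nat -> T -> S2) : Prop :=
  forall (A : set T) (B : set S1), sigma_generated X A -> measurable B ->
    P (A `&` N @^-1` B) = (P A * P (N @^-1` B))%E.

Definition absolutely_continuous (R : realType) (h : R -> R) : Prop :=
  forall e : R, 0 < e -> exists2 delta : R, 0 < delta &
    forall (n : nat) (a b : 'I_n -> R),
      (forall i, a i < b i) ->
      trivIset setT (fun i => `]a i, b i[%classic) ->
      \sum_(i < n) (b i - a i) < delta ->
      \sum_(i < n) `|h (b i) - h (a i)| < e.

(* An absolutely continuous function is differentiable almost everywhere, so
   h' is a function defined up to null sets and its supremum norm is taken
   accordingly. *)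
Definition wasserstein_class (R : realType) : set (R -> R) :=
  [set h | absolutely_continuous h /\
    {ae @lebesgue_measure R, forall x, derivable h x 1 /\ `|derive1 (h : R -> R) x| <= 1}].

Definition wasserstein d (T : measurableType d) d' (T' : measurableType d')
    (R : realType) (P : probability T R) (U : T -> R)
    (Q : probability T' R) (V : T' -> R) : \bar R :=
  ereal_sup [set `| 'E_P[h \o U] - 'E_Q[h \o V] |%E | h in @wasserstein_class R].

(* Main.v *)
Require Import Defs.
From HB Require Import structures.
From mathcomp Require Import measurable_realfun.
From mathcomp Require Import ring lra.
Set Implicit Arguments.
Unset Strict Implicit.
Unset Printing Implicit Defensive.
Import Order.TTheory GRing.Theory Num.Theory.
Import numFieldNormedType.Exports.
Local Open Scope classical_set_scope.
Local Open Scope ring_scope.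

(** Write [a] and [V] for the mean and variance of the random sum [Y]. Stein's
    method reduces the distance of [(Y - a) / sqrt V] to the standard normal law
    to a bound on [V * E f'(Y) - E ((Y - a) f(Y))], where [f'] is Lipschitz with
    constant [2 / V].

    At equal arguments, the identity that defines the equally correlated model
    says that the characteristic function of a partial sum of length [n] is
    [rho] times that of [n * X_1] plus [1 - rho] times that of an i.i.d. sum. By
    uniqueness of characteristic functions on the line, the law of [Y] is the
    mixture, with weights [rho] and [1 - rho], of the law of [W = N * X_1] and
    of the compound Poisson law of [C = X'_1 + ... + X'_N]
    ([corr_sum_law]). Both components have mean [a], so the variance of [Y] is
    the corresponding mixture of [Var W] and [Var C], and the Stein functional
    of [Y] splits in the same way ([corr_sum_stein]).

    For [W] only the moments are used. The error of replacing [f(W)]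
    by its linearisation at 0 is controlled by covariance monotonicity: the
    linearisation error grows at most as fast as [x |x| / V], so both
    [x |x| / V + error] and [x |x| / V - error] are nondecreasing and have
    a nonnegative covariance with [W] ([monotone_stein_bound]).
    Passing from [f'(0)] to [f'(Y)] costs at most [2 / V * E |Y|].

    For [C] the size-bias identity [E (C f(C)) = lambda * E (X' f(C + X'))],
    with [X'] independent of [C], and a Taylor expansion in [X'] give the
    compound Poisson bound ([iid_sum_stein]). Here [f'(C)] is replaced by
    [f'(Y)], and [E |Y - C| <= lambda * E |X'_1 - X_1|] because the two sums
    have the same number of terms ([random_sums_distance]).

    The test functions are handled by [absolutely_continuous_lipschitz], which
    makes them 1-Lipschitz, and by [stein_equation], which solves Stein's
    equation with a 2-Lipschitz derivative. *)

(** * Integrable real-valued functions *)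

Notation L1 mu f := (mu.-integrable setT (EFin \o f)).

Section real_integrable.
Context d (T : measurableType d) (R : realType) (mu : {measure set T -> \bar R}).
Implicit Types f g : T -> R.

Lemma L1_measurable f : L1 mu f -> measurable_fun setT f.
Proof. by move=> /integrableP[/measurable_EFinP]. Qed.

Lemma L1D f g : L1 mu f -> L1 mu g -> L1 mu (fun x => f x + g x).
Proof. by move=> fi gi; exact: (integrableD measurableT fi gi). Qed.

Lemma L1Z (k : R) f : L1 mu f -> L1 mu (fun x => k * f x).
Proof. by move=> fi; exact: (integrableZl measurableT k fi). Qed.

Lemma L1N f : L1 mu f -> L1 mu (fun x => - f x).
Proof. by move=> /(L1Z (-1)) fi; rewrite (_ : (fun x => - f x) = (fun x => -1 * f x)) //; apply/funext => x; rewrite mulN1r. Qed.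

Lemma L1B f g : L1 mu f -> L1 mu g -> L1 mu (fun x => f x - g x).
Proof. by move=> f1 /L1N g1; exact: L1D f1 g1. Qed.

Lemma L1_norm f : L1 mu f -> L1 mu (fun x => `|f x|).
Proof. by move=> fi; exact: (integrable_abse fi). Qed.

Lemma L1_le f g : L1 mu g -> measurable_fun setT f ->
  (forall x, `|f x| <= g x) -> L1 mu f.
Proof.
move=> ig mf fg; apply: (le_integrable _ _ _ ig) => //.
  exact/measurable_EFinP.
by move=> x _ /=; rewrite lee_fin (le_trans (fg x)) ?ler_norm.
Qed.

Lemma eq_L1 f g : f =1 g -> L1 mu f -> L1 mu g.
Proof. by move=> /funext ->. Qed.

Lemma L1_ge0P f : measurable_fun setT f -> (forall x, 0 <= f x) ->
  (\int[mu]_x (f x)%:E < +oo)%E -> L1 mu f.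
Proof.
move=> mf f0 fy; apply/integrableP; split; first exact/measurable_EFinP.
by under eq_integral do rewrite /= ger0_norm//.
Qed.

Lemma integralE_Rintegral f : L1 mu f ->
  (\int[mu]_x (f x)%:E = (\int[mu]_x f x)%:E)%E.
Proof. by move=> fi; rewrite /Rintegral fineK//; exact: integrable_fin_num. Qed.

Lemma Rintegral_le f g : L1 mu f -> L1 mu g -> (forall x, f x <= g x) ->
  \int[mu]_x f x <= \int[mu]_x g x.
Proof. by move=> fi gi fg; apply: le_Rintegral. Qed.

End real_integrable.

Lemma L1_cst d (T : measurableType d) (R : realType)
  (mu : {finite_measure set T -> \bar R}) (k : R) : L1 mu (fun=> k).
Proof. by apply: finite_measure_integrable_cst. Qed.

Lemma Rintegral_probability_cst d (T : measurableType d) (R : realType)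
  (P : probability T R) (k : R) : \int[P]_w k = k.
Proof.
rewrite (@Rintegral_cst _ _ _ P _ measurableT) (_ : fine _ = 1) ?mulr1//.
by have /(congr1 fine) := probability_setT P.
Qed.

Lemma L1_bounded d (T : measurableType d) (R : realType)
  (mu : {finite_measure set T -> \bar R}) (f : T -> R) (C : R) :
  measurable_fun setT f -> (forall x, `|f x| <= C) -> L1 mu f.
Proof. by move=> mf fC; exact: (L1_le (L1_cst mu C) mf). Qed.

Lemma sqr_sum_le (R : realDomainType) (a : nat -> R) n :
  (\sum_(j < n) a j) ^+ 2 <= n%:R * \sum_(j < n) a j ^+ 2.
Proof.
have cross m x : 2 * (\sum_(j < m) a j) * x <= \sum_(j < m) a j ^+ 2 + m%:R * x ^+ 2.
  elim: m => [|m IH]; first by rewrite !big_ord0 mulr0 !mul0r addr0.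
  rewrite !big_ord_recr /= -(addn1 m) natrD.
  by have : 0 <= (a m - x) ^+ 2 by [exact: sqr_ge0]; nra.
elim: n => [|n IH]; first by rewrite !big_ord0 expr0n mul0r.
rewrite !big_ord_recr /= -(addn1 n) natrD.
by have := cross n (a n); nra.
Qed.

Section moments.
Context d (T : measurableType d) (R : realType) (P : probability T R).

Lemma L1_cube_sqr (U : T -> R) :
  measurable_fun setT U -> L1 P (fun w => `|U w| ^+ 3) -> L1 P (fun w => U w ^+ 2).
Proof.
move=> mU U3; apply: (L1_le (L1D (L1_cst P 1) U3)); first exact: measurable_funX.
move=> w; rewrite ger0_norm ?sqr_ge0// -real_normK ?num_real//.
have := normr_ge0 (U w); set u := `|U w| => u0.
have : 0 <= u * (u - 1) ^+ 2 by rewrite mulr_ge0 ?sqr_ge0.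
by nra.
Qed.

Lemma L1_sqr_id (U : T -> R) :
  measurable_fun setT U -> L1 P (fun w => U w ^+ 2) -> L1 P U.
Proof.
move=> mU U2; apply: (L1_le (L1D (L1_cst P 1) U2)) => // w.
rewrite -[U w ^+ 2]real_normK ?num_real//.
by have := normr_ge0 (U w); set u := `|U w| => u0; nra.
Qed.

Lemma L1_mul_sqr (U V : T -> R) :
  measurable_fun setT U -> measurable_fun setT V ->
  L1 P (fun w => U w ^+ 2) -> L1 P (fun w => V w ^+ 2) -> L1 P (fun w => U w * V w).
Proof.
move=> mU mV U2 V2; apply: (L1_le (L1D U2 V2)); first exact: measurable_funM.
move=> w; rewrite normrM -[U w ^+ 2]real_normK ?num_real// -[V w ^+ 2]real_normK ?num_real//.
by nra.
Qed.

Lemma L1_sum (h : nat -> T -> R) n : (forall j, L1 P (h j)) ->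
  L1 P (fun w => \sum_(j < n) h j w) /\
  \int[P]_w (\sum_(j < n) h j w) = \sum_(j < n) \int[P]_w h j w.
Proof.
move=> h1; elim: n => [|n [IH1 IH2]].
  rewrite big_ord0; split.
    by apply: eq_L1 (L1_cst P 0) => w; rewrite big_ord0.
  by under eq_Rintegral do rewrite big_ord0; exact: Rintegral_probability_cst.
split; first by apply: eq_L1 (L1D IH1 (h1 n)) => w; rewrite big_ord_recr.
under eq_Rintegral do rewrite big_ord_recr /=.
by rewrite RintegralD// IH2 big_ord_recr.
Qed.

Lemma Rintegral_sqr_le (U : T -> R) :
  measurable_fun setT U -> L1 P (fun w => U w ^+ 2) ->
  (\int[P]_w U w) ^+ 2 <= \int[P]_w (U w ^+ 2).
Proof.
move=> mU U2; have U1 := L1_sqr_id mU U2; set m := \int[P]_w U w.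
have H : L1 P (fun w => 2 * m * U w - m ^+ 2) by exact: (L1B (L1Z _ U1) (L1_cst P _)).
have E : \int[P]_w (2 * m * U w - m ^+ 2) = m ^+ 2.
  rewrite RintegralB//; [|exact: (L1Z _ U1)|exact: L1_cst].
  by rewrite RintegralZl// Rintegral_probability_cst -/m; ring.
rewrite -E; apply: Rintegral_le => // w.
by have : 0 <= (U w - m) ^+ 2 by [exact: sqr_ge0]; lra.
Qed.

Lemma Rintegral_norm_le_sqrt (U : T -> R) :
  measurable_fun setT U -> L1 P (fun w => U w ^+ 2) ->
  \int[P]_w `|U w| <= Num.sqrt (\int[P]_w (U w ^+ 2)).
Proof.
move=> mU U2.
have nE w : `|U w| ^+ 2 = U w ^+ 2 by rewrite real_normK ?num_real.
have m0 : 0 <= \int[P]_w `|U w| by apply: Rintegral_ge0.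
rewrite -(ger0_norm m0) -sqrtr_sqr ler_wsqrtr//.
under [leRHS]eq_Rintegral do rewrite -nE.
apply: Rintegral_sqr_le; first exact: (measurableT_comp (@normr_measurable R setT) mU).
by apply: eq_L1 U2 => w; rewrite nE.
Qed.

End moments.
(** * Absolutely continuous functions with bounded derivative *)

Lemma derivable_lipschitz_near (R : realType) (h : R -> R) (x e : R) :
  0 < e -> derivable h x 1 -> `|derive1 h x| <= 1 ->
  exists2 r : R, 0 < r &
    forall y, `|y - x| < r -> `|h y - h x| <= (1 + e) * `|y - x|.
Proof.
move=> e0 dh; rewrite derive1E => h1.
have := dh; rewrite /derivable => /cvgrPdist_lt/(_ _ e0).
rewrite near_withinE => -[r /= r0 rP].
exists r => // y yx; have [->|ynx] := eqVneq y x.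
  by rewrite !subrr normr0 mulr0.
have yx0 : y - x != 0 by rewrite subr_eq0.
have yr : ball (0 : R) r (y - x) by rewrite -ball_normE /= sub0r normrN.
have := rP (y - x) yr yx0; rewrite /= [_ *: 1]mulr1 subrK -/(derive h x 1).
set q := _ *: _ => qe.
have -> : h y - h x = q * (y - x).
  by rewrite /q /= [_ *: _]mulrC mulfVK.
rewrite normrM ler_pM2r ?normr_gt0//.
have : `|q| <= `|'D_1 h x| + `|'D_1 h x - q|.
  by rewrite -[X in `|X| <= _](subKr ('D_1 h x)) ler_normB.
by lra.
Qed.

(** The supremum of the points of [[a, b]] where [G] holds can be neither
    missed nor passed: the step crosses it from some point of the set just to
    its left. Crossing [x], instead of arriving at [x], spares the case
    distinction between limits from the left and moves to the right. *)
Lemma real_induction (R : realType) (G : R -> Prop) (a b : R) : a <= b -> G a ->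
  (forall x, a <= x <= b -> exists2 r : R, 0 < r &
    forall c d, x - r < c -> d < x + r -> a <= c -> c <= x -> x <= d -> d <= b ->
      G c -> G d) ->
  G b.
Proof.
move=> ab Ga step.
pose S := [set c | a <= c <= b /\ G c].
have Sa : S a by split => //; rewrite lexx.
have hS : has_sup S by split; [exists a|exists b => c [/andP[]]].
have aS : a <= sup S by exact: ub_le_sup (proj2 hS) _ Sa.
have Sb : sup S <= b by apply: ge_sup; [exists a|move=> c [/andP[]]].
have [|r r0 rP] := step (sup S); first by rewrite aS.
have [c [/andP[ac cb] Gc] cS] := sup_adherent r0 hS.
have cs : c <= sup S by apply: ub_le_sup (proj2 hS) _ _; split => //; rewrite ac.
have [bs|sb] := leP b (sup S + r / 2).
  by apply: (rP c) => //; apply: le_lt_trans bs _; rewrite ltrD2l; lra.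
have : S (sup S + r / 2).
  split; first by apply/andP; split; lra.
  by apply: (rP c) => //; lra.
by move=> /(ub_le_sup (proj2 hS)); lra.
Qed.

(** The exceptional null set is covered by an open set [U] of measure less than
    the modulus [delta] of absolute continuity. Moving from [a] to [b], the
    increment of [h] is charged at rate [1 + e] near points of
    differentiability, and otherwise to disjoint intervals inside [U], whose
    total length is below [delta] and on which [h] varies by less than [e].
    Real induction replaces a covering argument. *)
Lemma absolutely_continuous_lipschitz (R : realType) (h : R -> R) :
  absolutely_continuous h ->
  {ae @lebesgue_measure R, forall x, derivable h x 1 /\ `|derive1 h x| <= 1} ->
  forall x y, `|h y - h x| <= `|y - x|.
Proof.
move=> ach [A [mA A0 Asub]].
suff H a b : a <= b -> `|h b - h a| <= b - a.
  move=> x y; have [/H xy|/ltW/H yx] := leP x y.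
    exact: le_trans (ler_norm _).
  by rewrite distrC [leRHS]distrC; exact: le_trans (ler_norm _).
move=> ab; apply/ler_addgt0Pr => e' e'0.
pose e := e' / (1 + (b - a)).
have ba1 : 0 < 1 + (b - a) by lra.
have e0 : 0 < e by rewrite divr_gt0.
have -> : e' = e * (1 + (b - a)) by rewrite divfK// gt_eqF.
have [delta delta0 acP] := ach e e0.
have [U [oU AU muU]] : exists U : set R, [/\ open U, A `<=` U &
    (@lebesgue_measure R U < delta%:E)%E].
  have [|U [oU AU UA]] := @lebesgue_regularity_outer R A delta mA _ delta0.
    exact: (eq_ind_r (fun z => (z < +oo)%E) (ltry 0) A0).
  exists U; split => //; rewrite -(setDUK AU) measureU//.
  - exact: (eq_ind_r (fun z => (z + _ < _)%E) (eq_ind_r (fun z => (z < _)%E) UA (add0e _)) A0).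
  - by apply: measurableD => //; exact: measurable_realfun.open_measurable.
  - by rewrite setDIK.
have mU : measurable U by exact: measurable_realfun.open_measurable.
pose len (s : seq (R * R)) : R := \sum_(p <- s) (p.2 - p.1).
pose var (s : seq (R * R)) : R := \sum_(p <- s) `|h p.2 - h p.1|.
(* [s] lists, from right to left, the intervals charged to [U] so far; their
   total length is compared with the part of [U] already passed. *)
pose G c := exists s : seq (R * R),
  [/\ all (fun p => (p.1 < p.2) && (p.2 <= c)) s,
      pairwise (fun p q => q.2 <= p.1) s,
      ((len s)%:E <= @lebesgue_measure R (U `&` `]-oo, c[%classic))%E &
      `|h c - h a| <= (1 + e) * (c - a) + var s].
have : G b.
  apply: (real_induction ab).
    exists [::]; split => //; first by rewrite /len big_nil.
    by rewrite /var big_nil !subrr normr0 mulr0 addr0.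
  move=> x /andP[ax xb].
(* An exceptional point has a neighbourhood inside [U]: the interval crossing
   it is added to the list. *)
  have [xA|xA] := pselect (A x).
    have [r /= r0 rU] := (open_nbhs_nbhs (conj oU (AU _ xA))).
    exists r => // c d rc dr ac cx xd db [s [s1 s2 s3 s4]].
    have [dc|cd] := leP d c.
      have -> : d = c by lra.
      by exists s.
    exists ((c, d) :: s); split => /=.
    - rewrite cd lexx /=; apply: sub_all s1 => p /andP[-> /=].
      by move=> /le_trans; apply; exact: ltW.
    - rewrite s2 andbT; apply: sub_all s1 => p /andP[_ //].
    - rewrite /len big_cons /= -/(len s) EFinD.
      have -> : U `&` `]-oo, d[%classic =
          (`[c, d[%classic `|` (U `&` `]-oo, c[%classic)) :> set R.
        apply/seteqP; split => z /=; rewrite !in_itv /=.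
          move=> [Uz zd]; have [cz|zc] := leP c z; first by left; rewrite zd.
          by right.
        move=> [/andP[cz zd]|[Uz zc]]; split => //.
          by apply: rU; rewrite /ball /= ltr_distlC; apply/andP; split; lra.
        by lra.
      rewrite measureU//=; last 2 first.
      - by apply: measurableI.
      - apply/seteqP; split => z //=; rewrite !in_itv /=.
        by move=> [/andP[cz _] [_ zc]]; move: (le_lt_trans cz zc); rewrite ltxx.
      rewrite lebesgue_measure_itv /= lte_fin cd.
      by apply: leeD.
    - rewrite /var big_cons /= -/(var s).
      have := ler_normD (h d - h c) (h c - h a).
      rewrite addrA subrK.
      have : (1 + e) * (c - a) <= (1 + e) * (d - a).
        by rewrite ler_pM2l; lra.
      by lra.
  have [dx h1] : derivable h x 1 /\ `|derive1 h x| <= 1.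
    by apply: contrapT => nx; apply: xA; exact: Asub.
  have [r r0 rP] := derivable_lipschitz_near e0 dx h1.
  exists r => // c d rc dr ac cx xd db [s [s1 s2 s3 s4]].
  exists s; split => //.
  - apply: sub_all s1 => p /andP[-> /=] /le_trans; apply.
    exact: le_trans cx xd.
  - apply: (le_trans s3); apply: le_measure; rewrite ?inE.
    + by apply: measurableI.
    + by apply: measurableI.
    + apply: setIS => z /=; rewrite !in_itv /= => /lt_le_trans; apply.
      exact: le_trans cx xd.
  - have hd : `|h d - h x| <= (1 + e) * (d - x).
      have := rP d; rewrite (ger0_norm (x := d - x)) ?subr_ge0//.
      by apply; lra.
    have hc : `|h c - h x| <= (1 + e) * (x - c).
      have := rP c; rewrite distrC (distrC (h c)) (ger0_norm (x := x - c)) ?subr_ge0//.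
      by apply; lra.
    have := ler_normD (h d - h x) (h x - h a).
    have := ler_normB (h x - h c) (h a - h c).
    have -> : h x - h c - (h a - h c) = h x - h a by lra.
    rewrite addrA subrK.
    have := ler_normD (h x - h c) (h c - h a).
    rewrite addrA subrK distrC in hc *.
    by nra.
move=> [s [s1 s2 s3 s4]].
suff : var s < e by move: s4; nra.
have len_s : len s < delta.
  rewrite -lte_fin; apply: (le_lt_trans s3); apply: le_lt_trans muU.
  by apply: le_measure; [rewrite inE; exact: measurableI|by rewrite inE|exact: subIsetl].
have := acP (size s) (fun i => (nth (0, 0) s i).1) (fun i => (nth (0, 0) s i).2).
rewrite -(big_mkord xpredT (fun i => (nth (0, 0) s i).2 - (nth (0, 0) s i).1)).
rewrite -(big_mkord xpredT
  (fun i => `|h (nth (0, 0) s i).2 - h (nth (0, 0) s i).1|)).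
rewrite -(big_nth (0, 0) xpredT (fun p => p.2 - p.1)).
rewrite -(big_nth (0, 0) xpredT (fun p => `|h p.2 - h p.1|)).
apply => //.
  by move=> i; have /allP/(_ _ (mem_nth (0, 0) (ltn_ord i)))/andP[] := s1.
move=> i j _ _ [z /=]; rewrite !in_itv /= => -[/andP[i1 i2] /andP[j1 j2]].
have disj k l : (k < l < size s)%N -> (nth (0, 0) s l).2 <= (nth (0, 0) s k).1.
  move=> /andP[kl ls]; move/pairwiseP : s2; apply => //.
  by rewrite inE (ltn_trans kl).
apply/val_inj => /=; case: (ltngtP i j) => // ij.
- have := disj i j; rewrite ij ltn_ord => /(_ isT) /le_lt_trans/(_ i1).
  by move=> /lt_trans/(_ j2); rewrite ltxx.
- have := disj j i; rewrite ij ltn_ord => /(_ isT) /le_lt_trans/(_ j1).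
  by move=> /lt_trans/(_ i2); rewrite ltxx.
Qed.

(** * Gaussian integrals and the Mills ratio *)

Section normal_expectation.
Context {R : realType}.
Notation mu := (@lebesgue_measure R).
Notation gamma := (@normal_prob R 0 1).
Notation phi := (@normal_pdf R 0 1).

(** The Gaussian probability is defined by integrals of its density over sets,
    so that the density is almost everywhere its Radon-Nikodym derivative. *)
Lemma ge0_integral_normal_prob (f : R -> \bar R) :
  measurable_fun setT f -> (forall x, (0 <= f x)%E) ->
  (\int[gamma]_x f x = \int[mu]_x (f x * (phi x)%:E))%E.
Proof.
move=> mf f0.
have dom : gamma `<< mu by exact: normal_prob_dominates.
rewrite -(Radon_Nikodym_SigmaFinite.change_of_variables dom f0 measurableT mf).
have mphi : measurable_fun setT (EFin \o phi).
  by apply/measurable_EFinP; exact: measurable_normal_pdf.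
have fi := Radon_Nikodym_SigmaFinite.f_integrable dom.
apply: ae_eq_integral => //.
- by apply: emeasurable_funM => //; exact: measurable_int fi.
- exact: emeasurable_funM.
- apply: ae_eqe_mul2l; apply: integral_ae_eq => //.
  by move=> E _ mE; rewrite -Radon_Nikodym_SigmaFinite.f_integral.
Qed.

Lemma integral_normal_prob (f : R -> R) : measurable_fun setT f ->
  (\int[gamma]_x (f x)%:E = \int[mu]_x (f x * phi x)%:E)%E.
Proof.
move=> mf; have mEf : measurable_fun setT (EFin \o f) by exact/measurable_EFinP.
rewrite integralE [RHS]integralE; congr (_ - _)%E.
  rewrite ge0_integral_normal_prob//; last exact: measurable_funepos.
  apply: eq_integral => x _; rewrite !funeposE.
  by rewrite maxe_pMl ?lee_fin ?normal_pdf_ge0// mul0e EFinM.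
rewrite ge0_integral_normal_prob//; last exact: measurable_funeneg.
apply: eq_integral => x _; rewrite !funenegE.
by rewrite maxe_pMl ?lee_fin ?normal_pdf_ge0// mul0e mulNe.
Qed.

Lemma normal_pdf01E x : phi x = normal_peak 1 * expR (- (x ^+ 2 / 2)).
Proof.
rewrite normal_pdfE// /normal_fun subr0 expr1n mulNr.
by congr (_ * expR (- (_ / _))).
Qed.

Lemma normal_pdf01_gt0 x : 0 < phi x.
Proof. by rewrite normal_pdf01E mulr_gt0 ?expR_gt0 ?normal_peak_gt0. Qed.

Lemma is_derive_normal_pdf01 (x : R) : is_derive x 1 phi (- x * phi x).
Proof.
have -> : phi = fun x => normal_peak 1 * expR (- (x ^+ 2 / 2)).
  by apply/funext => y; exact: normal_pdf01E.
apply: trigger_derive.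
by rewrite /= -![_ *: _]/(_ * _); field.
Qed.

Lemma normal_pdf01_peak x : phi x <= normal_peak 1.
Proof. exact: normal_pdf_ub. Qed.

(** Domination by a Gaussian density of larger variance gives the second moment
    without an integration by parts; the constant comes from
    [expR u >= 1 + u] at [u = 3 / 8 * x ^+ 2], the difference of the exponents. *)
Lemma sqr_normal_pdf01_le x :
  x ^+ 2 * phi x <= 8 / 3 * normal_peak 1 / normal_peak 2 * normal_pdf 0 2 x.
Proof.
have p1 : 0 < @normal_peak R 1 by exact: normal_peak_gt0.
have p2 : 0 < @normal_peak R 2 by exact: normal_peak_gt0.
rewrite normal_pdf01E normal_pdfE// /normal_fun subr0.
have -> : - x ^+ 2 / (2 ^+ 2 *+ 2) = - (x ^+ 2 / 2) + 3 / 8 * x ^+ 2 by field.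
rewrite expRD.
have -> : 8 / 3 * normal_peak 1 / normal_peak 2 *
    (normal_peak 2 * (expR (- (x ^+ 2 / 2)) * expR (3 / 8 * x ^+ 2))) =
  normal_peak 1 * expR (- (x ^+ 2 / 2)) * (8 / 3 * expR (3 / 8 * x ^+ 2)).
  by field; rewrite gt_eqF.
rewrite mulrC ler_pM2l ?mulr_gt0 ?expR_gt0//.
have := expR_ge1Dx (3 / 8 * x ^+ 2).
by lra.
Qed.

Lemma L1_normal_pdf (m s : R) : L1 mu (normal_pdf m s).
Proof. exact: integrable_normal_pdf. Qed.

Lemma L1_sqr_normal_pdf01 : L1 mu (fun x : R => x ^+ 2 * phi x).
Proof.
have mf : measurable_fun setT (fun x : R => x ^+ 2 * phi x).
  by apply: measurable_funM; [exact: measurable_funX|exact: measurable_normal_pdf].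
apply: (L1_le (L1Z (8 / 3 * normal_peak 1 / normal_peak 2) (L1_normal_pdf 0 2)) mf) => x.
rewrite ger0_norm; first exact: sqr_normal_pdf01_le.
by apply: mulr_ge0; [exact: sqr_ge0|exact: normal_pdf_ge0].
Qed.

Lemma L1_normal_pdf01M (g : R -> R) (a b : R) :
  measurable_fun setT g -> (forall x, `|g x| <= a + b * x ^+ 2) ->
  L1 mu (fun x => g x * phi x).
Proof.
move=> mg gab.
have mf : measurable_fun setT (fun x : R => g x * phi x).
  by apply: measurable_funM => //; exact: measurable_normal_pdf.
apply: (L1_le (L1D (L1Z a (L1_normal_pdf 0 1)) (L1Z b L1_sqr_normal_pdf01)) mf) => x.
rewrite normrM (ger0_norm (normal_pdf_ge0 _ _ _)) mulrA -mulrDl.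
by rewrite ler_wpM2r ?normal_pdf_ge0.
Qed.

Lemma is_derive_ndecr (f df : R -> R) :
  (forall x : R, is_derive x 1 f (df x)) -> (forall x, 0 <= df x) ->
  {homo f : x y / x <= y}.
Proof.
move=> fdf df0 x y; rewrite le_eqVlt => /predU1P[->//|xy].
have [|z _ fE] := @MVT R f df x y xy (fun z _ => fdf z).
- apply: derivable_within_continuous => z _.
  by have [] := fdf z.
- by rewrite -subr_ge0 fE mulr_ge0 // subr_ge0 ltW.
Qed.

Definition normal_cdf (x : R) : R := \int[mu]_(t in `]-oo, x]) phi t.

Lemma is_derive_integralNy (g : R -> R) (x : R) :
  continuous g -> mu.-integrable setT (EFin \o g) ->
  is_derive x 1 (fun y => \int[mu]_(t in `]-oo, y]) g t) (g x).
Proof.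
move=> cg ig.
have [|||dF <-] := @continuous_FTC1 R g -oo%O x (x + 1) _ _ _ (cg x).
- by rewrite ltrDl.
- by apply: integrableS ig.
- by rewrite ltNyr.
- by rewrite derive1E; exact: derivableP.
Qed.

Lemma continuous_normal_pdf01 : continuous phi.
Proof. exact: continuous_normal_pdf. Qed.

Lemma is_derive_normal_cdf (x : R) : is_derive x 1 normal_cdf (phi x).
Proof.
exact: is_derive_integralNy continuous_normal_pdf01 (L1_normal_pdf 0 1).
Qed.

Lemma Rintegral_normal_pdf01 : \int[mu]_x phi x = 1.
Proof. by rewrite /Rintegral integral_normal_pdf. Qed.

Lemma setT_itvNyS (x : R) : [set: R] = `]-oo, x] `|` `]x, +oo[.
Proof.
by apply/seteqP; split => y //= _; rewrite !in_itv/= andbT; case: leP; [left|right].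
Qed.

Lemma Rintegral_itvNyS (g : R -> R) (x : R) : L1 mu g ->
  \int[mu]_t g t = \int[mu]_(t in `]-oo, x]) g t + \int[mu]_(t in `]x, +oo[) g t.
Proof.
move=> gi; rewrite (setT_itvNyS x) Rintegral_setU//.
- by rewrite -setT_itvNyS.
- rewrite disj_set2E; apply/eqP/seteqP; split => y //=.
  by rewrite !in_itv/= andbT => -[/le_lt_trans /[apply]]; rewrite ltxx.
Qed.

Lemma normal_cdf01 x : 0 <= normal_cdf x <= 1.
Proof.
have p0 A : 0 <= \int[mu]_(t in A) phi t.
  by apply: Rintegral_ge0 => t _; exact: normal_pdf_ge0.
have := Rintegral_itvNyS x (L1_normal_pdf 0 1); rewrite Rintegral_normal_pdf01 => E.
by rewrite /normal_cdf p0 /= [leRHS]E lerDl.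
Qed.

(** The derivative of this function is [2 * phi x / (1 + x ^+ 2) ^+ 2], and its
    limits are 0 and 1. The inequalities [0 <= mills] and [mills <= 1] are the
    lower bounds of the Mills ratio of the left and of the right tail. *)
Definition mills (x : R) : R := normal_cdf x + x * phi x / (1 + x ^+ 2).

Lemma sqr1_gt0 (x : R) : 0 < 1 + x ^+ 2.
Proof. by rewrite ltr_pwDl// sqr_ge0. Qed.

Lemma mills_ndecr : {homo mills : x y / x <= y}.
Proof.
apply: (@is_derive_ndecr _ (fun x => 2 * phi x / (1 + x ^+ 2) ^+ 2)); last first.
  move=> x; apply: divr_ge0; last exact: sqr_ge0.
  by apply: mulr_ge0 => //; exact: normal_pdf_ge0.
move=> x; rewrite /mills.
have := is_derive_normal_cdf x => ?.
have := is_derive_normal_pdf01 x => ?.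
have nz : 1 + x ^+ 2 != 0 by rewrite gt_eqF// sqr1_gt0.
have dV : is_derive x 1 (fun y : R => (1 + y ^+ 2)^-1) (- (2 * x) / (1 + x ^+ 2) ^+ 2).
  have d1 : is_derive x 1 (fun y : R => 1 + y ^+ 2) (2 * x).
    by apply: trigger_derive; rewrite /= -![_ *: _]/(_ * _); ring.
  have d2 := @is_deriveV R (fun y : R => 1 + y ^+ 2) x (2 * x) 1 nz d1.
  apply: (trigger_derive d2).
  by rewrite /= -![_ *: _]/(_ * _); field.
apply: trigger_derive.
rewrite /= -![_ *: _]/(_ * _).
field.
exact: nz.
Qed.

Lemma mills_tail y : y != 0 -> `|y * phi y / (1 + y ^+ 2)| <= normal_peak 1 / `|y|.
Proof.
move=> y0; rewrite !normrM normfV (gtr0_norm (sqr1_gt0 y)).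
rewrite (ger0_norm (normal_pdf_ge0 _ _ _)).
rewrite ler_pdivrMr ?sqr1_gt0// mulrAC ler_pdivlMr ?normr_gt0//.
rewrite mulrAC -expr2 real_normK ?num_real// mulrC.
apply: ler_pM; rewrite ?sqr_ge0 ?normal_pdf_ge0 ?normal_pdf01_peak//.
by rewrite lerDr.
Qed.

(** By monotonicity, a value outside [[0, 1]] would persist up to infinity, where
    [mills_tail] and [normal_cdf01] exclude it. The point [y] is taken far
    enough for the tail to be smaller than the excess [e]. *)
Lemma mills01 x : 0 <= mills x <= 1.
Proof.
have p0 : 0 < @normal_peak R 1 by exact: normal_peak_gt0.
apply/andP; split; rewrite leNgt; apply/negP => h.
- pose e := - mills x; pose y := - (`|x| + normal_peak 1 / e + 1).
  have e0 : 0 < e by rewrite oppr_gt0.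
  have pe : 0 < normal_peak 1 / e by rewrite divr_gt0.
  have ny : `|y| = `|x| + normal_peak 1 / e + 1.
    by rewrite normrN ger0_norm// !addr_ge0// ltW.
  have xy : y <= x by rewrite /y; have := ler_norm (- x); rewrite normrN; lra.
  have y0 : 0 < `|y| by rewrite ny; have := normr_ge0 x; lra.
  have := mills_ndecr xy; have := mills_tail (y := y).
  rewrite -normr_gt0 => /(_ y0); rewrite ler_norml => /andP[+ _].
  have /andP[+ _] := normal_cdf01 y.
  rewrite /mills -/(mills x).
  have : normal_peak 1 / `|y| < e.
    rewrite ltr_pdivrMr// mulrC -ltr_pdivrMr// ny.
    by have := normr_ge0 x; lra.
  by rewrite /e; lra.
- pose e := mills x - 1; pose y := (`|x| + normal_peak 1 / e + 1).
  have e0 : 0 < e by rewrite subr_gt0.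
  have pe : 0 < normal_peak 1 / e by rewrite divr_gt0.
  have ny : `|y| = `|x| + normal_peak 1 / e + 1.
    by rewrite ger0_norm// !addr_ge0// ltW.
  have xy : x <= y by rewrite /y; have := ler_norm x; lra.
  have y0 : 0 < `|y| by rewrite ny; have := normr_ge0 x; lra.
  have := mills_ndecr xy; have := mills_tail (y := y).
  rewrite -normr_gt0 => /(_ y0); rewrite ler_norml => /andP[_ +].
  have /andP[_ +] := normal_cdf01 y.
  rewrite [mills y]/mills.
  have : normal_peak 1 / `|y| < e.
    rewrite ltr_pdivrMr// mulrC -ltr_pdivrMr// ny.
    by have := normr_ge0 x; lra.
  by rewrite /e; lra.
Qed.

End normal_expectation.

(** * Monotone functions under the Gaussian measure *)

Section stein.
Context {R : realType}.
Notation mu := (@lebesgue_measure R).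
Notation phi := (@normal_pdf R 0 1).

Lemma normr_Rintegral_le (A : set R) (g k : R -> R) :
  measurable (A : set (measurableTypeR R)) -> L1 mu g -> L1 mu k -> (forall t, 0 <= k t) ->
  (forall t, A t -> `|g t| <= k t) ->
  `|\int[mu]_(t in A) g t| <= \int[mu]_t k t.
Proof.
move=> mA gi ki k0 gk.
have giA : mu.-integrable A (EFin \o g) by apply: integrableS gi.
have kiA : mu.-integrable A (EFin \o k) by apply: integrableS ki.
apply: (le_trans (le_normr_Rintegral mA giA)).
apply: (@le_trans _ _ (\int[mu]_(t in A) k t)).
  by apply: le_Rintegral => //; exact: (integrable_abse giA).
rewrite /Rintegral fine_le//; [exact: integrable_fin_num..|].
apply: ge0_subset_integral => //.
- by have /integrableP[] := ki.
- by move=> x _; rewrite lee_fin.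
Qed.

Lemma eq0_of_le_div (z C : R) : (forall y, 1 <= y -> `|z| <= C / y) -> z = 0.
Proof.
move=> H; apply/eqP; rewrite -normr_le0 leNgt; apply/negP => z0.
have C0 : 0 <= C by have := H 1 (lexx _); rewrite divr1; exact: le_trans.
have Cz : 0 <= C / `|z| by rewrite divr_ge0.
have := H (C / `|z| + 1); rewrite lerDr => /(_ Cz).
rewrite leNgt => /negP; apply.
rewrite ltr_pdivrMr; last lra.
by rewrite mulrDr mulrCA divff ?gt_eqF// mulr1; lra.
Qed.

Lemma L1_id_normal_pdf01 : L1 mu (fun x : R => x * phi x).
Proof.
apply: (@L1_normal_pdf01M _ id 1 1) => // x.
by rewrite mul1r /= ler_norml; apply/andP; split; nra.
Qed.

Lemma normal_pdf01_tail : exists2 C : R, 0 <= C &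
  forall x : R, 1 <= `|x| -> phi x <= C / `|x|.
Proof.
pose C : R := 8 / 3 * normal_peak 1 / normal_peak 2 * normal_peak 2.
have C1 : 0 <= 8 / 3 * normal_peak 1 / normal_peak 2 :> R.
  by rewrite divr_ge0 ?mulr_ge0 ?normal_peak_ge0.
exists C; first by apply: mulr_ge0 => //; exact: normal_peak_ge0.
move=> x x1; rewrite ler_pdivlMr; last lra.
have H : x ^+ 2 * phi x <= C.
  apply: le_trans (sqr_normal_pdf01_le x) _.
  by rewrite ler_wpM2l// normal_pdf_ub.
apply: le_trans H; rewrite mulrC ler_wpM2r ?normal_pdf_ge0//.
by rewrite -real_normK ?num_real// expr2 ler_peMl.
Qed.

(** The function [K + phi], with [K] the left-hand integral, has derivative zero;
    it vanishes because both terms decay like [1 / y]. *)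
Lemma Rintegral_id_normal_pdf01 x :
  \int[mu]_(t in `]-oo, x]) (t * phi t) = - phi x /\ \int[mu]_t (t * phi t) = 0.
Proof.
pose K y := \int[mu]_(t in `]-oo, y]) (t * phi t).
pose S := \int[mu]_t (t ^+ 2 * phi t).
have Kd (y : R) : is_derive y 1 K (y * phi y).
  apply: (@is_derive_integralNy _ (fun t => t * phi t)).
    by move=> z; apply: cvgM => //; exact: continuous_normal_pdf01.
  exact: L1_id_normal_pdf01.
have Kcst y z : y <= z -> K y + phi y = K z + phi z.
  move=> yz; apply/eqP; rewrite eq_le; apply/andP; split.
    apply: (@is_derive_ndecr _ (fun y => K y + phi y) (fun=> 0)) yz => // w.
    have := Kd w => ?; have := is_derive_normal_pdf01 w => ?.
    by apply: trigger_derive; ring.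
  rewrite -lerN2.
  apply: (@is_derive_ndecr _ (fun y => - (K y + phi y)) (fun=> 0)) yz => // w.
  have := Kd w => ?; have := is_derive_normal_pdf01 w => ?.
  by apply: trigger_derive; ring.
have Ktail (A : set R) (y : R) : measurable (A : set (measurableTypeR R)) ->
    1 <= y -> (forall t, A t -> y <= `|t|) ->
    `|\int[mu]_(t in A) (t * phi t)| <= S / y.
  move=> mA y1 Ay; have y0 : 0 < y by lra.
  rewrite mulrC -RintegralZl//; last exact: L1_sqr_normal_pdf01.
  apply: normr_Rintegral_le => //.
  - exact: L1_id_normal_pdf01.
  - exact: (L1Z _ L1_sqr_normal_pdf01).
  - move=> t; apply: mulr_ge0; first by rewrite invr_ge0 ltW.
    by apply: mulr_ge0; [exact: sqr_ge0|exact: normal_pdf_ge0].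
  - move=> t /Ay yt; rewrite normrM (ger0_norm (normal_pdf_ge0 _ _ _)) mulrA.
    rewrite ler_wpM2r ?normal_pdf_ge0// ler_pdivlMl//.
    by rewrite -real_normK ?num_real// expr2 ler_wpM2r.
have [C C0 phiC] := normal_pdf01_tail.
have K0 y : K y + phi y = 0.
  apply: (@eq0_of_le_div _ (S + C)) => z z1.
  have nz : `|- `|y| - z| = `|y| + z.
    by rewrite -opprD normrN ger0_norm//; have := normr_ge0 y; lra.
  rewrite -(Kcst (- `|y| - z) y); last first.
    by have := ler_norm (- y); rewrite normrN; lra.
  rewrite mulrDl (le_trans (ler_normD _ _))// lerD//.
    apply: Ktail => // t /=; rewrite in_itv/= => tz.
    by have := ler_norm (- t); have := normr_ge0 y; rewrite normrN; lra.
  rewrite (ger0_norm (normal_pdf_ge0 _ _ _)).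
  apply: (le_trans (phiC _ _)); rewrite nz; first by have := normr_ge0 y; lra.
  rewrite ler_wpM2l// lef_pV2 ?posrE; have := normr_ge0 y; lra.
split; first by rewrite -/(K x); apply/eqP; rewrite -addr_eq0 K0.
apply: (@eq0_of_le_div _ (S + C)) => z z1.
rewrite (Rintegral_itvNyS z L1_id_normal_pdf01) -/(K z) mulrDl.
rewrite addrC (le_trans (ler_normD _ _))// lerD//.
  by apply: Ktail => // t /=; rewrite in_itv/= andbT => zt;
    rewrite (le_trans (ltW zt))// ler_norm.
have -> : K z = - phi z by apply/eqP; rewrite -addr_eq0 K0.
rewrite normrN (ger0_norm (normal_pdf_ge0 _ _ _)).
have zz : `|z| = z by rewrite ger0_norm; lra.
by rewrite -[X in _ / X]zz phiC// zz.
Qed.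

(** With [A <= 0] and [B >= 0] the Gaussian masses of [g - g x] on the left and on
    the right of [x], the quantity equals
    [(1 + x ^+ 2) * (A * (1 - mills x) - B * mills x)]. Up to the factor [phi x] it
    is the derivative at [x] of [x f(x)], for [f] the solution of Stein's
    equation with right-hand side [g]. *)
Lemma stein_ndecr_le0 (g : R -> R) (x : R) : {homo g : a b / a <= b} ->
  L1 mu (fun t => g t * phi t) ->
  let Ng := \int[mu]_t (g t * phi t) in
  (1 + x ^+ 2) * (\int[mu]_(t in `]-oo, x]) ((g t - Ng) * phi t)) +
    x * (g x - Ng) * phi x <= 0.
Proof.
move=> ndg gi; set Ng := (X in let _ := X in _); rewrite /=; set k := g x.
have ki : L1 mu (fun t => (g t - k) * phi t).
  apply: eq_L1 (L1B gi (L1Z k (L1_normal_pdf 0 1))) => t /=.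
  by rewrite mulrBl.
pose A := \int[mu]_(t in `]-oo, x]) ((g t - k) * phi t).
pose B := \int[mu]_(t in `]x, +oo[) ((g t - k) * phi t).
have A0 : A <= 0.
  rewrite -oppr_ge0 -mulN1r /A -RintegralZl//; last exact: integrableS ki.
  apply: Rintegral_ge0 => t /=; rewrite in_itv/= => tx.
  by rewrite mulN1r -mulNr mulr_ge0 ?normal_pdf_ge0// opprB subr_ge0 ndg.
have B0 : 0 <= B.
  apply: Rintegral_ge0 => t /=; rewrite in_itv/= andbT => /ltW xt.
  by rewrite mulr_ge0 ?normal_pdf_ge0// subr_ge0 ndg.
have AB : A + B = Ng - k.
  rewrite /A /B -Rintegral_itvNyS//.
  under eq_Rintegral do rewrite mulrBl.
  rewrite RintegralB//; last exact: (L1Z k (L1_normal_pdf 0 1)).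
  rewrite RintegralZl//; last exact: (L1_normal_pdf 0 1).
  by rewrite Rintegral_normal_pdf01 mulr1.
have -> : \int[mu]_(t in `]-oo, x]) ((g t - Ng) * phi t) =
    A - (A + B) * normal_cdf x.
  rewrite AB /normal_cdf -RintegralZl//; last first.
    by apply: integrableS (L1_normal_pdf 0 1).
  rewrite /A -RintegralB//.
  - by apply: eq_Rintegral => t _; ring.
  - exact: integrableS ki.
  - by apply: integrableS (L1Z (Ng - k) (L1_normal_pdf 0 1)).
have /andP[M0 M1] := mills01 x.
have nz : 1 + x ^+ 2 != 0 by rewrite gt_eqF// sqr1_gt0.
have -> : (1 + x ^+ 2) * (A - (A + B) * normal_cdf x) + x * (k - Ng) * phi x =
    (1 + x ^+ 2) * (A * (1 - mills x) - B * mills x).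
  have -> : k - Ng = - (A + B) by rewrite AB opprB.
  by rewrite /mills; field.
by rewrite pmulr_rle0 ?sqr1_gt0//; nra.
Qed.

End stein.

(** * Stein's equation *)

Section stein_equation.
Context {R : realType}.
Notation mu := (@lebesgue_measure R).
Notation phi := (@normal_pdf R 0 1).
Variable h : R -> R.
Hypothesis h_lip : forall x y, `|h y - h x| <= `|y - x|.

Lemma lipschitz1_continuous : continuous h.
Proof.
move=> x; apply/cvgrPdist_le => e e0; near=> y.
apply: le_trans (h_lip y x) _.
by near: y; apply: cvgr_dist_le.
Unshelve. all: by end_near. Qed.

Lemma lipschitz1_growth x : `|h x| <= `|h 0| + `|x|.
Proof.
have := h_lip 0 x; rewrite subr0.
by have := ler_normD (h x - h 0) (h 0); rewrite subrK; lra.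
Qed.

Lemma L1_lipschitz_normal_pdf01 : L1 mu (fun x => h x * phi x).
Proof.
apply: (@L1_normal_pdf01M _ _ (`|h 0| + 1) 1).
  exact: continuous_measurable_fun lipschitz1_continuous.
move=> x; apply: le_trans (lipschitz1_growth x) _.
rewrite -addrA lerD2l mul1r -real_normK ?num_real//.
by have := normr_ge0 x; nra.
Qed.

Let c := \int[mu]_x (h x * phi x).
Let F x := \int[mu]_(t in `]-oo, x]) ((h t - c) * phi t).
(** The second factor is [1 / phi x]. *)
Definition stein_solution x := F x * ((normal_peak 1)^-1 * expR (x ^+ 2 / 2)).
Let f := stein_solution.

Let Fi : L1 mu (fun t => (h t - c) * phi t).
Proof.
apply: eq_L1 (L1B L1_lipschitz_normal_pdf01 (L1Z c (L1_normal_pdf 0 1))) => t /=.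
by rewrite mulrBl.
Qed.

Let phi_inv x : phi x * ((normal_peak 1)^-1 * expR (x ^+ 2 / 2)) = 1.
Proof.
rewrite normal_pdf01E mulrACA divff ?mul1r ?gt_eqF ?normal_peak_gt0//.
by rewrite -expRD addNr expR0.
Qed.

Let f_phi x : f x * phi x = F x.
Proof. by rewrite /f /stein_solution -mulrA [X in _ * X]mulrC phi_inv mulr1. Qed.

Lemma is_derive_stein (x : R) : is_derive x 1 f (h x - c + x * f x).
Proof.
have Fd : is_derive x 1 F ((h x - c) * phi x).
  apply: (@is_derive_integralNy _ (fun t => (h t - c) * phi t)) => //.
  move=> y; apply: cvgM; last exact: continuous_normal_pdf01.
  by apply: cvgB; [exact: lipschitz1_continuous|exact: cvg_cst].
rewrite /f /stein_solution; apply: trigger_derive.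
rewrite /= -![_ *: _]/(_ * _).
have := phi_inv x; set u := (normal_peak 1)^-1; set v := expR _ => uv.
transitivity ((h x - c) * (phi x * (u * v)) + x * (F x * (u * v))).
  by field.
by rewrite uv mulr1.
Qed.

Let Rintegral_addl (s : R) (A : set R) : measurable (A : set (measurableTypeR R)) ->
  \int[mu]_(t in A) ((t + s * h t) * phi t) =
  \int[mu]_(t in A) (t * phi t) + s * \int[mu]_(t in A) (h t * phi t).
Proof.
move=> mA.
rewrite -RintegralZl//; last by apply: integrableS L1_lipschitz_normal_pdf01.
rewrite -RintegralD//.
- by apply: eq_Rintegral => t _; ring.
- by apply: integrableS L1_id_normal_pdf01.
- by apply: integrableS (L1Z s L1_lipschitz_normal_pdf01).
Qed.

(** The expression is the derivative of [x f(x)]. It is linear in [h], and for the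
    function [t] it is the constant -1; since [t + h t] and [t - h t] are
    nondecreasing, [stein_ndecr_le0] bounds it on both sides. *)
Lemma stein_key (x : R) : `|(1 + x ^+ 2) * f x + x * (h x - c)| <= 1.
Proof.
have [K1 K0] := Rintegral_id_normal_pdf01 x.
have phi0 := normal_pdf01_gt0 x.
suff H s : `|s| = 1 -> s * ((1 + x ^+ 2) * f x + x * (h x - c)) <= 1.
  rewrite ler_norml; apply/andP; split.
    by have := H (-1); rewrite normrN normr1 => /(_ erefl); lra.
  by have := H 1; rewrite normr1 => /(_ erefl); lra.
move=> s1.
have nd : {homo (fun t => t + s * h t) : a b / a <= b}.
  move=> a b ab; rewrite -subr_ge0.
  have -> : b + s * h b - (a + s * h a) = (b - a) + s * (h b - h a) by ring.
  have := h_lip a b; rewrite (ger0_norm (x := b - a)) ?subr_ge0// => hab.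
  have := ler_norm (- (s * (h b - h a))); rewrite normrN normrM s1 mul1r.
  by lra.
have gi : L1 mu (fun t => (t + s * h t) * phi t).
  apply: eq_L1 (L1D L1_id_normal_pdf01 (L1Z s L1_lipschitz_normal_pdf01)) => t /=.
  by ring.
have := stein_ndecr_le0 x nd gi.
rewrite /= (Rintegral_addl s measurableT) K0 add0r -/c.
have -> : \int[mu]_(t in `]-oo, x]) ((t + s * h t - s * c) * phi t) =
    - phi x + s * F x.
  have FiA : mu.-integrable `]-oo, x] (EFin \o (fun t => (h t - c) * phi t)).
    by apply: integrableS Fi.
  rewrite -K1 /F -(RintegralZl s _ FiA)//.
  rewrite -RintegralD//.
  - by apply: eq_Rintegral => t _; ring.
  - by apply: integrableS L1_id_normal_pdf01.
  - by apply: integrableS (L1Z s Fi).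
rewrite -f_phi => H.
have : phi x * (s * ((1 + x ^+ 2) * f x + x * (h x - c)) - 1) <= 0.
  by move: H; congr (_ <= 0); ring.
by rewrite pmulr_rle0// subr_le0.
Qed.

Lemma stein_solution_bounded x : `|f x| <= 1 + (1 + `|h 0 - c|).
Proof.
have h0 := sqr1_gt0 x.
rewrite -(ler_pM2l h0) -{1}(gtr0_norm h0) -normrM.
have -> : (1 + x ^+ 2) * f x = ((1 + x ^+ 2) * f x + x * (h x - c)) - x * (h x - c).
  by ring.
apply: (le_trans (ler_normB _ _)).
have := stein_key x; set u := `|_|; set v := `|x * _| => u1.
have : v <= `|x| * (`|x| + `|h 0 - c|).
  rewrite /v normrM ler_wpM2l//.
  have := ler_normD (h x - h 0) (h 0 - c); rewrite addrA subrK.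
  by have := h_lip 0 x; rewrite subr0; lra.
have xx : `|x| ^+ 2 = x ^+ 2 by rewrite real_normK ?num_real.
rewrite -xx; set k := `|h 0 - c|; have k0 : 0 <= k by exact: normr_ge0.
have := normr_ge0 x; set a := `|x| => a0.
have : 0 <= k * (1 + a ^+ 2 - a) by apply: mulr_ge0 => //; nra.
have : 0 <= a ^+ 2 by apply: sqr_ge0.
by nra.
Qed.

(** Both [h] and [x f(x)] are 1-Lipschitz, the latter by [stein_key]. *)
Lemma stein_derivative_lipschitz x y :
  `|(h y - c + y * f y) - (h x - c + x * f x)| <= 2 * `|y - x|.
Proof.
have xf_lip a b : a <= b -> `|b * f b - a * f a| <= b - a.
  move=> ab.
  pose g (z : R) := z * f z; pose g1 (z : R) := (1 + z ^+ 2) * f z + z * (h z - c).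
  have dg (z : R) : is_derive z 1 g (g1 z).
    have := is_derive_stein z => ?; rewrite /g.
    by apply: trigger_derive; rewrite /= /g1 -![_ *: _]/(_ * _); ring.
  have g1_le (z : R) : -1 <= g1 z <= 1 by rewrite -ler_norml; exact: stein_key.
  rewrite -![_ * f _]/(g _) ler_norml; apply/andP; split.
    have : a + g a <= b + g b; last lra.
    apply: (@is_derive_ndecr _ (fun z => z + g z) (fun z => 1 + g1 z)) ab => z.
    by have := g1_le z; lra.
  have : a - g a <= b - g b; last lra.
  apply: (@is_derive_ndecr _ (fun z => z - g z) (fun z => 1 - g1 z)) ab => z.
  by have := g1_le z; lra.
have xf_lip' : `|y * f y - x * f x| <= `|y - x|.
  have [/xf_lip H|/ltW/xf_lip H] := leP x y.
    exact: le_trans (ler_norm _).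
  by rewrite distrC [leRHS]distrC; exact: le_trans (ler_norm _).
have -> : (h y - c + y * f y) - (h x - c + x * f x) =
  (h y - h x) + (y * f y - x * f x) by ring.
apply: (le_trans (ler_normD _ _)).
by have := h_lip x y; lra.
Qed.

End stein_equation.

(** The second derivative bound 2 is the classical one; it is stated as a Lipschitz
    bound because [f1] need not be differentiable where [h] is not. *)
Lemma stein_equation (R : realType) (h : R -> R) :
  (forall x y, `|h y - h x| <= `|y - x|) ->
  exists f f1 : R -> R, exists M : R,
    [/\ (forall x : R, is_derive x 1 f (f1 x)),
        (forall x y, `|f1 y - f1 x| <= 2 * `|y - x|),
        (forall x, `|f x| <= M) &
        forall x, f1 x - x * f x =
          h x - \int[@lebesgue_measure R]_x (h x * normal_pdf 0 1 x)].
Proof.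
move=> hl; pose c := \int[@lebesgue_measure R]_x (h x * normal_pdf 0 1 x).
exists (stein_solution h), (fun x => h x - c + x * stein_solution h x).
exists (1 + (1 + `|h 0 - c|)); split.
- by move=> x; exact: is_derive_stein.
- by move=> x y; exact: stein_derivative_lipschitz.
- by move=> x; exact: stein_solution_bounded.
- by move=> x; rewrite addrK.
Qed.

(** * Uniqueness of characteristic functions *)

Lemma tonelli_restrict d1 d2 (T1 : measurableType d1) (T2 : measurableType d2)
    (R : realType) (m1 : {sigma_finite_measure set T1 -> \bar R})
    (m2 : {sigma_finite_measure set T2 -> \bar R}) (D : set T2)
    (f : T1 -> T2 -> R) : measurable D ->
  measurable_fun setT (fun z : T1 * T2 => f z.1 z.2) ->
  (forall x y, 0 <= f x y) ->
  (\int[m1]_x \int[m2]_(y in D) (f x y)%:E =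
   \int[m2]_(y in D) \int[m1]_x (f x y)%:E)%E.
Proof.
move=> mD mf f0.
transitivity (\int[m1]_x \int[m2]_y (f x y * \1_D y)%:E)%E.
  apply: eq_integral => x _; rewrite integral_mkcond; apply: eq_integral => y _.
  by rewrite restrict_EFin patch_indic.
rewrite (fubini_tonelli (fun z => (f z.1 z.2 * \1_D z.2)%:E)).
- rewrite [RHS]integral_mkcond; apply: eq_integral => y _ /=.
  rewrite patchE indicE; case: ifPn => yD.
    by apply: eq_integral => x _; rewrite mulr1.
  by apply: integral0_eq => x _; rewrite mulr0.
- apply/measurable_EFinP; apply: measurable_funM => //.
  by apply: measurableT_comp => //; exact: measurable_snd.
- by move=> z; rewrite lee_fin mulr_ge0.
Qed.

Section kernels.
Context {R : realType}.
Notation mu := (@lebesgue_measure R).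

(** Adding 1 to the cosine makes the integrand nonnegative, so that Tonelli's
    theorem applies below without any integrability condition. *)
Lemma laplace_cos (e z : R) : 0 < e ->
  (\int[mu]_(t in `[0%R, +oo[) (expR (- (e * t)) * (1 + cos (t * z)))%:E =
   (e^-1 + e / (e ^+ 2 + z ^+ 2))%:E)%E.
Proof.
move=> e0.
have ez0 : e ^+ 2 + z ^+ 2 != 0 by rewrite gt_eqF// ltr_pwDl ?exprn_gt0 ?sqr_ge0.
have en0 : e != 0 by rewrite gt_eqF.
pose F t := expR (- (e * t)) *
  ((z * sin (t * z) - e * cos (t * z)) / (e ^+ 2 + z ^+ 2) - e^-1).
pose f t := expR (- (e * t)) * (1 + cos (t * z)).
have dF (t : R) : is_derive t 1 F (f t).
  rewrite /F; apply: trigger_derive.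
  rewrite /= -![_ *: _]/(_ * _) /f.
  by field; rewrite en0 ez0.
have df (t : R) : derivable f t 1 by [].
have cF (t : R) : {for t, continuous F}.
  by apply: differentiable_continuous; apply/derivable1_diffP; have [] := dF t.
rewrite (@ge0_continuous_FTC2y _ f F 0 0).
- by rewrite /F !mul0r sin0 cos0 mulr0 oppr0 expR0 -EFinB; congr EFin; field; rewrite ez0.
- move=> x _; apply: mulr_ge0; first exact: expR_ge0.
  by have := cos_geN1 (x * z); lra.
- apply: derivable_within_continuous => x _; exact: df.
- pose C : R := (`|z| + e) / (e ^+ 2 + z ^+ 2) + e^-1.
  have FC t : `|F t| <= C * expR (- (e * t)).
    rewrite /F normrM (ger0_norm (expR_ge0 _)) mulrC ler_wpM2r ?expR_ge0//.
    apply: (le_trans (ler_normB _ _)); rewrite /C.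
    rewrite (gtr0_norm (x := e^-1)) ?invr_gt0// lerD2r.
    rewrite normrM normfV (gtr0_norm (x := e ^+ 2 + z ^+ 2)); last first.
      by rewrite ltr_pwDl ?exprn_gt0 ?sqr_ge0.
    rewrite ler_wpM2r ?invr_ge0 ?addr_ge0 ?sqr_ge0//.
    apply: (le_trans (ler_normB _ _)); rewrite !normrM lerD//.
      by rewrite ler_piMr// sin_max.
    by rewrite gtr0_norm// ler_piMr ?cos_max// ltW.
  have H : (fun t => C * expR (- (e * t))) t @[t --> +oo] --> (0 : R).
    rewrite -(mulr0 C); apply: cvgM; first exact: cvg_cst.
    apply: (@cvg_comp _ _ _ (fun t : R => e * t) (fun u => expR (- u)) _ (+oo)%R); last exact: cvgr_expR.
    by apply: (@gt0_cvgMry _ _ _ e id e0); exact: cvg_id.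
  apply: (@squeeze_cvgr _ _ _ _ (fun t => - (C * expR (- (e * t))))
      (fun t => C * expR (- (e * t))) F _ _ _ H).
    by near=> t; rewrite -ler_norml; exact: FC.
  by rewrite -oppr0; exact: (cvgN H).
- by move=> x _; have [] := dF x.
- by apply: cvg_at_right_filter; exact: cF.
- by move=> x _; rewrite derive1E; have [_ ->] := dF x.
Unshelve. all: by end_near. Qed.

Lemma integral_cauchy_kernel (a b e y : R) : 0 < e -> a < b ->
  (\int[mu]_(x in `[a, b]) (e^-1 + e / (e ^+ 2 + (x - y) ^+ 2))%:E =
   ((b - a) / e + (atan ((b - y) / e) - atan ((a - y) / e)))%:E)%E.
Proof.
move=> e0 ab.
have en0 : e != 0 by rewrite gt_eqF.
pose F x := x / e + atan ((x - y) / e).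
pose f x := e^-1 + e / (e ^+ 2 + (x - y) ^+ 2).
have ez0 x : e ^+ 2 + (x - y) ^+ 2 != 0.
  by rewrite gt_eqF// ltr_pwDl ?exprn_gt0 ?sqr_ge0.
have dF (x : R) : is_derive x 1 F (f x).
  rewrite /F; apply: trigger_derive.
  rewrite /= -![_ *: _]/(_ * _) /f; field.
  by rewrite en0 ez0.
have df (x : R) : derivable f x 1.
  have d1 : is_derive x 1 (fun y0 : R => e ^+ 2 + (y0 - y) ^+ 2) (2 * (x - y)).
    by apply: trigger_derive; rewrite /= -![_ *: _]/(_ * _); ring.
  have d2 := @is_deriveV R (fun y0 : R => e ^+ 2 + (y0 - y) ^+ 2) x _ 1 (ez0 x) d1.
  apply: derivableD; first exact: derivable_cst.
  by apply: derivableM; [exact: derivable_cst|have [] := d2].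
have cF (t : R) : {for t, continuous F}.
  by apply: differentiable_continuous; apply/derivable1_diffP; have [] := dF t.
rewrite (@continuous_FTC2 _ f F)//.
- by rewrite -EFinB; congr EFin; rewrite /F; field.
- apply: derivable_within_continuous => x _; exact: df.
- split; first by move=> x _; have [] := dF x.
    by apply: cvg_at_right_filter; exact: cF.
  by apply: cvg_at_left_filter; exact: cF.
- by move=> x _; rewrite derive1E; have [_ ->] := dF x.
Qed.
End kernels.

Lemma bounded_cvg_Rintegral d (T : measurableType d) (R : realType)
  (mu : {finite_measure set T -> \bar R}) (f_ : nat -> T -> R) (f : T -> R) (C : R) :
  (forall n, measurable_fun setT (f_ n)) -> measurable_fun setT f ->
  (forall n x, `|f_ n x| <= C) -> (forall x, f_ ^~ x @ \oo --> f x) ->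
  (fun n => \int[mu]_x f_ n x) @ \oo --> \int[mu]_x f x.
Proof.
move=> mf_ mf fC ff.
have [|||||fi _] := @dominated_convergence _ _ _ mu _ measurableT
  (fun n => EFin \o f_ n) (EFin \o f) (cst C%:E).
- by move=> n; exact/measurable_EFinP.
- exact/measurable_EFinP.
- apply: aeW => x _; apply: cvg_EFin; first exact: nearW.
  exact: ff.
- exact: L1_cst.
- by apply: aeW => x n _; rewrite lee_fin.
by rewrite (integralE_Rintegral fi) => /fine_cvg.
Qed.

Section cauchy_smoothing.
Context {R : realType}.
Notation mu := (@lebesgue_measure R).
Variables m1 m2 : {finite_measure set R -> \bar R}.
Hypothesis cosE : forall t : R, \int[m1]_y cos (t * y) = \int[m2]_y cos (t * y).
Hypothesis sinE : forall t : R, \int[m1]_y sin (t * y) = \int[m2]_y sin (t * y).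

Let mcos (t : R) : measurable_fun setT (fun y : R => cos (t * y)).
Proof.
apply: measurableT_comp; last exact: measurable_funM.
exact: continuous_measurable_fun (@continuous_cos R).
Qed.

Let msin (t : R) : measurable_fun setT (fun y : R => sin (t * y)).
Proof.
apply: measurableT_comp; last exact: measurable_funM.
exact: continuous_measurable_fun (@continuous_sin R).
Qed.

Let massE : \int[m1]_y 1 = \int[m2]_y 1 :> R.
Proof.
have := cosE 0; under eq_Rintegral do rewrite mul0r cos0.
by under [in RHS]eq_Rintegral do rewrite mul0r cos0.
Qed.

(** The last two terms only involve the characteristic function of [m], by the
   addition formula of the cosine. *)
Let trigE (m : {finite_measure set R -> \bar R}) (e t x : R) :
  (\int[m]_y (expR (- (e * t)) * (1 + cos (t * (x - y))))%:E =
   (expR (- (e * t)) * (\int[m]_y 1 + (cos (t * x) * \int[m]_y cos (t * y) +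
     sin (t * x) * \int[m]_y sin (t * y))))%:E)%E.
Proof.
have ic : L1 m (fun y => cos (t * y)).
  by apply: (L1_bounded _ (C := 1)) => // y; exact: cos_max.
have iS : L1 m (fun y => sin (t * y)).
  by apply: (L1_bounded _ (C := 1)) => // y; exact: sin_max.
have i1 : L1 m (fun=> 1) by exact: L1_cst.
have iD := L1D (L1Z (cos (t * x)) ic) (L1Z (sin (t * x)) iS).
have iE := L1Z (expR (- (e * t))) (L1D i1 iD).
rewrite -RintegralZl// -(RintegralZl (sin (t * x)) _ iS)// -RintegralD//; last 2 first.
- exact: (L1Z (cos (t * x)) ic).
- exact: (L1Z (sin (t * x)) iS).
rewrite -RintegralD// -RintegralZl//; last exact: (L1D i1 iD).
rewrite -(integralE_Rintegral iE); apply: eq_integral => y _.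
by rewrite mulrBr cosB.
Qed.

(** The Cauchy kernel is a Laplace transform of cosines, hence its integral
    against [m] is determined by the characteristic function of [m]. *)
Let kernelE (m : {finite_measure set R -> \bar R}) (e x : R) : 0 < e ->
  (\int[m]_y (e^-1 + e / (e ^+ 2 + (x - y) ^+ 2))%:E =
   \int[mu]_(t in `[0%R, +oo[)
     (expR (- (e * t)) * (\int[m]_y 1 + (cos (t * x) * \int[m]_y cos (t * y) +
     sin (t * x) * \int[m]_y sin (t * y))))%:E)%E.
Proof.
move=> e0; under eq_integral do rewrite -laplace_cos//.
rewrite (@tonelli_restrict _ _ R (measurableTypeR R) R m mu _ (fun y t => expR (- (e * t)) * (1 + cos (t * (x - y)))))//.
- by apply: eq_integral => t _; exact: trigE.
  apply: measurable_funM.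
    apply: measurableT_comp => //; apply: measurableT_comp => //.
    by apply: measurable_funM => //; exact: measurable_snd.
  apply: measurable_funD => //; apply: measurableT_comp.
    exact: continuous_measurable_fun (@continuous_cos R).
  apply: measurable_funM; first exact: measurable_snd.
  by apply: measurable_funB => //; exact: measurable_fst.
Qed.

Let kernel_eq (e x : R) : 0 < e ->
  (\int[m1]_y (e^-1 + e / (e ^+ 2 + (x - y) ^+ 2))%:E =
   \int[m2]_y (e^-1 + e / (e ^+ 2 + (x - y) ^+ 2))%:E)%E.
Proof.
move=> e0; rewrite !kernelE//; apply: eq_integral => t _.
by rewrite massE cosE sinE.
Qed.

(** Up to the factor [pi], the indicator function of [[a, b]] convolved with the
    Cauchy law of scale [e]. *)
Definition smooth_step (e a b y : R) : R := atan ((b - y) / e) - atan ((a - y) / e).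

Lemma measurable_smooth_step (e a b : R) : measurable_fun setT (smooth_step e a b).
Proof.
have matan : measurable_fun setT (@atan R).
  by apply: continuous_measurable_fun => x; exact: continuous_atan.
by apply: measurable_funB; apply: measurableT_comp => //; apply: measurable_funM => //;
  apply: measurable_funB.
Qed.

Lemma smooth_step_le (e a b y : R) : `|smooth_step e a b y| <= pi.
Proof.
rewrite /smooth_step.
have := atan_gtNpi2 ((b - y) / e); have := atan_ltpi2 ((b - y) / e).
have := atan_gtNpi2 ((a - y) / e); have := atan_ltpi2 ((a - y) / e).
by rewrite ler_norml; lra.
Qed.

Lemma smooth_eq (e a b : R) : 0 < e -> a < b ->
  \int[m1]_y smooth_step e a b y = \int[m2]_y smooth_step e a b y.
Proof.
move=> e0 ab.
have mk : measurable_fun setT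
    (fun z : R * measurableTypeR R => e^-1 + e / (e ^+ 2 + (z.2 - z.1) ^+ 2)).
  apply: measurable_funD => //.
  have ck : continuous (fun u : R => e / (e ^+ 2 + u ^+ 2)).
    move=> u; apply: cvgM; first exact: cvg_cst.
    apply: cvgV; first by rewrite gt_eqF// ltr_pwDl ?exprn_gt0 ?sqr_ge0.
    by apply: cvgD; [exact: cvg_cst|exact: exprn_continuous].
  apply: (@measurableT_comp _ _ _ _ _ _ (fun u : R => e / (e ^+ 2 + u ^+ 2)) _ (fun z : R * measurableTypeR R => z.2 - z.1)).
    exact: continuous_measurable_fun ck.
  by apply: measurable_funB; [exact: measurable_snd|exact: measurable_fst].
have step (m : {finite_measure set R -> \bar R}) :
    (\int[mu]_(x in `[a, b]) \int[m]_y (e^-1 + e / (e ^+ 2 + (x - y) ^+ 2))%:E =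
     ((b - a) / e * \int[m]_y 1 + \int[m]_y smooth_step e a b y)%:E)%E.
  rewrite -(@tonelli_restrict _ _ R (measurableTypeR R) R m mu _ (fun y x => e^-1 + e / (e ^+ 2 + (x - y) ^+ 2)))//.
    have i1 : L1 m (fun=> 1) by exact: L1_cst.
    have i2 : L1 m (smooth_step e a b).
      by apply: (@L1_bounded _ _ _ _ _ pi (@measurable_smooth_step _ _ _) (@smooth_step_le _ _ _)).
    rewrite -RintegralZl// -RintegralD//; last exact: (L1Z _ i1).
    rewrite -(integralE_Rintegral (L1D (L1Z _ i1) i2)).
    by apply: eq_integral => y _; rewrite integral_cauchy_kernel// mulr1.
  move=> y x; apply: addr_ge0; first by rewrite invr_ge0 ltW.
  by rewrite divr_ge0 ?ltW// ltr_pwDl ?exprn_gt0 ?sqr_ge0.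
have : (\int[mu]_(x in `[a, b]) \int[m1]_y (e^-1 + e / (e ^+ 2 + (x - y) ^+ 2))%:E =
   \int[mu]_(x in `[a, b]) \int[m2]_y (e^-1 + e / (e ^+ 2 + (x - y) ^+ 2))%:E)%E.
  by apply: eq_integral => x _; exact: kernel_eq.
by rewrite !step massE => -[/addrI].
Qed.

End cauchy_smoothing.

Section characteristic_uniqueness.
Context {R : realType}.
Variables m1 m2 : {finite_measure set R -> \bar R}.
Hypothesis cosE : forall t : R, \int[m1]_y cos (t * y) = \int[m2]_y cos (t * y).
Hypothesis sinE : forall t : R, \int[m1]_y sin (t * y) = \int[m2]_y sin (t * y).

Let cvg_atany (u : nat -> R) : (\forall n \near \oo, n%:R <= u n) ->
  atan (u n) @[n --> \oo] --> pi / 2.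
Proof.
move=> nu; apply: (@cvg_comp _ _ _ u (@atan R) _ (+oo)%R); last exact: cvgy_atan.
exact: ger_cvgy nu cvgr_idn.
Qed.

Let cvg_atanNy (u : nat -> R) : (\forall n \near \oo, u n <= - n%:R) ->
  atan (u n) @[n --> \oo] --> - (pi / 2).
Proof.
move=> nu; rewrite (_ : (fun n => atan (u n)) = (fun n => - atan (- u n))).
  apply: cvgN; apply: cvg_atany.
  by apply: filterS nu => n; rewrite lerNr.
by apply/funext => n; rewrite atanN opprK.
Qed.

(** As [n] grows the smoothed indicators tend to [pi] times the indicator of the
    ray. The left end exceeds [b] by [1 / n], much more than the scale
    [n ^- 2], so that the limit at the end point [b] itself is 0 and not
    [pi / 2]. *)
Let ray_eq (b : R) : m1 `]b, +oo[%classic = m2 `]b, +oo[%classic.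
Proof.
pose s (n : nat) (y : R) : R := atan (((`|b| + n%:R + 2) - y) / (n.+1%:R ^- 2)) -
  atan (((b + n.+1%:R^-1) - y) / (n.+1%:R ^- 2)).
have sE n : \int[m1]_y s n y = \int[m2]_y s n y.
  apply: (smooth_eq cosE sinE); first by rewrite invr_gt0 exprn_gt0.
  have n1 : n.+1%:R^-1 <= 1 :> R by rewrite invf_le1// ler1n.
  have n0 : 0 <= n%:R :> R by [].
  rewrite -addrA; apply: ler_ltD; first exact: ler_norm.
  by rewrite (le_lt_trans n1)// ltr_wpDl// ltr1n.
have cv (m : {finite_measure set R -> \bar R}) :
    (fun n => \int[m]_y s n y) @ \oo --> \int[m]_y (pi * \1_(`]b, +oo[%classic) y).
  apply: (bounded_cvg_Rintegral (C := pi)).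
  - by move=> n; exact: measurable_smooth_step.
  - by apply: measurable_funM.
  - by move=> n y; exact: smooth_step_le.
  - move=> y; rewrite /s.
    have near_big : \forall n \near \oo, n%:R <= ((`|b| + n%:R + 2) - y) / (n.+1%:R ^- 2).
      near=> n; rewrite invrK.
      have yn : y <= n%:R by near: n; exact: nbhs_infty_ger.
      have n0 : 0 <= n%:R :> R by [].
      have -> : n.+1%:R = n%:R + 1 :> R by rewrite -addn1 natrD.
      by have := normr_ge0 b; nra.
    rewrite indicE; case: (boolP (y \in _)).
      rewrite inE /= in_itv /= andbT => bY.
      have -> : pi * true%:R = pi / 2 - - (pi / 2) :> R by rewrite mulr1; field.
      apply: cvgB; first exact: cvg_atany.
      apply: cvg_atanNy; near=> n; rewrite invrK.
      have n0 : 0 <= n%:R :> R by [].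
      have n1 : 0 < n.+1%:R :> R by [].
      have yn : 2 / (y - b) <= n%:R by near: n; exact: nbhs_infty_ger.
      have yn1 : 2 <= n.+1%:R * (y - b).
        rewrite -ler_pdivrMr ?subr_gt0// (le_trans yn)// ler_nat.
        exact: leqnSn.
      have -> : (b + n.+1%:R^-1 - y) * n.+1%:R ^+ 2 =
          n.+1%:R * (1 - n.+1%:R * (y - b)) by field; rewrite gt_eqF.
      have -> : n%:R = n.+1%:R - 1 :> R by rewrite -addn1 natrD addrK.
      by nra.
    rewrite notin_setE /= in_itv /= andbT => /negP; rewrite -leNgt => yb.
    have -> : pi * false%:R = pi / 2 - (pi / 2) :> R by rewrite mulr0; field.
    apply: cvgB; first exact: cvg_atany.
    apply: cvg_atany; near=> n; rewrite invrK.
    have n1 : 0 < n.+1%:R :> R by [].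
    have -> : (b + n.+1%:R^-1 - y) * n.+1%:R ^+ 2 =
        n.+1%:R + n.+1%:R ^+ 2 * (b - y) by field; rewrite gt_eqF.
    have : 0 <= n.+1%:R ^+ 2 * (b - y) by rewrite mulr_ge0 ?sqr_ge0 ?subr_ge0.
    have : n%:R <= n.+1%:R :> R by rewrite ler_nat.
    by lra.
have : \int[m1]_y (pi * \1_(`]b, +oo[%classic) y) = \int[m2]_y (pi * \1_(`]b, +oo[%classic) y) :> R.
  apply: (cvg_unique _ (cv m1)) => //.
  rewrite (_ : (fun n => \int[m1]_y s n y) = (fun n => \int[m2]_y s n y)).
    exact: cv.
  by apply/funext => n; exact: sE.
have mI : measurable (`]b, +oo[%classic : set R) by [].
rewrite !RintegralZl//; last 2 first.
- by apply: (@L1_bounded _ _ _ _ _ 1) => // y; rewrite indicE; case: (_ \in _); rewrite ?normr1 ?normr0.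
- by apply: (@L1_bounded _ _ _ _ _ 1) => // y; rewrite indicE; case: (_ \in _); rewrite ?normr1 ?normr0.
move=> /mulfI; rewrite gt_eqF ?pi_gt0// => /(_ isT).
rewrite /Rintegral !integral_indic// !setIT => /eqP.
by rewrite -eqe !fineK ?fin_num_measure// => /eqP.
Unshelve. all: by end_near. Qed.

(** Real and imaginary parts of the characteristic functions are compared
    separately, and open rays generate the Borel sets. *)
Lemma characteristic_uniqueness (A : set R) : measurable A -> m1 A = m2 A.
Proof.
refine (@measure_unique _ R _ (@RGenOInfty.G R) (fun n => `]- n%:R, +oo[%classic) _ _ _ _ m1 m2 _ _ A).
- exact: RGenOInfty.measurableE.
- move=> _ _ [x ->] [y ->]; exists (Num.max x y).
  by apply/seteqP; split => z /=; rewrite !in_itv/= !andbT gt_max => /andP.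
- by move=> n; exists (- n%:R).
- apply/seteqP; split => // z _; exists (Num.bound `|z|) => //=.
  by rewrite in_itv/= andbT ltrNl (le_lt_trans (ler_norm _))// normrN archi_boundP.
- by move=> B [x ->]; exact: ray_eq.
- by move=> n; rewrite -ge0_fin_numE// fin_num_measure.
Qed.
End characteristic_uniqueness.

(** * Laws and independence *)

(** The law of a variable built from others is a [distribution] only once the
    variable is bundled with its measurability. *)
Definition mfun_of d d' (T : measurableType d) (S : measurableType d') (U : T -> S)
  (mU : measurable_fun setT U) : {mfun T >-> S} :=
  HB.pack U (isMeasurableFun.Build _ _ _ _ U mU).

Lemma measurable_preimage d d' (T : measurableType d) (S : measurableType d')
    (U : T -> S) (A : set S) :
  measurable_fun setT U -> measurable A -> measurable (U @^-1` A).
Proof. by move=> mU mA; rewrite -[X in measurable X]setTI; exact: mU. Qed.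

Section laws.
Context d (T : measurableType d) (R : realType) (P : probability T R).
Context d1 (S1 : measurableType d1) d2 (S2 : measurableType d2).

Lemma Rintegral_distribution (U : T -> S1) (mU : measurable_fun setT U) (g : S1 -> R) :
  measurable_fun setT g -> L1 P (g \o U) ->
  L1 (distribution P (mfun_of mU)) g /\
  \int[distribution P (mfun_of mU)]_x g x = \int[P]_w g (U w).
Proof.
move=> mg gU; have mEg : measurable_fun setT (EFin \o g) by exact/measurable_EFinP.
split; last by congr fine; rewrite integral_pushforward.
exact: (@integrable_pushforward _ _ _ _ _ _ mU P setT (EFin \o g)).
Qed.

Lemma same_law_ge0_integral (U V : T -> S1) (g : S1 -> \bar R) :
  measurable_fun setT U -> measurable_fun setT V -> measurable_fun setT g ->
  (forall x, (0 <= g x)%E) -> same_law P U V ->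
  (\int[P]_w g (U w) = \int[P]_w g (V w))%E.
Proof.
move=> mU mV mg g0 UV.
transitivity (\int[distribution P (mfun_of mU)]_x g x)%E.
  by rewrite ge0_integral_pushforward.
transitivity (\int[distribution P (mfun_of mV)]_x g x)%E.
  by apply: eq_measure_integral => A mA _; exact: UV.
by rewrite ge0_integral_pushforward.
Qed.

Lemma same_law_L1 (U V : T -> S1) (g : S1 -> R) :
  measurable_fun setT U -> measurable_fun setT V -> measurable_fun setT g ->
  same_law P U V -> L1 P (g \o U) ->
  L1 P (g \o V) /\ \int[P]_w g (U w) = \int[P]_w g (V w).
Proof.
move=> mU mV mg UV gU.
have mEg : measurable_fun setT (EFin \o g) by exact/measurable_EFinP.
have gV : L1 P (g \o V).
  move/integrableP : gU => [_ gUy]; apply/integrableP; split.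
    by apply/measurable_EFinP; exact: measurableT_comp.
  rewrite -(same_law_ge0_integral (g := fun x => `|(g x)%:E|%E) mU mV)//.
  exact: measurableT_comp.
split => //; congr fine.
transitivity (\int[distribution P (mfun_of mU)]_x (g x)%:E)%E.
  by rewrite integral_pushforward.
transitivity (\int[distribution P (mfun_of mV)]_x (g x)%:E)%E.
  by apply: eq_measure_integral => A mA _; exact: UV.
by rewrite integral_pushforward.
Qed.

Lemma same_law_comp (U V : T -> S1) (g : S1 -> S2) : measurable_fun setT g ->
  same_law P U V -> same_law P (g \o U) (g \o V).
Proof. by move=> mg UV A mA; exact: (UV _ (measurable_preimage mg mA)). Qed.

Lemma same_law_sym (U V : T -> S1) : same_law P U V -> same_law P V U.
Proof. by move=> UV A mA; rewrite UV. Qed.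

Lemma same_law_trans (U V W : T -> S1) :
  same_law P U V -> same_law P V W -> same_law P U W.
Proof. by move=> UV VW A mA; rewrite UV// VW. Qed.

Definition indep2 (U : T -> S1) (V : T -> S2) := forall A B,
  measurable A -> measurable B ->
  P ((U @^-1` A) `&` (V @^-1` B)) = (P (U @^-1` A) * P (V @^-1` B))%E.

Lemma measurable_pair (U : T -> S1) (V : T -> S2) :
  measurable_fun setT U -> measurable_fun setT V ->
  measurable_fun setT (fun w => (U w, V w)).
Proof. by move=> mU mV; exact: measurable_fun_pair. Qed.

Lemma indep2_law (U : T -> S1) (V : T -> S2)
    (mU : measurable_fun setT U) (mV : measurable_fun setT V) (E : set (S1 * S2)) :
  indep2 U V -> measurable E ->
  P ((fun w => (U w, V w)) @^-1` E) =
  (distribution P (mfun_of mU) \x distribution P (mfun_of mV))%E E.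
Proof.
move=> UV mE; apply/esym.
apply: (@product_measure_unique _ _ _ _ _ (distribution P (mfun_of mU))
  (distribution P (mfun_of mV)) (distribution P (mfun_of (measurable_pair mU mV)))) => //.
Qed.

(** Both sides are finite measures of [A], so that it is enough to compare them
    on a generating pi-system. *)
Lemma indep_event_generated (G : set (set S1)) (U : T -> S1) (D : set T) :
  @measurable _ S1 = <<s G >> -> setI_closed G -> G setT ->
  measurable_fun setT U -> measurable D ->
  (forall A, G A -> P ((U @^-1` A) `&` D) = (P (U @^-1` A) * P D)%E) ->
  forall A, measurable A -> P ((U @^-1` A) `&` D) = (P (U @^-1` A) * P D)%E.
Proof.
move=> mG GI GT mU mD GD A mA.
have pD : 0 <= fine (P D) by exact: fine_ge0.
pose m1 := pushforward (mrestr P mD) (mfun_of mU).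
pose m2 := mscale (NngNum pD) (distribution P (mfun_of mU)).
have m1E B : m1 B = P ((U @^-1` B) `&` D) by [].
have m2E B : m2 B = (P (U @^-1` B) * P D)%E.
  by rewrite /m2/= /mscale/= fineK ?fin_num_measure// muleC.
rewrite -m1E -m2E; apply: (@measure_unique _ R S1 G (fun=> setT) mG GI) => //.
- by rewrite bigcup_const//; exists 0%N.
- by move=> B GB; have := GD B GB; rewrite -m1E -m2E.
- have : (m1 setT < +oo)%E; last by move=> h k; exact: h.
  by rewrite m1E preimage_setT setTI -ge0_fin_numE// fin_num_measure.
Qed.

End laws.

Section indep_real.
Context d (T : measurableType d) (R : realType) (P : probability T R).

Lemma indep2_comp d1 d2 d3 d4 (S1 : measurableType d1) (S2 : measurableType d2)
    (S3 : measurableType d3) (S4 : measurableType d4)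
    (U : T -> S1) (V : T -> S2) (g : S1 -> S3) (k : S2 -> S4) :
  measurable_fun setT g -> measurable_fun setT k ->
  indep2 P U V -> indep2 P (g \o U) (k \o V).
Proof.
move=> mg mk UV A B mA mB.
exact: (UV _ _ (measurable_preimage mg mA) (measurable_preimage mk mB)).
Qed.

Lemma indep2_L1M (U V : T -> R) : indep2 P U V -> L1 P U -> L1 P V ->
  L1 P (fun w => U w * V w) /\
  \int[P]_w (U w * V w) = (\int[P]_w U w) * (\int[P]_w V w).
Proof.
move=> UV U1 V1; have mU := L1_measurable U1; have mV := L1_measurable V1.
pose lU := distribution P (mfun_of mU); pose lV := distribution P (mfun_of mV).
pose UVp := mfun_of (measurable_pair mU mV).
have mM : measurable_fun setT (fun z : R * R => z.1 * z.2).
  by apply: measurable_funM; [exact: measurable_fst|exact: measurable_snd].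
have lUVE E : measurable E -> (lU \x lV)%E E = distribution P UVp E.
  by move=> mE; rewrite -indep2_law.
have aU : (\int[P]_w `|U w|%:E < +oo)%E.
  by move/integrableP : U1 => [].
have aV : (\int[P]_w `|V w|%:E < +oo)%E.
  by move/integrableP : V1 => [].
have lUi : L1 lU id.
  apply: (@integrable_pushforward _ _ _ _ _ _ mU P setT (EFin \o id)) => //.
  exact/measurable_EFinP.
have lVi : L1 lV id.
  apply: (@integrable_pushforward _ _ _ _ _ _ mV P setT (EFin \o id)) => //.
  exact/measurable_EFinP.
have prod_i : (lU \x lV)%E.-integrable setT (EFin \o (fun z : R * R => z.1 * z.2)).
  apply/integrable12ltyP; first exact/measurable_EFinP.
  have mN : measurable_fun setT (fun y : R => `|y|%:E).
    by apply/measurable_EFinP; exact: normr_measurable.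
  have inner x : (\int[lV]_y `|(x * y)%:E| = `|x|%:E * \int[lV]_y `|y|%:E)%E.
    under eq_integral => y _ do rewrite /= normrM EFinM.
    by rewrite ge0_integralZl.
  under eq_integral => x _ do rewrite /= inner.
  rewrite ge0_integralZr//; last by apply: integral_ge0.
  move/integrableP : lUi => [_ ?]; move/integrableP : lVi => [_ ?].
  by apply: lte_mul_pinfty => //; rewrite ?integral_ge0// ge0_fin_numE// integral_ge0.
have UVi : L1 P (fun w => U w * V w).
  move/integrableP : prod_i => [_ prod_y]; apply/integrableP; split.
    by apply/measurable_EFinP; exact: measurable_funM.
  move: prod_y; rewrite (eq_measure_integral (distribution P UVp)); last first.
    by move=> E mE _; exact: lUVE.
  rewrite ge0_integral_pushforward//.
  by apply: measurableT_comp => //; exact/measurable_EFinP.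
split => //; rewrite /Rintegral.
have -> : (\int[P]_w (U w * V w)%:E = \int[lU \x lV]_z (z.1 * z.2)%:E)%E.
  rewrite (eq_measure_integral (distribution P UVp)); last first.
    by move=> E mE _; exact: lUVE.
  rewrite integral_pushforward//.
  exact/measurable_EFinP.
rewrite -integral12_prod_meas1//.
have lUE : (\int[lU]_x x%:E = (\int[P]_w U w)%:E)%E.
  rewrite -integralE_Rintegral//= integral_pushforward//.
have lVE : (\int[lV]_x x%:E = (\int[P]_w V w)%:E)%E.
  rewrite -integralE_Rintegral//= integral_pushforward//.
have inner x : (\int[lV]_y (x * y)%:E = (\int[P]_w V w)%:E * x%:E)%E.
  under eq_integral => y _ do rewrite /= EFinM.
  by rewrite integralZl// lVE muleC.
rewrite (eq_integral (fun x => (\int[P]_w V w)%:E * x%:E)%E); last by move=> x _; exact: inner.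
by rewrite integralZl// lUE -EFinM mulrC.
Qed.

End indep_real.

(** * Sums of independent variables *)

Section rectangles.
Context d1 (S1 : measurableType d1) d2 (S2 : measurableType d2).

Definition rectangles : set (set (S1 * S2)) :=
  [set A `*` B | A in measurable & B in measurable].

Lemma setI_closed_rectangles : setI_closed rectangles.
Proof.
move=> _ _ [A mA [B mB <-]] [A' mA' [B' mB' <-]].
rewrite -setXI; exists (A `&` A'); first exact: measurableI.
by exists (B `&` B') => //; exact: measurableI.
Qed.

Lemma rectangles_setT : rectangles setT.
Proof. by exists setT => //; exists setT => //; rewrite setXTT. Qed.

Lemma indep2_same_law d (T : measurableType d) (R : realType) (P : probability T R)
    (U U' : T -> S1) (V V' : T -> S2) :
  measurable_fun setT U -> measurable_fun setT U' ->
  measurable_fun setT V -> measurable_fun setT V' ->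
  indep2 P U V -> indep2 P U' V' -> same_law P U U' -> same_law P V V' ->
  same_law P (fun w => (U w, V w)) (fun w => (U' w, V' w)).
Proof.
move=> mU mU' mV mV' iUV iUV' UU VV A mA.
pose m1 := distribution P (mfun_of (measurable_pair mU mV)).
pose m2 := distribution P (mfun_of (measurable_pair mU' mV')).
apply: (@measure_unique _ R _ rectangles (fun=> setT) _ setI_closed_rectangles _ _ m1 m2) => //.
- exact: measurable_prod_measurableType.
- by move=> _; exact: rectangles_setT.
- by rewrite bigcup_const//; exists 0%N.
- move=> _ [B mB [C mC <-]].
  have := iUV B C mB mC; have := iUV' B C mB mC.
  have := UU B mB; have := VV C mC; rewrite /pushforward => -> -> <-.
  by [].
- by move=> k; rewrite -ge0_fin_numE// fin_num_measure.
Qed.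

End rectangles.

Section independent_sums.
Context d (T : measurableType d) (R : realType) (P : probability T R).
Variable Y : nat -> {RV P >-> R}.
Hypothesis Yindep : mutually_independent P (fun j => Y j : T -> R).

(** Sums over arbitrary lists of indices, so that any single summand can be
    split off from an i.i.d. sum. *)
Definition seq_sum (s : seq nat) (w : T) : R := \sum_(j <- s) Y j w.

Lemma measurable_seq_sum s : measurable_fun setT (seq_sum s).
Proof. exact: measurable_sum. Qed.

Let cylinder (J : seq nat) (A : nat -> set R) : set T :=
  \bigcap_(j in [set j | j \in J]) (Y j @^-1` A j).

Let measurable_cylinder J A : (forall j, measurable (A j)) -> measurable (cylinder J A).
Proof.
by move=> mA; apply: bigcap_measurableType => // j _; exact: measurable_preimage.
Qed.

Let cylinderE (J : seq nat) A : uniq J -> (forall j, measurable (A j)) ->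
  P (cylinder J A) = (\prod_(j <- J) fine (P (Y j @^-1` A j)))%:E.
Proof.
move=> uJ mA; have := Yindep [fset j in J]%fset mA.
rewrite [X in P X](_ : _ = cylinder J A); last first.
  by apply/seteqP; split => w Jw j /= jJ; apply: Jw; move: jJ; rewrite /= in_fset.
rewrite (perm_big J)/=; last first.
  by apply: uniq_perm => //; [exact: fset_uniq|move=> j; rewrite in_fset].
by move=> <-; rewrite fineK// fin_num_measure//; exact: measurable_cylinder.
Qed.

(** Induction on the summands. The event on the unused variables is kept general
    because the induction step moves a variable from the sum to the cylinder:
    on rectangles, the event on the pair (new summand, old sum) is an event
    on the old sum intersected with a larger cylinder. *)
Lemma indep_sum_event (s J : seq nat) A B : uniq (s ++ J) ->
  (forall j, measurable (A j)) -> measurable B ->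
  P ((seq_sum s @^-1` B) `&` cylinder J A) =
  (P (seq_sum s @^-1` B) * P (cylinder J A))%E.
Proof.
elim: s J A B => [|k s IH] J A B /= uJ mA mB.
  have [B0|B0] := pselect (B 0).
    have -> : seq_sum [::] @^-1` B = setT.
      by apply/seteqP; split => // w _; rewrite /seq_sum /= big_nil.
    by rewrite setTI probability_setT mul1e.
  have -> : seq_sum [::] @^-1` B = set0.
    by apply/seteqP; split => // w; rewrite /seq_sum /= big_nil.
  by rewrite set0I measure0 mul0e.
have /andP[ksJ usJ] := uJ.
have [us kJ uJ'] : [/\ uniq s, k \notin J & uniq J].
  move: ksJ usJ; rewrite mem_cat negb_or => /andP[_ ->].
  by rewrite cat_uniq => /and3P[].
have ks : k \notin s by move: ksJ; rewrite mem_cat negb_or => /andP[].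
pose U w := (Y k w : R, seq_sum s w).
have mU : measurable_fun setT U.
  by apply: measurable_pair => //; exact: measurable_seq_sum.
have mcyl : measurable (cylinder J A) by exact: measurable_cylinder.
have indepU := @indep_event_generated _ T R P _ _ (@rectangles _ R _ R) U (cylinder J A)
  (measurable_prod_measurableType _ _) (@setI_closed_rectangles _ _ _ _) (@rectangles_setT _ _ _ _) mU mcyl.
pose E : set (R * R) := (fun z => z.1 + z.2) @^-1` B.
have mE : measurable E.
  apply: measurable_preimage => //; apply: measurable_funD.
    exact: measurable_fst.
  exact: measurable_snd.
have EB : seq_sum (k :: s) @^-1` B = U @^-1` E.
  by apply/seteqP; split => w; rewrite /E/U/seq_sum/= big_cons.
rewrite EB; apply: indepU => // _ [C mC [D mD <-]].
pose A' j := if j == k then C else A j.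
have mA' j : measurable (A' j) by rewrite /A'; case: ifP.
have cylk J' : k \notin J' -> (Y k @^-1` C) `&` cylinder J' A = cylinder (k :: J') A'.
  move=> kJ'; apply/seteqP; split => w.
    move=> [Cw Jw] j /=; rewrite inE /A' => /orP[/eqP ->|jJ]; first by rewrite eqxx.
    by case: eqP => [->//|_]; exact: Jw.
  move=> Jw; split; first by have := Jw k; rewrite /= /A' inE eqxx; apply.
  move=> j jJ; have := Jw j; rewrite /= /A' inE jJ orbT => /(_ isT).
  by case: eqP => // jk; rewrite -jk jJ in kJ'.
have U1 : U @^-1` (C `*` D) = (Y k @^-1` C) `&` (seq_sum s @^-1` D).
  by apply/seteqP; split => w [].
have cyl0 : cylinder [::] A = setT by apply/seteqP; split.
have PC : P (Y k @^-1` C) = (fine (P (Y k @^-1` C)))%:E.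
  by rewrite fineK// fin_num_measure//; exact: measurable_preimage.
have P1 : P (U @^-1` (C `*` D)) = (P (seq_sum s @^-1` D) * P (Y k @^-1` C))%E.
  have := cylk [::] isT; rewrite cyl0 setIT => kE.
  rewrite U1 kE setIC IH//.
  by rewrite cat_uniq us /= orbF ks.
rewrite P1 U1 -[in LHS]setIA [in LHS]setICA cylk// IH//; last first.
  by rewrite cat_uniq us /= kJ uJ' andbT negb_or ks/=; move: usJ; rewrite cat_uniq => /and3P[_ ->].
rewrite -muleA; congr (_ * _)%E.
rewrite !cylinderE//=; last by rewrite kJ.
rewrite big_cons EFinM {1}/A' eqxx -PC; congr (_ * _%:E)%E.
apply: eq_big_seq => j jJ; rewrite /A'; case: eqP => // jk.
by rewrite -jk jJ in kJ.
Qed.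

Lemma indep2_seq_sum k s : uniq (k :: s) -> indep2 P (Y k) (seq_sum s).
Proof.
rewrite /= => /andP[ks us] A B mA mB.
have := @indep_sum_event s [:: k] (fun=> A) B.
have -> : cylinder [:: k] (fun=> A) = Y k @^-1` A.
  apply/seteqP; split => w; first by apply; rewrite /= inE.
  by move=> Aw j /=; rewrite inE => /eqP ->.
rewrite setIC muleC; apply => //.
by rewrite cat_uniq us/= orbF ks.
Qed.

Hypothesis Ylaw : forall i j, same_law P (Y i : T -> R) (Y j).

Lemma seq_sum_same_law s s' : uniq s -> uniq s' -> size s = size s' ->
  same_law P (seq_sum s) (seq_sum s').
Proof.
elim: s s' => [|k s IH] [|k' s']//= us us' [] ss'.
have H : same_law P (fun w => (Y k w : R, seq_sum s w)) (fun w => (Y k' w : R, seq_sum s' w)).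
  apply: indep2_same_law => //; try exact: measurable_seq_sum.
  - exact: indep2_seq_sum.
  - exact: indep2_seq_sum.
  - by apply: IH => //; [case/andP: us|case/andP: us'].
have mD : measurable_fun setT (fun z : R * R => z.1 + z.2).
  by apply: measurable_funD; [exact: measurable_fst|exact: measurable_snd].
have := same_law_comp mD H; congr same_law.
- by apply/funext => w; rewrite /seq_sum big_cons.
- by apply/funext => w; rewrite /seq_sum big_cons.
Qed.

(** Each summand is independent of the sum of the others, whose law does not
    depend on which summand was left out. *)
Lemma summand_sum_same_law n j : (j < n.+1)%N ->
  same_law P (fun w => (Y j w : R, \sum_(i < n.+1) Y i w))
             (fun w => (Y n w : R, \sum_(i < n.+1) Y i w)).
Proof.
have key k : (k < n.+1)%N ->
    (fun w => (Y k w : R, \sum_(i < n.+1) Y i w)) =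
    (fun z : R * R => (z.1, z.1 + z.2)) \o
      (fun w => (Y k w : R, seq_sum (rem k (iota 0 n.+1)) w)).
  move=> kn; apply/funext => w /=; congr (_, _).
  rewrite -(big_mkord xpredT (fun i => Y i w)) /seq_sum /index_iota subn0.
  by rewrite (perm_big _ (perm_to_rem (s := iota 0 n.+1) (x := k) _)) ?big_cons// mem_iota.
move=> jn; rewrite !key//; apply: same_law_comp.
  apply: measurable_pair; first exact: measurable_fst.
  by apply: measurable_funD; [exact: measurable_fst|exact: measurable_snd].
have urem k : (k < n.+1)%N -> uniq (k :: rem k (iota 0 n.+1)).
  move=> kn; rewrite -(perm_uniq (perm_to_rem _)) ?iota_uniq//.
  by rewrite mem_iota.
apply: indep2_same_law => //; try exact: measurable_seq_sum.
- exact/indep2_seq_sum/urem.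
- exact/indep2_seq_sum/urem.
- have u k : (k < n.+1)%N -> uniq (rem k (iota 0 n.+1)).
    by move=> kn; exact: rem_uniq (iota_uniq _ _).
  apply: (seq_sum_same_law (u _ jn) (u _ (ltnSn n))).
  by rewrite !size_rem ?mem_iota ?add0n ?jn /= ?ltnSn.
Qed.

End independent_sums.

(** * Partial sums in the equally correlated model *)

Lemma L1_mscale d (T : measurableType d) (R : realType)
    (m : {measure set T -> \bar R}) (k : {nonneg R}) (f : T -> R) : L1 m f ->
  L1 (mscale k m) f /\ \int[mscale k m]_x f x = k%:num * \int[m]_x f x.
Proof.
move=> fi; have mf := L1_measurable fi.
have mEf : measurable_fun setT (EFin \o f) by exact/measurable_EFinP.
split.
  apply/integrableP; split => //.
  rewrite ge0_integral_mscale//; last exact: measurableT_comp.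
  move/integrableP : fi => [_ fy].
  by apply: lte_mul_pinfty => //; rewrite lee_fin.
rewrite /Rintegral integralE !ge0_integral_mscale//; last 2 first.
- exact: measurable_funeneg.
- exact: measurable_funepos.
rewrite -muleBr//; last first.
  apply: fin_num_adde_defl; rewrite fin_numN.
  have /integrable_fin_num := integrable_funeneg measurableT fi.
  by apply.
rewrite -integralE fineM//; exact: integrable_fin_num.
Qed.

Section mixture_measure.
Context d (T : measurableType d) (R : realType)
  (m1 m2 : {finite_measure set T -> \bar R}) (k1 k2 : {nonneg R}).

Definition mixture : set T -> \bar R := measure_add (mscale k1 m1) (mscale k2 m2).

HB.instance Definition _ := Measure.on mixture.

Let mixture_fin : fin_num_fun mixture.
Proof.
move=> A mA; rewrite /mixture measure_addE.
by rewrite fin_numD !fin_num_measure.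
Qed.

HB.instance Definition _ := Measure_isFinite.Build _ _ _ mixture mixture_fin.

Lemma mixtureE A : mixture A = (k1%:num%:E * m1 A + k2%:num%:E * m2 A)%E.
Proof. by rewrite /mixture measure_addE. Qed.

Lemma Rintegral_mixture (f : T -> R) : L1 m1 f -> L1 m2 f ->
  \int[mixture]_x f x = k1%:num * \int[m1]_x f x + k2%:num * \int[m2]_x f x.
Proof.
move=> f1 f2.
have [g1 <-] := L1_mscale k1 f1; have [g2 <-] := L1_mscale k2 f2.
rewrite /Rintegral /mixture integral_measure_add// fineD//; exact: integrable_fin_num.
Qed.

End mixture_measure.

(** Stated with preimages, because the mixture measure itself only matters
    through the integrals that it splits. *)
Lemma Rintegral_law_mixture d (T : measurableType d) (R : realType) (P : probability T R)
    (U V C : T -> R) (k : R) (g : R -> R) :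
  measurable_fun setT U -> measurable_fun setT V -> measurable_fun setT C ->
  0 <= k <= 1 ->
  (forall A, measurable A -> P (U @^-1` A) =
    (k%:E * P (V @^-1` A) + (1 - k)%:E * P (C @^-1` A))%E) ->
  measurable_fun setT g -> L1 P (g \o V) -> L1 P (g \o C) ->
  L1 P (g \o U) /\
  \int[P]_w g (U w) = k * \int[P]_w g (V w) + (1 - k) * \int[P]_w g (C w).
Proof.
move=> mU mV mC /andP[k0 k1] law mg gV gC.
have k1' : 0 <= 1 - k by rewrite subr_ge0.
have mEg : measurable_fun setT (EFin \o g) by exact/measurable_EFinP.
have [gV' EV] := Rintegral_distribution mV mg gV.
have [gC' EC] := Rintegral_distribution mC mg gC.
pose m := mixture (distribution P (mfun_of mV)) (distribution P (mfun_of mC))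
  (NngNum k0) (NngNum k1').
have lawE (A : set R) : measurable A -> distribution P (mfun_of mU) A = m A.
  by move=> mA; rewrite /m mixtureE; exact: law.
have gU : L1 P (g \o U).
  have mn : measurable_fun setT (fun x => `|(g x)%:E|%E) by exact: measurableT_comp.
  apply/integrableP; split; first by apply/measurable_EFinP; exact: measurableT_comp.
  have -> : (\int[P]_w `|(EFin \o (g \o U)) w| =
      \int[distribution P (mfun_of mU)]_x `|(g x)%:E|)%E.
    by rewrite ge0_integral_pushforward.
  rewrite (eq_measure_integral m); last by move=> A mA _; exact: lawE.
  rewrite /m ge0_integral_measure_add//.
  have [g1 _] := L1_mscale (NngNum k0) gV'; have [g2 _] := L1_mscale (NngNum k1') gC'.
  by apply: lte_add_pinfty; [have /integrableP[] := g1|have /integrableP[] := g2].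
split=> //.
rewrite -EV -EC -[k]/((NngNum k0)%:num) -[1 - _]/((NngNum k1')%:num) -Rintegral_mixture//.
congr fine; transitivity (\int[distribution P (mfun_of mU)]_x (g x)%:E)%E.
  by rewrite integral_pushforward.
by apply: eq_measure_integral => A mA _; exact: lawE.
Qed.
Section characteristic_functions.
Context d (T : measurableType d) (R : realType) (P : probability T R).

Lemma measurable_cos : measurable_fun setT (@cos R).
Proof. exact: continuous_measurable_fun (@continuous_cos R). Qed.

Lemma measurable_sin : measurable_fun setT (@sin R).
Proof. exact: continuous_measurable_fun (@continuous_sin R). Qed.

Lemma L1_cos (U : T -> R) : measurable_fun setT U -> L1 P (fun w => cos (U w)).
Proof.
move=> mU; apply: (@L1_bounded _ _ _ _ _ 1); last by move=> w; exact: cos_max.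
exact: (measurableT_comp measurable_cos mU).
Qed.

Lemma L1_sin (U : T -> R) : measurable_fun setT U -> L1 P (fun w => sin (U w)).
Proof.
move=> mU; apply: (@L1_bounded _ _ _ _ _ 1); last by move=> w; exact: sin_max.
exact: (measurableT_comp measurable_sin mU).
Qed.

Lemma cexpectation_cexpi (U : T -> R) :
  cexpectation P (fun w => cexpi (U w)) =
  Complex (\int[P]_w cos (U w)) (\int[P]_w sin (U w)).
Proof. by rewrite /cexpectation unlock. Qed.

Lemma cexpectation_same_law (U V : T -> R) :
  measurable_fun setT U -> measurable_fun setT V -> same_law P U V ->
  cexpectation P (fun w => cexpi (U w)) = cexpectation P (fun w => cexpi (V w)).
Proof.
move=> mU mV UV; rewrite !cexpectation_cexpi; congr Complex.
- by have [] := same_law_L1 mU mV measurable_cos UV (L1_cos mU).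
- by have [] := same_law_L1 mU mV measurable_sin UV (L1_sin mU).
Qed.

Lemma cexpectation_indep (U V : T -> R) :
  measurable_fun setT U -> measurable_fun setT V -> indep2 P U V ->
  cexpectation P (fun w => cexpi (U w + V w)) =
  cexpectation P (fun w => cexpi (U w)) * cexpectation P (fun w => cexpi (V w)).
Proof.
move=> mU mV UV; rewrite !cexpectation_cexpi.
have mc := measurable_cos; have ms := measurable_sin.
have [cc Ecc] := indep2_L1M (indep2_comp mc mc UV) (L1_cos mU) (L1_cos mV).
have [ss Ess] := indep2_L1M (indep2_comp ms ms UV) (L1_sin mU) (L1_sin mV).
have [cs Ecs] := indep2_L1M (indep2_comp mc ms UV) (L1_cos mU) (L1_sin mV).
have [sc Esc] := indep2_L1M (indep2_comp ms mc UV) (L1_sin mU) (L1_cos mV).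
rewrite /= in Ecc Ess Ecs Esc.
have -> : \int[P]_w cos (U w + V w) =
    \int[P]_w (cos (U w) * cos (V w)) - \int[P]_w (sin (U w) * sin (V w)).
  by rewrite -RintegralB//; apply: eq_Rintegral => w _; rewrite cosD.
have -> : \int[P]_w sin (U w + V w) =
    \int[P]_w (cos (U w) * sin (V w)) + \int[P]_w (sin (U w) * cos (V w)).
  by rewrite -RintegralD//; apply: eq_Rintegral => w _; rewrite sinD addrC.
by rewrite Ecc Ess Ecs Esc.
Qed.

Variable Y : nat -> {RV P >-> R}.
Hypothesis Yindep : mutually_independent P (fun j => Y j : T -> R).
Hypothesis Ylaw : forall i j, same_law P (Y i : T -> R) (Y j).

Lemma cexpectation_seq_sum (t : R) s : uniq s ->
  cexpectation P (fun w => cexpi (t * seq_sum Y s w)) =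
  cexpectation P (fun w => cexpi (t * Y 0%N w)) ^+ size s.
Proof.
have mt (U : T -> R) : measurable_fun setT U -> measurable_fun setT (fun w => t * U w).
  by move=> mU; exact: measurable_funM.
elim: s => [_|k s IH us].
  rewrite expr0 cexpectation_cexpi; congr Complex.
    under eq_Rintegral do rewrite /seq_sum big_nil mulr0 cos0.
  exact: Rintegral_probability_cst.
  under eq_Rintegral do rewrite /seq_sum big_nil mulr0 sin0.
  exact: Rintegral_probability_cst.
rewrite /= exprS -IH; last by case/andP: us.
have mtR : measurable_fun setT (fun x : R => t * x) by exact: measurable_funM.
have -> : cexpectation P (fun w => cexpi (t * Y 0%N w)) =
    cexpectation P (fun w => cexpi (t * Y k w)).
  apply: cexpectation_same_law; [exact: mt|exact: mt|].
  exact: (same_law_comp mtR (Ylaw 0 k)).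
rewrite -cexpectation_indep.
- by congr cexpectation; apply/funext => w; rewrite /seq_sum big_cons mulrDr.
- exact: mt.
- exact/mt/measurable_seq_sum.
- apply: (@indep2_comp _ T R P _ _ _ _ R R R R _ _ (fun x : R => t * x) (fun x : R => t * x)).
  + exact: measurable_funM.
  + exact: measurable_funM.
  + exact: indep2_seq_sum.
Qed.

Variables (rho : R) (X : nat -> {RV P >-> R}).
Hypothesis rho01 : 0 <= rho <= 1.
Hypothesis Xcorr : equally_correlated P rho (fun j => X j : T -> R).
Hypothesis Xlaw : forall j, same_law P (X j : T -> R) (Y 0%N).

(** With all arguments equal to [t], the defining identity compares the
    characteristic functions at [t] of the three one-dimensional laws, and
    these determine the laws. *)
Lemma equally_correlated_sum_law n (A : set R) : measurable A ->
  P ((fun w => \sum_(j < n) X j w) @^-1` A) =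
  (rho%:E * P ((fun w => (n%:R * Y 0%N w)%R) @^-1` A) +
   (1 - rho)%:E * P ((fun w => (\sum_(j < n) Y j w)%R) @^-1` A))%E.
Proof.
move=> mA; have /andP[rho0 rho1] := rho01.
have rho1' : 0 <= 1 - rho by rewrite subr_ge0.
case: n => [|n].
  have -> : (fun w => \sum_(j < 0) X j w) = cst (0 : R).
    by apply/funext => w; rewrite big_ord0.
  have -> : (fun w => \sum_(j < 0) Y j w) = cst (0 : R).
    by apply/funext => w; rewrite big_ord0.
  have -> : (fun w => 0%:R * Y 0%N w) = cst (0 : R).
    by apply/funext => w; rewrite mul0r.
  rewrite -muleDl; [by rewrite -EFinD addrC subrK mul1e| |by []].
  by rewrite fin_num_measure//; exact: measurable_preimage.
have mS (W : nat -> {RV P >-> R}) : measurable_fun setT (fun w => \sum_(j < n.+1) W j w).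
  exact: measurable_sum.
have mV : measurable_fun setT (fun w => n.+1%:R * Y 0%N w) by exact: measurable_funM.
pose m1 := distribution P (mfun_of (mS X)).
pose m2 := mixture (distribution P (mfun_of mV)) (distribution P (mfun_of (mS Y)))
  (NngNum rho0) (NngNum rho1').
transitivity (m2 A); last exact: mixtureE.
rewrite -[LHS]/(m1 A).
have trig (t : R) : \int[m1]_y cos (t * y) = \int[m2]_y cos (t * y) /\
    \int[m1]_y sin (t * y) = \int[m2]_y sin (t * y).
  have mt (U : T -> R) : measurable_fun setT U -> measurable_fun setT (fun w => t * U w).
    by move=> mU; exact: measurable_funM.
  have mtR : measurable_fun setT (fun x : R => t * x) by exact: measurable_funM.
  have mct := measurableT_comp measurable_cos mtR.
  have mst := measurableT_comp measurable_sin mtR.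
  have [c1 ->] := Rintegral_distribution (mS X) mct (L1_cos (mt _ (mS X))).
  have [s1 ->] := Rintegral_distribution (mS X) mst (L1_sin (mt _ (mS X))).
  have [c2 c2E] := Rintegral_distribution mV mct (L1_cos (mt _ mV)).
  have [s2 s2E] := Rintegral_distribution mV mst (L1_sin (mt _ mV)).
  have [c3 c3E] := Rintegral_distribution (mS Y) mct (L1_cos (mt _ (mS Y))).
  have [s3 s3E] := Rintegral_distribution (mS Y) mst (L1_sin (mt _ (mS Y))).
  rewrite (Rintegral_mixture _ _ c2 c3) (Rintegral_mixture _ _ s2 s3).
  rewrite c2E s2E c3E s3E /=.
  have := Xcorr (fun=> t) (ltn0Sn n).
  have -> : (fun w => cexpi (\sum_(j < n.+1) t * X j w)) =
      (fun w => cexpi (t * \sum_(j < n.+1) X j w)).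
    by apply/funext => w; rewrite mulr_sumr.
  have -> : cexpectation P (fun w => cexpi (X 0%N w * \sum_(j < n.+1) t)) =
      cexpectation P (fun w => cexpi (t * (n.+1%:R * Y 0%N w))).
    rewrite sumr_const card_ord.
    transitivity (cexpectation P (fun w => cexpi (X 0%N w * (t *+ n.+1)))) => //.
    rewrite (@cexpectation_same_law (fun w => X 0%N w * (t *+ n.+1))
      (fun w => Y 0%N w * (t *+ n.+1))).
    - congr cexpectation; apply/funext => w; congr cexpi.
      by rewrite -mulr_natr; ring.
    - exact: measurable_funM.
    - exact: measurable_funM.
    - have mk : measurable_fun setT (fun x : R => x * (t *+ n.+1)) by exact: measurable_funM.
      exact: (same_law_comp mk (Xlaw 0)).
  have -> : \prod_(j < n.+1) cexpectation P (fun w => cexpi (t * X j w)) =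
      cexpectation P (fun w => cexpi (t * \sum_(j < n.+1) Y j w)).
    have XY (j : nat) : cexpectation P (fun w => cexpi (t * X j w)) =
        cexpectation P (fun w => cexpi (t * Y 0%N w)).
      apply: cexpectation_same_law; [exact: mt|exact: mt|].
      exact: (same_law_comp mtR (Xlaw j)).
    under eq_bigr => j _ do rewrite XY.
    rewrite prodr_const card_ord.
    have := cexpectation_seq_sum t (iota_uniq 0 n.+1); rewrite size_iota => <-.
    congr cexpectation; apply/funext => w; rewrite /seq_sum.
    by rewrite -(big_mkord xpredT (fun i => Y i w)) /index_iota subn0.
  rewrite !cexpectation_cexpi => /eqP; rewrite eq_complex /=.
  by rewrite !mul0r !subr0 !addr0 => /andP[/eqP -> /eqP ->].
by apply: characteristic_uniqueness => // t; have [] := trig t.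
Qed.

End characteristic_functions.

(** * Poisson index independent of a process *)

Lemma measurable_fun_prod_nat d (S : measurableType d) (R : realType)
    (U : nat -> S -> R) : (forall n, measurable_fun setT (U n)) ->
  measurable_fun setT (fun z : S * nat => U z.2 z.1).
Proof.
move=> mU _ B mB; rewrite setTI.
rewrite (_ : _ @^-1` _ = \bigcup_n ((U n @^-1` B) `*` [set n])); last first.
  apply/seteqP; split => [[x n] Bx|[x n] [m _ [/= Bx ->]]] //.
  by exists n.
apply: bigcup_measurable => n _; apply: measurableX => //.
exact: measurable_preimage.
Qed.

Lemma integral_nat_measure (R : realType) (m : {measure set nat -> \bar R})
    (g : nat -> \bar R) : (forall n, (0 <= g n)%E) ->
  (\int[m]_n g n = \sum_(0 <= n <oo) g n * m [set n])%E.
Proof.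
move=> g0; have setTE : [set: nat] = \bigcup_n [set n].
  by apply/seteqP; split => // n _; exists n.
rewrite setTE ge0_integral_bigcup//.
- apply: eq_eseriesr => n _.
  by rewrite (eq_integral (cst (g n))) ?integral_cst// => x; rewrite inE => ->.
- by move=> i j _ _ [x [-> ->]].
Qed.

Section indep_tonelli.
Context d (T : measurableType d) (R : realType) (P : probability T R).
Context d1 (S1 : measurableType d1) d2 (S2 : measurableType d2).

Lemma indep2_tonelli (U : T -> S1) (V : T -> S2) (mV : measurable_fun setT V)
    (Phi : S1 * S2 -> R) :
  measurable_fun setT U -> indep2 P U V -> measurable_fun setT Phi ->
  (forall z, 0 <= Phi z) ->
  (\int[P]_w (Phi (U w, V w))%:E =
   \int[distribution P (mfun_of mV)]_v \int[P]_w (Phi (U w, v))%:E)%E.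
Proof.
move=> mU UV mPhi Phi0.
have mEPhi : measurable_fun setT (EFin \o Phi) by exact/measurable_EFinP.
pose UVp := mfun_of (measurable_pair mU mV).
pose lU := distribution P (mfun_of mU); pose lV := distribution P (mfun_of mV).
transitivity (\int[distribution P UVp]_z (Phi z)%:E)%E.
  by rewrite ge0_integral_pushforward// => z _; rewrite lee_fin.
transitivity (\int[lU \x lV]_z (Phi z)%:E)%E.
  by apply: eq_measure_integral => E mE _; exact: (indep2_law mU mV UV mE).
rewrite (fubini_tonelli2 _ mEPhi); last by move=> z; rewrite lee_fin.
apply: eq_integral => v _; rewrite /fubini_G ge0_integral_pushforward//.
  apply/measurable_EFinP; apply: (measurableT_comp mPhi).
  exact: measurable_fun_pair.
by move=> x _; rewrite lee_fin.
Qed.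

End indep_tonelli.

Section palm.
Context d (T : measurableType d) (R : realType) (P : probability T R).
Variables (lambda : R) (N : {RV P >-> nat}) (F : set (set T)).
Hypothesis lambda0 : 0 < lambda.
Hypothesis Npoisson : forall k : nat, P (N @^-1` [set k]) = (poisson_pmf lambda k)%:E.
Hypothesis F_sub : <<s F >> `<=` (@measurable _ T).
Hypothesis FN : forall (A : set T) (B : set nat), <<s F >> A -> measurable B ->
  P (A `&` N @^-1` B) = (P A * P (N @^-1` B))%E.

(** Independence of [N] from a whole process is used in the form: the identity
    map into the sigma-algebra generated by the process is a single random
    variable independent of [N]. Functions of the process are those measurable
    for that sigma-algebra. *)
Definition adapted (U : T -> R) := @measurable_fun _ _ (g_sigma_algebraType F) R setT U.

Lemma adapted_measurable U : adapted U -> measurable_fun setT U.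
Proof. by move=> mU _ B mB; rewrite setTI; apply: F_sub; exact: (@measurable_preimage _ _ (g_sigma_algebraType F) R U B mU mB). Qed.

Let idF : T -> g_sigma_algebraType F := id.

Let midF : measurable_fun setT idF.
Proof. by move=> _ B mB; rewrite setTI; exact: F_sub. Qed.

Let indepN : indep2 P idF N.
Proof. by move=> A B mA mB; exact: FN. Qed.

Lemma measurable_random_index (U : nat -> T -> R) : (forall n, measurable_fun setT (U n)) ->
  measurable_fun setT (fun w => U (N w) w).
Proof.
move=> mU.
have mp : measurable_fun setT (fun w => (w, N w)) by exact: measurable_fun_pair.
exact: (measurableT_comp (measurable_fun_prod_nat mU) mp).
Qed.

(** Tonelli's theorem for the product law of the process and [N]. *)
Lemma random_index_ge0 (U : nat -> T -> R) : (forall n, adapted (U n)) ->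
  (forall n w, 0 <= U n w) ->
  (\int[P]_w (U (N w) w)%:E =
   \sum_(0 <= n <oo) \int[P]_w (U n w)%:E * (poisson_pmf lambda n)%:E)%E.
Proof.
move=> mU U0.
have mN : measurable_fun setT N by [].
have := indep2_tonelli mN midF indepN (measurable_fun_prod_nat mU).
rewrite /= => -> //; rewrite integral_nat_measure.
  by apply: eq_eseriesr => n _; rewrite /pushforward -Npoisson.
by move=> n; apply: integral_ge0 => w _; rewrite lee_fin.
Qed.

Lemma poisson_pmf_shift n :
  n.+1%:R * poisson_pmf lambda n.+1 = lambda * poisson_pmf lambda n.
Proof.
rewrite /poisson_pmf lambda0 factS natrM invfM exprS.
have n0 : n.+1%:R != 0 :> R by rewrite pnatr_eq0.
by move: (n.+1%:R : R) (n`!%:R^-1 : R) (expR _) n0 => a b e a0; field.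
Qed.

(** The Palm, or size-bias, identity: after conditioning on [N] it reduces to
    [poisson_pmf_shift], which removes the factor [N] at the price of one more
    term. *)
Lemma palm_ge0 (U : nat -> T -> R) : (forall n, adapted (U n)) ->
  (forall n w, 0 <= U n w) ->
  (\int[P]_w ((N w)%:R * U (N w) w)%:E = lambda%:E * \int[P]_w (U (N w).+1 w)%:E)%E.
Proof.
move=> mU U0.
have mnU n : adapted (fun w => n%:R * U n w).
  rewrite /adapted; apply: measurable_funM; [exact: measurable_cst|exact: mU].
have intU0 n : (0 <= \int[P]_w (U n w)%:E)%E by apply: integral_ge0 => w _; rewrite lee_fin.
rewrite (random_index_ge0 mnU); last by move=> n w; rewrite mulr_ge0.
rewrite (random_index_ge0 (fun n => mU n.+1))// -nneseriesZl; last first.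
  by move=> n _; rewrite mule_ge0// lee_fin poisson_pmf_ge0.
rewrite nneseries_recl//; last first.
  by move=> n _; rewrite mule_ge0 ?lee_fin ?poisson_pmf_ge0//;
    apply: integral_ge0 => w _; rewrite lee_fin mulr_ge0.
under eq_integral do rewrite mul0r.
rewrite integral0 mul0e add0e -nneseries_addn//=; last first.
  move=> n; rewrite mule_ge0 ?lee_fin ?poisson_pmf_ge0//.
  by apply: integral_ge0 => w _; rewrite lee_fin mulr_ge0.
apply: eq_eseriesr => n _; rewrite addn1.
under eq_integral do rewrite EFinM.
rewrite ge0_integralZl//; last first.
- by move=> w _; rewrite lee_fin.
- exact/measurable_EFinP/adapted_measurable.
by rewrite muleAC -EFinM poisson_pmf_shift EFinM muleC muleCA muleA.
Qed.

Lemma palm (U : nat -> T -> R) : (forall n, adapted (U n)) ->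
  L1 P (fun w => U (N w).+1 w) ->
  L1 P (fun w => (N w)%:R * U (N w) w) /\
  \int[P]_w ((N w)%:R * U (N w) w) = lambda * \int[P]_w U (N w).+1 w.
Proof.
move=> mU U1.
have mN : measurable_fun setT (fun w => (N w)%:R * U (N w) w).
  apply: (@measurable_random_index (fun n w => n%:R * U n w)) => n.
  by apply: measurable_funM => //; exact: adapted_measurable.
have UE n w : U n w = (U n)^\+ w - (U n)^\- w.
  by rewrite -[in LHS](funrposBneg (U n)).
have key (W : nat -> T -> R) : (forall n, adapted (W n)) -> (forall n w, 0 <= W n w) ->
    (forall n w, W n w <= `|U n w|) ->
    [/\ L1 P (fun w => W (N w).+1 w), L1 P (fun w => (N w)%:R * W (N w) w) &
     \int[P]_w ((N w)%:R * W (N w) w) = lambda * \int[P]_w W (N w).+1 w].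
  move=> mW W0 WU.
  have W1 : L1 P (fun w => W (N w).+1 w).
    apply: (L1_le (L1_norm U1)).
      by apply: (@measurable_random_index (fun n w => W n.+1 w)) => n; exact: adapted_measurable.
    by move=> w; rewrite ger0_norm.
  have E := palm_ge0 mW W0.
  rewrite (integralE_Rintegral W1) in E.
  split => //; last by rewrite /Rintegral E.
  apply: L1_ge0P; last by rewrite E ltry.
    apply: (@measurable_random_index (fun n w => n%:R * W n w)) => n.
    by apply: measurable_funM => //; exact: adapted_measurable.
  by move=> w; rewrite mulr_ge0.
have posle n w : (U n)^\+ w <= `|U n w|.
  have /(congr1 (@^~ w)) /= <- := funrposDneg (U n).
  by rewrite [leRHS]/(_ + _) lerDl funrneg_ge0.
have negle n w : (U n)^\- w <= `|U n w|.
  have /(congr1 (@^~ w)) /= <- := funrposDneg (U n).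
  by rewrite [leRHS]/(_ + _) lerDr funrpos_ge0.
have [p1 p2 p3] := key (fun n => (U n)^\+) (fun n => measurable_funrpos (mU n))
  (fun n => funrpos_ge0 (U n)) posle.
have [m1 m2 m3] := key (fun n => (U n)^\-) (fun n => measurable_funrneg (mU n))
  (fun n => funrneg_ge0 (U n)) negle.
have E : (fun w => (N w)%:R * U (N w) w) =
    (fun w => (N w)%:R * (U (N w))^\+ w - (N w)%:R * (U (N w))^\- w).
  by apply/funext => w; rewrite -mulrBr -UE.
split; first by rewrite E; exact: (L1B p2 m2).
rewrite E RintegralB// p3 m3 -mulrBr -RintegralB//.
by congr (_ * _); apply: eq_Rintegral => w _; rewrite -UE.
Qed.

End palm.

(** * Taylor bounds *)

Section taylor.
Context {R : realType}.
Variables (f f1 : R -> R) (L : R).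
Hypothesis fd : forall x : R, is_derive x 1 f (f1 x).
Hypothesis f1_lip : forall x y, `|f1 y - f1 x| <= L * `|y - x|.

(** Mean value theorem for [K + g] and [K - g]; the two signs of [u] below are
    reduced to it by the choice of [K]. *)
Lemma derivative_bound_le (g g1 : R -> R) (k : R -> R) (K : R -> R) (a b : R) : a <= b ->
  (forall x : R, is_derive x 1 g (g1 x)) -> (forall x : R, is_derive x 1 K (k x)) ->
  (forall x, a <= x <= b -> `|g1 x| <= k x) -> `|g b - g a| <= K b - K a.
Proof.
rewrite le_eqVlt => /predU1P[->|ab] gd Kd gk; first by rewrite !subrr normr0.
have mono (u u1 : R -> R) : (forall x : R, is_derive x 1 u (u1 x)) ->
    (forall x, a <= x <= b -> 0 <= u1 x) -> u a <= u b.
  move=> ud u0.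
  have [|z zab uE] := @MVT R u u1 a b ab (fun z _ => ud z).
    by apply: derivable_within_continuous => z _; have [] := ud z.
  rewrite -subr_ge0 uE mulr_ge0 ?subr_ge0 ?(ltW ab)// u0//.
  by move: zab; rewrite in_itv/= => /andP[/ltW -> /ltW ->].
rewrite ler_norml; apply/andP; split.
  have : K a + g a <= K b + g b; last lra.
  apply: (mono (fun x => K x + g x) (fun x => k x + g1 x)) => x.
  by move=> /gk; rewrite ler_norml => /andP[]; lra.
have : K a - g a <= K b - g b; last lra.
apply: (mono (fun x => K x - g x) (fun x => k x - g1 x)) => x.
by move=> /gk; rewrite ler_norml => /andP[]; lra.
Qed.

Lemma lipschitz_taylor x u : `|f (x + u) - f x - u * f1 x| <= L / 2 * u ^+ 2.
Proof.
pose g v := f (x + v) - v * f1 x.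
have gd (v : R) : is_derive v 1 g (f1 (x + v) - f1 x).
  have := fd (x + v) => ?; rewrite /g.
  have d1 : is_derive v 1 (fun v : R => f (x + v)) (f1 (x + v)).
    have d0 : is_derive v 1 (fun v : R => x + v) 1 by apply: (trigger_derive (is_deriveD (is_derive_cst x v 1) (is_derive_id v 1))); rewrite add0r.
    have := @is_derive1_comp R f (fun v => x + v) v _ _ (fd (x + v)) d0.
    by rewrite mulr1.
  by apply: trigger_derive; rewrite /= -![_ *: _]/(_ * _); ring.
have Kd s (v : R) : is_derive v 1 (fun v : R => s * (L / 2 * v ^+ 2)) (s * L * v).
  by apply: trigger_derive; rewrite /= -![_ *: _]/(_ * _); field.
have g0 : g u - g 0 = f (x + u) - f x - u * f1 x by rewrite /g addr0; ring.
have xvx v : x + v - x = v by ring.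
rewrite -g0; have [u0|u0] := leP 0 u.
  have := @derivative_bound_le g _ (fun v => 1 * L * v) (fun v => 1 * (L / 2 * v ^+ 2)) 0 u u0 gd (Kd 1).
  rewrite !mul1r expr0n /= mulr0 subr0; apply => v /andP[v0 _].
  by rewrite ?mul1r; have := f1_lip x (x + v); rewrite xvx (ger0_norm v0).
rewrite distrC.
have := @derivative_bound_le g _ (fun v => -1 * L * v) (fun v => -1 * (L / 2 * v ^+ 2)) u 0 (ltW u0) gd (Kd (-1)).
rewrite expr0n /= !mulr0 sub0r !mulN1r opprK; apply => v /andP[_ v0].
by have := f1_lip x (x + v); rewrite xvx (ler0_norm v0); lra.
Qed.

(** The derivative [f1 v - f1 0] of the linearisation error at 0 is at most
    [L * |v|], whose primitive is [L / 2 * (v * |v|)]. *)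
Lemma lipschitz_remainder_mono x y : x <= y ->
  `|(f y - f 0 - y * f1 0) - (f x - f 0 - x * f1 0)| <=
  L / 2 * (y * `|y|) - L / 2 * (x * `|x|).
Proof.
move=> xy; pose g v := f v - f 0 - v * f1 0.
rewrite -/(g y) -/(g x).
have gd (v : R) : is_derive v 1 g (f1 v - f1 0).
  have := fd v => ?; rewrite /g.
  by apply: trigger_derive; rewrite /= -![_ *: _]/(_ * _); ring.
have Kd s (v : R) : is_derive v 1 (fun v : R => s * (L / 2 * v ^+ 2)) (s * L * v).
  by apply: trigger_derive; rewrite /= -![_ *: _]/(_ * _); field.
have pos a b : 0 <= a -> a <= b -> `|g b - g a| <= L / 2 * (b * `|b|) - L / 2 * (a * `|a|).
  move=> a0 ab; have b0 : 0 <= b by exact: le_trans ab.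
  have := @derivative_bound_le g _ (fun v => 1 * L * v) (fun v => 1 * (L / 2 * v ^+ 2)) a b ab gd (Kd 1).
  rewrite !mul1r (ger0_norm b0) (ger0_norm a0) -!expr2; apply => v /andP[av _].
  by have := f1_lip 0 v; rewrite ?mul1r subr0 (ger0_norm (le_trans a0 av)).
have neg a b : b <= 0 -> a <= b -> `|g b - g a| <= L / 2 * (b * `|b|) - L / 2 * (a * `|a|).
  move=> b0 ab; have a0 : a <= 0 by exact: le_trans b0.
  have := @derivative_bound_le g _ (fun v => -1 * L * v) (fun v => -1 * (L / 2 * v ^+ 2)) a b ab gd (Kd (-1)).
  rewrite !mulN1r (ler0_norm b0) (ler0_norm a0) !mulrN -!expr2; apply => v /andP[_ bv].
  by have := f1_lip 0 v; rewrite ?mulN1r subr0 (ler0_norm (le_trans bv b0)); lra.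
have [y0|y0] := leP y 0; first exact: neg.
have [x0|x0] := leP 0 x; first exact: pos.
have := pos 0 y (lexx _) (ltW y0); have := neg x 0 (lexx _) (ltW x0).
rewrite !mul0r !mulr0.
have := ler_normD (g y - g 0) (g 0 - g x); rewrite addrA subrK.
lra.
Qed.

Lemma lipschitz_measurable : measurable_fun setT f /\ measurable_fun setT f1.
Proof.
split.
  apply: continuous_measurable_fun => x.
  by apply: differentiable_continuous; apply/derivable1_diffP; have [] := fd x.
apply: continuous_measurable_fun => x; apply/cvgrPdist_le => e e0.
have L0 : 0 <= L.
  by have := f1_lip 0 1; rewrite subr0 normr1 mulr1; exact: le_trans.
near=> y; apply: le_trans (f1_lip y x) _.
have : `|x - y| <= e / (L + 1).
  by near: y; apply: cvgr_dist_le => //; rewrite divr_gt0//; lra.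
rewrite ler_pdivlMr; last lra.
by have := normr_ge0 (x - y); nra.
Unshelve. all: by end_near. Qed.

Lemma lipschitz_derivative_growth y : `|f1 y| <= `|f1 0| + L * `|y|.
Proof.
have := f1_lip 0 y; rewrite subr0.
by have := ler_normD (f1 y - f1 0) (f1 0); rewrite subrK; lra.
Qed.

Lemma lipschitz_growth y : `|f y| <= `|f 0| + `|f1 0| * `|y| + L / 2 * y ^+ 2.
Proof.
have := lipschitz_taylor 0 y; rewrite add0r.
have := ler_normD (f y - f 0 - y * f1 0) (f 0 + y * f1 0).
have -> : f y - f 0 - y * f1 0 + (f 0 + y * f1 0) = f y by ring.
by have := ler_normD (f 0) (y * f1 0); rewrite normrM mulrC; lra.
Qed.

End taylor.

(** * Stein functional of a single variable *)

Section monotone_stein.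
Context d (T : measurableType d) (R : realType) (P : probability T R).
Variables (f f1 : R -> R) (L : R).
Hypothesis fd : forall x : R, is_derive x 1 f (f1 x).
Hypothesis f1_lip : forall x y, `|f1 y - f1 x| <= L * `|y - x|.

(** Let [g] be the linearisation error of [f] at 0. The functions
    [L / 2 * (v * |v|) + s * g v], for [s = 1] and [s = -1], are nondecreasing by
    [lipschitz_remainder_mono], so their covariance with [V] is nonnegative.
    Linearising at 0 makes [V * |V|] appear, without any centring. *)
Lemma monotone_stein_bound (V : T -> R) :
  L1 P V -> L1 P (fun w => V w ^+ 2) -> L1 P (fun w => `|V w| ^+ 3) ->
  let a := \int[P]_w V w in
  L1 P (fun w => (V w - a) * f (V w)) /\
  `|\int[P]_w ((V w - a) * f (V w)) - f1 0 * (\int[P]_w (V w ^+ 2) - a ^+ 2)| <=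
  L / 2 * (\int[P]_w (`|V w| ^+ 3) - a * \int[P]_w (V w * `|V w|)).
Proof.
move=> V1 V2 V3 a; have mV := L1_measurable V1.
have L0 : 0 <= L.
  by have := f1_lip 0 1; rewrite subr0 normr1 mulr1; exact: le_trans.
have [mf mf1] := lipschitz_measurable fd f1_lip.
have nV1 := L1_norm V1.
have VnV : L1 P (fun w => V w * `|V w|).
  apply: (L1_le V2).
    by apply: measurable_funM => //; exact: (L1_measurable nV1).
  by move=> w; rewrite normrM normr_id -expr2 real_normK ?num_real.
have Vaf : L1 P (fun w => (V w - a) * f (V w)).
  pose c0 := `|f 0|; pose c1 := `|f1 0|; pose c2 := L / 2.
  pose b := `|a|.
  have H : L1 P (fun w => (b * c0 + (c0 + b * c1) * `|V w|) +
      ((c1 + b * c2) * V w ^+ 2 + c2 * `|V w| ^+ 3)).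
    exact: (L1D (L1D (L1_cst P _) (L1Z _ nV1)) (L1D (L1Z _ V2) (L1Z _ V3))).
  apply: (L1_le H).
    apply: measurable_funM; last exact: (measurableT_comp mf mV).
    exact: measurable_funB.
  move=> w; rewrite normrM.
  apply: (le_trans (ler_pM (normr_ge0 _) (normr_ge0 _) (ler_normB _ _) (lipschitz_growth fd f1_lip (V w)))).
  rewrite -/c0 -/c1 -/c2 -/b -(real_normK (num_real (V w))).
  by rewrite le_eqVlt; apply/orP; left; apply/eqP; ring.
split=> //.
pose g v := f v - f 0 - v * f1 0.
have VaV : L1 P (fun w => (V w - a) * V w).
  apply: eq_L1 (L1B V2 (L1Z a V1)) => w /=; rewrite expr2; ring.
have Va : L1 P (fun w => V w - a) by exact: (L1B V1 (L1_cst P a)).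
have Va0 : \int[P]_w (V w - a) = 0.
  by rewrite RintegralB//; [rewrite Rintegral_probability_cst subrr|exact: L1_cst].
have VaVE : \int[P]_w ((V w - a) * V w) = \int[P]_w (V w ^+ 2) - a ^+ 2.
  under eq_Rintegral do rewrite mulrBl -expr2.
  by rewrite RintegralB// ?RintegralZl// ?expr2//; exact: (L1Z a V1).
have Vag : L1 P (fun w => (V w - a) * g (V w)).
  apply: eq_L1 (L1B (L1B Vaf (L1Z (f 0) Va)) (L1Z (f1 0) VaV)) => w /=.
  by rewrite /g; ring.
have VagE : \int[P]_w ((V w - a) * g (V w)) =
    \int[P]_w ((V w - a) * f (V w)) - f1 0 * (\int[P]_w (V w ^+ 2) - a ^+ 2).
  transitivity (\int[P]_w ((V w - a) * f (V w) - (f 0 * (V w - a) + f1 0 * ((V w - a) * V w)))).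
    by apply: eq_Rintegral => w _; rewrite /g; ring.
  rewrite RintegralB//; last exact: (L1D (L1Z (f 0) Va) (L1Z (f1 0) VaV)).
  rewrite RintegralD//; [|exact: (L1Z (f 0) Va)|exact: (L1Z (f1 0) VaV)].
  by rewrite !RintegralZl// Va0 mulr0 add0r VaVE.
rewrite -VagE.
have VaVn : L1 P (fun w => (V w - a) * (V w * `|V w|)).
  apply: eq_L1 (L1B V3 (L1Z a VnV)) => w /=.
  have V2E : `|V w| ^+ 2 = V w ^+ 2 by rewrite real_normK ?num_real.
  by rewrite mulrBl (exprS _ 2) V2E; ring.
have VaVnE : \int[P]_w ((V w - a) * (V w * `|V w|)) =
    \int[P]_w (`|V w| ^+ 3) - a * \int[P]_w (V w * `|V w|).
  rewrite -RintegralZl// -RintegralB//; last exact: (L1Z a VnV).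
  apply: eq_Rintegral => w _.
  have V2E : `|V w| ^+ 2 = V w ^+ 2 by rewrite real_normK ?num_real.
  by rewrite mulrBl (exprS _ 2) V2E; ring.
rewrite -VaVnE -RintegralZl//.
have key (s : R) : `|s| = 1 ->
    0 <= \int[P]_w (L / 2 * ((V w - a) * (V w * `|V w|)) + s * ((V w - a) * g (V w))).
  move=> s1.
  (* Subtracting the value [k] at the mean turns the covariance into the integral
     of a product of two factors of the same sign. *)
  pose k := L / 2 * (a * `|a|) + s * g a.
  have E : \int[P]_w (L / 2 * ((V w - a) * (V w * `|V w|)) + s * ((V w - a) * g (V w))) =
      \int[P]_w (L / 2 * ((V w - a) * (V w * `|V w|)) + s * ((V w - a) * g (V w)) - k * (V w - a)).
    rewrite [RHS]RintegralB//; last 2 first.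
    - exact: (L1D (L1Z _ VaVn) (L1Z _ Vag)).
    - exact: (L1Z k Va).
    by rewrite [in X in _ - X]RintegralZl// Va0 mulr0 subr0.
  rewrite E; apply: Rintegral_ge0 => w _.
  have -> : L / 2 * ((V w - a) * (V w * `|V w|)) + s * ((V w - a) * g (V w)) - k * (V w - a) =
      (V w - a) * ((L / 2 * (V w * `|V w|) - L / 2 * (a * `|a|)) + s * (g (V w) - g a)).
    by rewrite /k; ring.
  have sg x y : - `|g y - g x| <= s * (g y - g x).
    have := ler_norm (- (s * (g y - g x))); rewrite normrN normrM s1 mul1r.
    by rewrite lerNl.
  have [aV|Va'] := leP a (V w).
    rewrite mulr_ge0 ?subr_ge0//.
    have := lipschitz_remainder_mono fd f1_lip aV; rewrite -/(g (V w)) -/(g a).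
    by have := sg a (V w); lra.
  rewrite mulr_le0 ?subr_le0 ?(ltW Va')//.
  have := lipschitz_remainder_mono fd f1_lip (ltW Va'); rewrite -/(g (V w)) -/(g a).
  have := sg a (V w); rewrite distrC => h1 h2.
  have := ler_norm (s * (g (V w) - g a)); rewrite normrM s1 mul1r distrC.
  by lra.
rewrite ler_norml; apply/andP; split.
  have := key 1 (normr1 _); rewrite RintegralD//; [|exact: (L1Z _ VaVn)|exact: (L1Z _ Vag)].
  by rewrite [X in _ + X]RintegralZl// mul1r; lra.
have : `|-1| = 1 :> R by rewrite normrN normr1.
move=> /key; rewrite RintegralD//; [|exact: (L1Z _ VaVn)|exact: (L1Z _ Vag)].
by rewrite [X in _ + X]RintegralZl// mulN1r; lra.
Qed.

End monotone_stein.

(** * Poisson random sums *)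

Section random_sums.
Context d (T : measurableType d) (R : realType) (P : probability T R).
Variables (lambda : R) (N : {RV P >-> nat}) (X Y : nat -> {RV P >-> R}).
Hypothesis lambda0 : 0 < lambda.
Hypothesis Npoisson : forall k : nat, P (N @^-1` [set k]) = (poisson_pmf lambda k)%:E.
Hypothesis Yindep : mutually_independent P (fun j => Y j : T -> R).
Hypothesis Ylaw0 : forall i, same_law P (Y i : T -> R) (Y 0%N).
Hypothesis indepN : independent_of_process P N (fun j w => (X j w, Y j w)).

(** The joint process is needed: the coupling compares [X] and [Y] under the same
   index [N]. *)
Let F : set (set T) :=
  \bigcup_i preimage_set_system setT (fun w => (X i w, Y i w)) measurable.

Let mpair j : measurable_fun setT (fun w => (X j w, Y j w)).
Proof. exact: measurable_fun_pair. Qed.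

Let F_sub : <<s F >> `<=` (@measurable _ T).
Proof.
apply: smallest_sub; first exact: sigma_algebra_measurable.
move=> A [i _ [B mB <-]]; rewrite setTI.
exact: (measurable_preimage (mpair i) mB).
Qed.

Let FN (A : set T) (B : set nat) : <<s F >> A -> measurable B ->
  P (A `&` N @^-1` B) = (P A * P (N @^-1` B))%E.
Proof. exact: indepN. Qed.

Let adapted_pair j :
  @measurable_fun _ _ (g_sigma_algebraType F) (R * R)%type setT (fun w => (X j w, Y j w)).
Proof.
move=> _ B mB; apply: sub_sigma_algebra.
by exists j => //; exists B.
Qed.

Let adaptedX j : adapted F (X j).
Proof. exact: (measurableT_comp measurable_fst (adapted_pair j)). Qed.

Let adaptedY j : adapted F (Y j).
Proof. exact: (measurableT_comp measurable_snd (adapted_pair j)). Qed.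

Let adapted_comp (g : R -> R) (U : T -> R) : measurable_fun setT g -> adapted F U -> adapted F (g \o U).
Proof. by move=> mg mU; exact: (measurableT_comp mg mU). Qed.

Let adapted_sum (W : nat -> T -> R) n : (forall j, adapted F (W j)) ->
  adapted F (fun w => \sum_(j < n) W j w).
Proof. move=> mW; apply: (@measurable_sum _ (g_sigma_algebraType F) R setT); exact: mW. Qed.

Let adaptedM (U V : T -> R) : adapted F U -> adapted F V -> adapted F (fun w => U w * V w).
Proof. by move=> mU mV; exact: (measurable_funM mU mV). Qed.

Let adaptedD (U V : T -> R) : adapted F U -> adapted F V -> adapted F (fun w => U w + V w).
Proof. by move=> mU mV; exact: (measurable_funD mU mV). Qed.

Let adapted_cst (c : R) : adapted F (fun=> c).
Proof. exact: measurable_cst. Qed.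

Let Ylaw i j : same_law P (Y i : T -> R) (Y j).
Proof. by apply: (same_law_trans (Ylaw0 i)); apply: same_law_sym; exact: Ylaw0. Qed.

Let palmN (U : nat -> T -> R) (mU : forall n, adapted F (U n)) :=
  palm lambda0 Npoisson F_sub FN mU.
Let random_ge0 (U : nat -> T -> R) (mU : forall n, adapted F (U n)) :=
  random_index_ge0 Npoisson F_sub FN mU.

Definition iid_sum w : R := \sum_(j < N w) Y j w.
Definition corr_sum w : R := \sum_(j < N w) X j w.
(** The first variable outside the sum; it is distributed as [Y 0] and independent
    of the sum, like the extra term created by the Palm identity. *)
Definition next_var w : R := Y (N w) w.
Definition multiple w : R := (N w)%:R * Y 0%N w.

Lemma measurable_iid_sum : measurable_fun setT iid_sum.
Proof.
apply: (@measurable_random_index _ _ _ P N (fun n w => \sum_(j < n) Y j w)) => n.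
exact: measurable_sum.
Qed.

Lemma measurable_corr_sum : measurable_fun setT corr_sum.
Proof.
apply: (@measurable_random_index _ _ _ P N (fun n w => \sum_(j < n) X j w)) => n.
exact: measurable_sum.
Qed.

Lemma measurable_next_var : measurable_fun setT next_var.
Proof. exact: (@measurable_random_index _ _ _ P N (fun n w => Y n w)). Qed.

Lemma measurable_multiple : measurable_fun setT multiple.
Proof.
apply: (@measurable_random_index _ _ _ P N (fun n w => n%:R * Y 0%N w)) => n.
exact: measurable_funM.
Qed.

Let random_index_event (U : nat -> T -> R) (A : set R) : (forall n, adapted F (U n)) ->
  measurable A ->
  P ((fun w => U (N w) w) @^-1` A) =
  (\sum_(0 <= n <oo) P (U n @^-1` A) * (poisson_pmf lambda n)%:E)%E.
Proof.
move=> mU mA.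
have mUN : measurable_fun setT (fun w => U (N w) w).
  by apply: measurable_random_index => n; exact: (adapted_measurable F_sub).
have E (V : T -> R) : measurable_fun setT V ->
    P (V @^-1` A) = (\int[P]_w (\1_A (V w))%:E)%E.
  move=> mV; have mVA := measurable_preimage mV mA.
  by rewrite -(setIT (V @^-1` A)) -integral_indic//; exact: eq_integral.
rewrite E// (random_ge0 (U := fun n w => \1_A (U n w))).
- apply: eq_eseriesr => n _; rewrite -E//; exact: (adapted_measurable F_sub).
- by move=> n; apply: (adapted_comp (g := \1_A)).
- by [].
Qed.

Lemma indep_sum_next n : indep2 P (fun w => \sum_(j < n) Y j w) (Y n).
Proof.
move=> A B mA mB; rewrite setIC muleC.
have -> : (fun w => \sum_(j < n) Y j w) = seq_sum Y (iota 0 n).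
  apply/funext => w; rewrite /seq_sum.
  by rewrite -(big_mkord xpredT (fun i => Y i w)) /index_iota subn0.
apply: (indep2_seq_sum Yindep) => //=.
by rewrite iota_uniq mem_iota add0n ltnn andbF.
Qed.

(** Conditionally on [N = n] the two variables are independent, and the law of the
   second one does not depend on [n]. *)
Let indep_iid_sum_next0 (A B : set R) : measurable A -> measurable B ->
  P ((iid_sum @^-1` A) `&` (next_var @^-1` B)) =
  (P (iid_sum @^-1` A) * P (Y 0%N @^-1` B))%E.
Proof.
move=> mA mB.
pose ind (C : set R) (n : nat) w : R := \1_A (\sum_(j < n) Y j w) * \1_C (Y n w).
have E (U V : T -> R) : measurable_fun setT U -> measurable_fun setT V ->
    P ((U @^-1` A) `&` (V @^-1` B)) = (\int[P]_w (\1_A (U w) * \1_B (V w))%:E)%E.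
  move=> mU mV; have mUV := measurableI _ _ (measurable_preimage mU mA) (measurable_preimage mV mB).
  rewrite -(setIT (_ `&` _)) -integral_indic//; apply: eq_integral => w _.
  by rewrite indicI.
rewrite E; [|exact: measurable_iid_sum|exact: measurable_next_var].
rewrite (random_ge0 (U := fun n w => \1_A (\sum_(j < n) Y j w) * \1_B (Y n w))); last 2 first.
- move=> n; apply: adaptedM; first by apply: (adapted_comp (g := \1_A)) => //; exact: (adapted_sum n adaptedY).
  exact: (adapted_comp (g := \1_B)).
- by move=> n w; rewrite mulr_ge0.
rewrite (@random_index_event (fun n w => \sum_(j < n) Y j w))//; last by move=> n; exact: (adapted_sum n adaptedY).
have PB : P (Y 0%N @^-1` B) = (fine (P (Y 0%N @^-1` B)))%:E.
  by rewrite fineK// fin_num_measure//; exact: measurable_preimage.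
rewrite muleC PB -nneseriesZl; last first.
  by move=> n _; rewrite mule_ge0// lee_fin poisson_pmf_ge0.
apply: eq_eseriesr => n _.
rewrite -PB -E//; last exact: measurable_sum.
have YB : P (Y n @^-1` B) = P (Y 0%N @^-1` B) := Ylaw0 n mB.
rewrite indep_sum_next// YB.
by rewrite muleAC muleC.
Qed.

Lemma next_var_law : same_law P next_var (Y 0%N).
Proof.
move=> B mB; have := indep_iid_sum_next0 measurableT mB.
by rewrite preimage_setT setTI probability_setT mul1e.
Qed.

Lemma indep_iid_sum_next : indep2 P iid_sum next_var.
Proof.
move=> A B mA mB; rewrite indep_iid_sum_next0//.
by have -> : P (next_var @^-1` B) = P (Y 0%N @^-1` B) := next_var_law mB.
Qed.

(** The weights of the mixture do not depend on the number of terms, hence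
    averaging [equally_correlated_sum_law] over [N] keeps them. *)
Lemma corr_sum_law (rho : R) : 0 <= rho <= 1 ->
  equally_correlated P rho (fun j => X j : T -> R) ->
  (forall j, same_law P (X j : T -> R) (Y 0%N)) ->
  forall A, measurable A ->
  P (corr_sum @^-1` A) =
    (rho%:E * P (multiple @^-1` A) + (1 - rho)%:E * P (iid_sum @^-1` A))%E.
Proof.
move=> rho01 Xcorr Xlaw A mA; have /andP[rho0 rho1] := rho01.
have rho1' : 0 <= 1 - rho by rewrite subr_ge0.
rewrite (@random_index_event (fun n w => \sum_(j < n) X j w))//; last by move=> n; exact: (adapted_sum n adaptedX).
rewrite (@random_index_event (fun n w => \sum_(j < n) Y j w))//; last by move=> n; exact: (adapted_sum n adaptedY).
rewrite (@random_index_event (fun n w => n%:R * Y 0%N w))//; last by move=> n; exact: adaptedM.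
have p0 n (B : set T) : (0 <= P B * (poisson_pmf lambda n)%:E)%E.
  by rewrite mule_ge0// lee_fin poisson_pmf_ge0.
rewrite -!nneseriesZl// -nneseriesD; last 2 first.
- by move=> n _ _; rewrite mule_ge0// lee_fin.
- by move=> n _ _; rewrite mule_ge0// lee_fin.
apply: eq_eseriesr => n _.
rewrite (equally_correlated_sum_law Yindep Ylaw rho01 Xcorr Xlaw)//.
rewrite muleDl ?muleA//.
apply: fin_num_adde_defr; rewrite fin_numM// fin_num_measure//.
by apply: measurable_preimage => //; exact: measurable_funM.
Qed.

(** The identity holds termwise for signed integrands; the nonnegative parts are
   moved across so that [random_ge0] applies to both sides. *)
Let random_eq (U W : nat -> T -> R) : (forall n, adapted F (U n)) -> (forall n, adapted F (W n)) ->
  (forall n, L1 P (U n)) -> (forall n, L1 P (W n)) ->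
  (forall n, \int[P]_w U n w = \int[P]_w W n w) ->
  L1 P (fun w => U (N w) w) -> L1 P (fun w => W (N w) w) ->
  \int[P]_w U (N w) w = \int[P]_w W (N w) w.
Proof.
move=> mU mW U1 W1 UW UN WN.
have pos (V : T -> R) : L1 P V -> L1 P (fun w => V^\+ w).
  move=> V1; apply: (L1_le (L1_norm V1)); first exact: (measurable_funrpos (L1_measurable V1)).
  move=> w; rewrite ger0_norm ?funrpos_ge0//.
  have /(congr1 (@^~ w)) /= <- := funrposDneg V.
  by rewrite [leRHS]/(_ + _) lerDl funrneg_ge0.
have neg (V : T -> R) : L1 P V -> L1 P (fun w => V^\- w).
  move=> V1; apply: (L1_le (L1_norm V1)); first exact: (measurable_funrneg (L1_measurable V1)).
  move=> w; rewrite ger0_norm ?funrneg_ge0//.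
  have /(congr1 (@^~ w)) /= <- := funrposDneg V.
  by rewrite [leRHS]/(_ + _) lerDr funrpos_ge0.
have decomp (V : T -> R) w : V w = V^\+ w - V^\- w.
  by rewrite -[in LHS](funrposBneg V).
have intE (V : T -> R) : L1 P V -> \int[P]_w V w = \int[P]_w V^\+ w - \int[P]_w V^\- w.
  move=> V1; rewrite -RintegralB//; [|exact: pos|exact: neg].
  by apply: eq_Rintegral => w _; exact: decomp.
have key (V V' : T -> R) : L1 P V -> L1 P V' ->
    (\int[P]_w (V^\+ w + V'^\- w)%:E = (\int[P]_w V^\+ w + \int[P]_w V'^\- w)%:E)%E.
  move=> V1 V1'; rewrite -RintegralD//; [|exact: pos|exact: neg].
  by rewrite -(integralE_Rintegral (L1D (pos _ V1) (neg _ V1'))).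
have ad (A B : nat -> T -> R) n : (forall n, adapted F (A n)) -> (forall n, adapted F (B n)) ->
    adapted F (fun w => (A n)^\+ w + (B n)^\- w).
  by move=> mA mB; exact: (adaptedD (measurable_funrpos (mA n)) (measurable_funrneg (mB n))).
have E1 : (\int[P]_w ((U (N w))^\+ w + (W (N w))^\- w)%:E =
    \int[P]_w ((W (N w))^\+ w + (U (N w))^\- w)%:E)%E.
  rewrite (random_ge0 (fun n => ad U W n mU mW)); last first.
    by move=> n w; rewrite addr_ge0 ?funrpos_ge0 ?funrneg_ge0.
  rewrite (random_ge0 (fun n => ad W U n mW mU)); last first.
    by move=> n w; rewrite addr_ge0 ?funrpos_ge0 ?funrneg_ge0.
  apply: eq_eseriesr => n _; rewrite !key//; congr (_%:E * _)%E.
  by have := UW n; rewrite (intE _ (U1 n)) (intE _ (W1 n)); lra.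
have := key _ _ UN WN; have := key _ _ WN UN.
rewrite (intE _ UN) (intE _ WN) => H1 H2.
by move: E1; rewrite [LHS]H2 [RHS]H1 => -[]; lra.
Qed.

(** Both sides equal [E (N * W 0)]: termwise on the left, and by the Palm identity
   on the right. *)
Let wald_ge0 (W : nat -> T -> R) : (forall n, adapted F (W n)) -> (forall n w, 0 <= W n w) ->
  (forall n, \int[P]_w (W n w)%:E = \int[P]_w (W 0%N w)%:E)%E ->
  (\int[P]_w (\sum_(j < N w) W j w)%R%:E = lambda%:E * \int[P]_w (W 0%N w)%:E)%E.
Proof.
move=> mW W0 WW.
rewrite (random_ge0 (U := fun n w => \sum_(j < n) W j w)); last 2 first.
- by move=> n; exact: (adapted_sum n mW).
- by move=> n w; exact: sumr_ge0.
rewrite -(palm_ge0 lambda0 Npoisson F_sub FN (U := fun=> W 0%N))//.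
rewrite (random_ge0 (U := fun n w => n%:R * W 0%N w)); last 2 first.
- by move=> n; exact: adaptedM.
- by move=> n w; rewrite mulr_ge0.
apply: eq_eseriesr => n _; congr (_ * _)%E.
have mW' j : measurable_fun setT (fun w => (W j w)%:E).
  by apply/measurable_EFinP; exact: (adapted_measurable F_sub).
under eq_integral do rewrite -sumEFin.
rewrite ge0_integral_sum//; last by move=> j w _; rewrite lee_fin.
under eq_bigr do rewrite WW.
under [RHS]eq_integral do rewrite EFinM.
rewrite ge0_integralZl//; last by move=> w _; rewrite lee_fin.
elim: n => [|n IH]; first by rewrite big_ord0 mul0e.
rewrite big_ord_recr /= IH -addn1 natrD EFinD ge0_muleDl ?mul1e ?lee_fin//.
Qed.

Let poisson_moment1 (g : T -> R) : adapted F g -> L1 P g ->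
  L1 P (fun w => (N w)%:R * g w) /\
  \int[P]_w ((N w)%:R * g w) = lambda * \int[P]_w g w.
Proof. by move=> mg g1; exact: (palmN (U := fun=> g)). Qed.

(** Each Palm step replaces one factor [N] by [N + 1], which is then expanded. *)
Let poisson_moment2 (g : T -> R) : adapted F g -> L1 P g ->
  L1 P (fun w => (N w)%:R * ((N w)%:R * g w)) /\
  \int[P]_w ((N w)%:R * ((N w)%:R * g w)) = lambda * (lambda + 1) * \int[P]_w g w.
Proof.
move=> mg g1; have [Ng1 NgE] := poisson_moment1 mg g1.
have E w : (N w).+1%:R * g w = (N w)%:R * g w + g w by rewrite -addn1 natrD mulrDl mul1r.
have [||H1 H2] := @palmN (fun n w => n%:R * g w).
- by move=> n; exact: adaptedM.
- by apply: eq_L1 (L1D Ng1 g1) => w; rewrite E.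
split => //; rewrite H2; under eq_Rintegral do rewrite E.
by rewrite RintegralD// NgE; ring.
Qed.

Let poisson_moment3 (g : T -> R) : adapted F g -> L1 P g ->
  L1 P (fun w => (N w)%:R * ((N w)%:R * ((N w)%:R * g w))) /\
  \int[P]_w ((N w)%:R * ((N w)%:R * ((N w)%:R * g w))) =
    lambda * (lambda ^+ 2 + 3 * lambda + 1) * \int[P]_w g w.
Proof.
move=> mg g1; have [Ng1 NgE] := poisson_moment1 mg g1.
have [NNg1 NNgE] := poisson_moment2 mg g1.
have E w : (N w).+1%:R * ((N w).+1%:R * g w) =
    (N w)%:R * ((N w)%:R * g w) + (2 * ((N w)%:R * g w) + g w).
  by rewrite -addn1 natrD; ring.
have [||H1 H2] := @palmN (fun n w => n%:R * (n%:R * g w)).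
- by move=> n; do 2 apply: adaptedM => //.
- by apply: eq_L1 (L1D NNg1 (L1D (L1Z 2 Ng1) g1)) => w; rewrite E.
split => //; rewrite H2; under eq_Rintegral do rewrite E.
rewrite RintegralD//; last exact: (L1D (L1Z 2 Ng1) g1).
rewrite RintegralD//; last exact: (L1Z 2 Ng1).
by rewrite RintegralZl// NNgE NgE; ring.
Qed.

Hypothesis Y3 : L1 P (fun w => `|Y 0%N w| ^+ 3).

Let mY0 : measurable_fun setT (Y 0%N) := measurable_funPT (Y 0%N).
Let Y2 : L1 P (fun w => Y 0%N w ^+ 2) := L1_cube_sqr mY0 Y3.
Let Y1 : L1 P (Y 0%N) := L1_sqr_id mY0 Y2.

Let sqr_meas : measurable_fun setT (fun x : R => x ^+ 2).
Proof. exact: measurable_funX. Qed.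

Let cube_meas : measurable_fun setT (fun x : R => `|x| ^+ 3).
Proof. by apply: measurable_funX; exact: normr_measurable. Qed.

Lemma next_var_moments :
  [/\ L1 P next_var /\ \int[P]_w next_var w = \int[P]_w Y 0%N w,
      L1 P (fun w => next_var w ^+ 2) /\
        \int[P]_w (next_var w ^+ 2) = \int[P]_w (Y 0%N w ^+ 2) &
      L1 P (fun w => `|next_var w| ^+ 3) /\
        \int[P]_w (`|next_var w| ^+ 3) = \int[P]_w (`|Y 0%N w| ^+ 3)].
Proof.
have law := same_law_sym next_var_law.
have mn := measurable_next_var.
split.
- by have [? ->] := same_law_L1 mY0 mn (@measurable_id _ R setT) law Y1.
- by have [? ->] := same_law_L1 mY0 mn sqr_meas law Y2.
- by have [? ->] := same_law_L1 mY0 mn cube_meas law Y3.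
Qed.

Let Yj2 j : L1 P (fun w => Y j w ^+ 2) /\ \int[P]_w (Y j w ^+ 2) = \int[P]_w (Y 0%N w ^+ 2).
Proof.
have [H E] := same_law_L1 mY0 (measurable_funPT (Y j)) sqr_meas (Ylaw 0 j) Y2.
by split => //; rewrite -E.
Qed.

Let sum2 n : L1 P (fun w => (\sum_(j < n) Y j w) ^+ 2).
Proof.
have [S1 _] := L1_sum n (fun j => (Yj2 j).1).
apply: (L1_le (L1Z n%:R S1)).
  by apply: measurable_funX; exact: measurable_sum.
move=> w; rewrite ger0_norm ?sqr_ge0//.
exact: (sqr_sum_le (fun j => Y j w)).
Qed.

Lemma L1_iid_sum_sqr : L1 P (fun w => iid_sum w ^+ 2).
Proof.
have aY2 j : adapted F (fun w => Y j w ^+ 2) by exact: (adapted_comp sqr_meas (adaptedY j)).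
have Q1 : L1 P (fun w => \sum_(j < N w) Y j w ^+ 2).
  apply: L1_ge0P.
  - by apply: (@measurable_random_index _ _ _ P N (fun n w => \sum_(j < n) Y j w ^+ 2)) => n;
      apply: measurable_sum => j; exact: measurable_funX.
  - by move=> w; rewrite sumr_ge0// => j _; exact: sqr_ge0.
  - rewrite (wald_ge0 (W := fun j w => Y j w ^+ 2))//.
    + by rewrite (integralE_Rintegral Y2) ltry.
    + by move=> j w; exact: sqr_ge0.
    + by move=> j; rewrite (integralE_Rintegral (Yj2 j).1) (Yj2 j).2 (integralE_Rintegral Y2).
have [_ [n2 _] _] := next_var_moments.
have [||H _] := @palmN (fun n w => \sum_(j < n) Y j w ^+ 2).
- by move=> n; exact: (adapted_sum n aY2).
- by apply: eq_L1 (L1D Q1 n2) => w; rewrite big_ord_recr.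
apply: (L1_le H); first by apply: measurable_funX; exact: measurable_iid_sum.
move=> w; rewrite ger0_norm ?sqr_ge0//.
exact: (sqr_sum_le (fun j => Y j w)).
Qed.

Lemma L1_iid_sum : L1 P iid_sum.
Proof. exact: (L1_sqr_id measurable_iid_sum L1_iid_sum_sqr). Qed.

(** Given [N = n], the [n] summands contribute equally to [E (C f(C))] by
    [summand_sum_same_law], so that [C f(C)] may be replaced by [n] times the last
    summand times [f(C)]; the Palm identity then turns the last summand into
    an additional one. *)
Lemma iid_sum_size_bias (f : R -> R) (M : R) : measurable_fun setT f ->
  (forall y, `|f y| <= M * (1 + `|y|)) ->
  [/\ L1 P (fun w => iid_sum w * f (iid_sum w)),
      L1 P (fun w => next_var w * f (iid_sum w + next_var w)) &
      \int[P]_w (iid_sum w * f (iid_sum w)) =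
      lambda * \int[P]_w (next_var w * f (iid_sum w + next_var w))].
Proof.
move=> mf fM.
have M0 : 0 <= M by have := fM 0; rewrite normr0 addr0 mulr1; exact: le_trans.
have f2 (U : T -> R) : measurable_fun setT U -> L1 P (fun w => U w ^+ 2) ->
    L1 P (fun w => f (U w) ^+ 2).
  move=> mU U2; apply: (L1_le (L1Z (M ^+ 2 * 2) (L1D (L1_cst P 1) U2))).
    by apply: measurable_funX; exact: (measurableT_comp mf mU).
  move=> w; rewrite ger0_norm ?sqr_ge0// -(real_normK (num_real (f (U w)))).
  rewrite -(real_normK (num_real (U w))).
  apply: (@le_trans _ _ ((M * (1 + `|U w|)) ^+ 2)).
    by rewrite ler_sqr ?nnegrE// mulr_ge0// addr_ge0.
  rewrite exprMn -mulrA ler_wpM2l ?sqr_ge0//.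
  have : 0 <= (1 - `|U w|) ^+ 2 by exact: sqr_ge0.
  by rewrite mulrDr mulr1; lra.
have mC := measurable_iid_sum; have mn := measurable_next_var.
have C2 := L1_iid_sum_sqr.
have [_ [n2 _] _] := next_var_moments.
have S2 : L1 P (fun w => (iid_sum w + next_var w) ^+ 2).
  apply: (L1_le (L1Z 2 (L1D C2 n2))).
    by apply: measurable_funX; exact: measurable_funD.
  move=> w; rewrite ger0_norm ?sqr_ge0//.
  have : 0 <= (iid_sum w - next_var w) ^+ 2 by exact: sqr_ge0.
  by lra.
have L1C : L1 P (fun w => iid_sum w * f (iid_sum w)).
  by apply: L1_mul_sqr => //; [exact: (measurableT_comp mf mC)|exact: f2].
have mD : measurable_fun setT (fun w => iid_sum w + next_var w) by exact: measurable_funD.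
have L1N : L1 P (fun w => next_var w * f (iid_sum w + next_var w)).
  by apply: L1_mul_sqr => //; [exact: (measurableT_comp mf mD)|exact: f2].
split => //.
(* At [n = 0] the value is irrelevant: it is multiplied by [N = 0]. *)
pose U n w := Y n.-1 w * f (\sum_(j < n) Y j w).
have aU n : adapted F (U n).
  apply: adaptedM => //; apply: (adapted_comp mf); exact: (adapted_sum n adaptedY).
have UN1 w : U (N w).+1 w = next_var w * f (iid_sum w + next_var w).
  by rewrite /U /= big_ord_recr.
have [|H1 H2] := @palmN U aU.
  by apply: eq_L1 L1N => w; rewrite UN1.
transitivity (\int[P]_w ((N w)%:R * U (N w) w)); last first.
  by rewrite H2; congr (_ * _); apply: eq_Rintegral => w _; rewrite UN1.
have mS n : measurable_fun setT (fun w => \sum_(j < n) Y j w) by exact: measurable_sum.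
have YjS j n : L1 P (fun w => Y j w * f (\sum_(j < n) Y j w)).
  apply: L1_mul_sqr => //; first exact: (measurableT_comp mf (mS n)).
    exact: (Yj2 j).1.
  exact: f2.
apply: (random_eq (U := fun n w => (\sum_(j < n) Y j w) * f (\sum_(j < n) Y j w))
  (W := fun n w => n%:R * U n w)) => //.
- move=> n; apply: adaptedM; first exact: (adapted_sum n adaptedY).
  by apply: (adapted_comp mf); exact: (adapted_sum n adaptedY).
- by move=> n; exact: adaptedM.
- move=> n; apply: L1_mul_sqr => //; first exact: (measurableT_comp mf (mS n)).
  exact: f2.
- by move=> n; exact: (L1Z n%:R (YjS n.-1 n)).
- case=> [|n].
    rewrite (eq_Rintegral _ (g := fun=> 0)); last by move=> w _; rewrite big_ord0 mul0r.
    by rewrite [RHS](eq_Rintegral _ (g := fun=> 0)) // => w _; rewrite mul0r.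
  rewrite RintegralZl//; last exact: (YjS n n.+1).
  under eq_Rintegral do rewrite mulr_suml.
  have [_ ->] := L1_sum n.+1 (fun j => YjS j n.+1).
  transitivity (\sum_(j < n.+1) \int[P]_w (Y n w * f (\sum_(j < n.+1) Y j w))).
    apply: eq_bigr => j _.
    have mg : measurable_fun setT (fun z : R * R => z.1 * f z.2).
      apply: measurable_funM; first exact: measurable_fst.
      exact: (measurableT_comp mf measurable_snd).
    have mp k : measurable_fun setT (fun w => (Y k w : R, \sum_(i < n.+1) Y i w)).
      exact: measurable_fun_pair.
    have law := summand_sum_same_law Yindep Ylaw (ltn_ord j).
    by have [_ ->] := same_law_L1 (mp j) (mp n) mg law (YjS j n.+1).
  by rewrite sumr_const card_ord mulr_natl.
Qed.

Notation mean := (\int[P]_w Y 0%N w).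
Notation second := (\int[P]_w (Y 0%N w ^+ 2)).
Notation third := (\int[P]_w (`|Y 0%N w| ^+ 3)).

(** By [iid_sum_size_bias] and independence, the difference is
    [lambda * E (X (f (C + X) - f C - X * f1 C))] with [X = next_var]. The growth
    condition on [f] admits constants and the identity, which give the first
    two moments of [C]. *)
Lemma iid_sum_stein (f f1 : R -> R) (L M : R) :
  (forall x : R, is_derive x 1 f (f1 x)) ->
  (forall x y, `|f1 y - f1 x| <= L * `|y - x|) ->
  (forall y, `|f y| <= M * (1 + `|y|)) ->
  [/\ L1 P (fun w => (iid_sum w - lambda * mean) * f (iid_sum w)),
      L1 P (fun w => f1 (iid_sum w)) &
  `|\int[P]_w ((iid_sum w - lambda * mean) * f (iid_sum w)) -
    lambda * second * \int[P]_w f1 (iid_sum w)| <= lambda * (L / 2) * third].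
Proof.
move=> fd f1_lip fM.
have [mf mf1] := lipschitz_measurable fd f1_lip.
have [Cf1 Nf1 CfE] := iid_sum_size_bias mf fM.
have [[n1 n1E] [n2 n2E] [n3 n3E]] := next_var_moments.
have mC := measurable_iid_sum; have mn := measurable_next_var.
have C1 := L1_iid_sum.
have M0 : 0 <= M by have := fM 0; rewrite normr0 addr0 mulr1; exact: le_trans.
have fC : L1 P (fun w => f (iid_sum w)).
  apply: (L1_le (L1Z M (L1D (L1_cst P 1) (L1_norm C1)))) => //.
  exact: (measurableT_comp mf mC).
have f1C : L1 P (fun w => f1 (iid_sum w)).
  apply: (L1_le (L1D (L1_cst P `|f1 0|) (L1Z L (L1_norm C1)))).
    exact: (measurableT_comp mf1 mC).
  by move=> w; exact: (lipschitz_derivative_growth f1_lip).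
have Caf : L1 P (fun w => (iid_sum w - lambda * mean) * f (iid_sum w)).
  by apply: eq_L1 (L1B Cf1 (L1Z (lambda * mean) fC)) => w /=; rewrite mulrBl.
split => //.
have indep_sym (g k : R -> R) : measurable_fun setT g -> measurable_fun setT k ->
    L1 P (fun w => g (next_var w)) -> L1 P (fun w => k (iid_sum w)) ->
    L1 P (fun w => g (next_var w) * k (iid_sum w)) /\
    \int[P]_w (g (next_var w) * k (iid_sum w)) =
    (\int[P]_w g (next_var w)) * (\int[P]_w k (iid_sum w)).
  move=> mg mk g1 k1.
  have [H E] := indep2_L1M (indep2_comp mk mg indep_iid_sum_next) k1 g1.
  split; first by apply: eq_L1 H => w /=; rewrite mulrC.
  by rewrite [RHS]mulrC -E; apply: eq_Rintegral => w _ /=; rewrite mulrC.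
have [nf nfE] := indep_sym id f (@measurable_id _ R setT) mf n1 fC.
have [n2f1 n2f1E] := indep_sym (fun x => x ^+ 2) f1 sqr_meas mf1 n2 f1C.
have E1 : \int[P]_w ((iid_sum w - lambda * mean) * f (iid_sum w)) =
    lambda * \int[P]_w (next_var w * f (iid_sum w + next_var w) - next_var w * f (iid_sum w)).
  under eq_Rintegral do rewrite mulrBl.
  rewrite RintegralB//; last exact: (L1Z (lambda * mean) fC).
  rewrite RintegralZl// CfE RintegralB// [in RHS]nfE n1E; ring.
have E2 : \int[P]_w ((iid_sum w - lambda * mean) * f (iid_sum w)) -
    lambda * second * \int[P]_w f1 (iid_sum w) =
    lambda * \int[P]_w (next_var w * f (iid_sum w + next_var w) - next_var w * f (iid_sum w) -
      next_var w ^+ 2 * f1 (iid_sum w)).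
  rewrite E1 [in RHS]RintegralB//; last exact: (L1B Nf1 nf).
  by rewrite n2f1E n2E; ring.
have D1 := L1B (L1B Nf1 nf) n2f1.
rewrite E2 normrM (gtr0_norm lambda0) -mulrA ler_pM2l// -n3E -RintegralZl//.
apply: (le_trans (le_normr_Rintegral measurableT D1)).
apply: Rintegral_le; [exact: L1_norm|exact: L1Z|].
move=> w; set c := iid_sum w; set x := next_var w.
have -> : x * f (c + x) - x * f c - x ^+ 2 * f1 c = x * (f (c + x) - f c - x * f1 c) by ring.
rewrite normrM; have := lipschitz_taylor fd f1_lip c x.
rewrite -[x ^+ 2]real_normK ?num_real// => H.
rewrite (exprS _ 2) mulrCA; apply: ler_wpM2l => //.
Qed.

Lemma iid_sum_mean : \int[P]_w iid_sum w = lambda * mean.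
Proof.
have d1 (x : R) : is_derive x 1 (fun=> 1 : R) 0 by exact: is_derive_cst.
have [||H1 H2] := @iid_sum_stein (fun=> 1) (fun=> 0) 0 1 d1.
- by move=> x y; rewrite subrr normr0 mul0r.
- by move=> y; rewrite normr1 mul1r lerDl.
rewrite mul0r mulr0 mul0r normr_le0 subr_eq0 => /eqP.
under eq_Rintegral do rewrite mulr1.
rewrite Rintegral_probability_cst mulr0 RintegralB//; [|exact: L1_iid_sum|exact: L1_cst].
by rewrite Rintegral_probability_cst => /eqP; rewrite subr_eq0 => /eqP.
Qed.

Lemma iid_sum_sqr_mean : \int[P]_w (iid_sum w ^+ 2) = lambda * second + (lambda * mean) ^+ 2.
Proof.
have d1 (x : R) : is_derive x 1 (id : R -> R) 1 by exact: is_derive_id.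
have [||H1 H2] := @iid_sum_stein id (fun=> 1) 0 1 d1.
- by move=> x y; rewrite subrr normr0 mul0r.
- by move=> y; rewrite mul1r lerDr.
rewrite mul0r mulr0 mul0r normr_le0 subr_eq0 => /eqP.
under eq_Rintegral do rewrite mulrBl -expr2.
rewrite Rintegral_probability_cst mulr1 RintegralB//; last 2 first.
- exact: L1_iid_sum_sqr.
- exact: (L1Z _ L1_iid_sum).
by rewrite RintegralZl ?iid_sum_mean//; [lra|exact: L1_iid_sum].
Qed.

Let Yabs : L1 P (fun w => Y 0%N w * `|Y 0%N w|).
Proof.
apply: (L1_le Y2).
  by apply: measurable_funM => //; exact: (L1_measurable (L1_norm Y1)).
by move=> w; rewrite normrM normr_id -expr2 real_normK ?num_real.
Qed.

Let adapted_abs : adapted F (fun w => Y 0%N w * `|Y 0%N w|).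
Proof.
apply: (adapted_comp (g := fun x : R => x * `|x|)) => //.
by apply: measurable_funM => //; exact: normr_measurable.
Qed.

(** [N] and [Y 0] are independent, so these are products of Poisson moments
    [lambda], [lambda * (lambda + 1)], [lambda * (lambda ^+ 2 + 3 * lambda + 1)] with moments
    of [Y 0]. *)
Lemma multiple_moments :
  [/\ L1 P multiple /\ \int[P]_w multiple w = lambda * mean,
      L1 P (fun w => multiple w ^+ 2) /\
        \int[P]_w (multiple w ^+ 2) = lambda * (lambda + 1) * second,
      L1 P (fun w => multiple w * `|multiple w|) /\
        \int[P]_w (multiple w * `|multiple w|) =
        lambda * (lambda + 1) * \int[P]_w (Y 0%N w * `|Y 0%N w|) &
      L1 P (fun w => `|multiple w| ^+ 3) /\
        \int[P]_w (`|multiple w| ^+ 3) =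
        lambda * (lambda ^+ 2 + 3 * lambda + 1) * third].
Proof.
have a0 := adaptedY 0%N.
have [A1 A2] := poisson_moment1 a0 Y1.
have [B1 B2] := poisson_moment2 (adapted_comp sqr_meas a0) Y2.
have [C1 C2] := poisson_moment2 adapted_abs Yabs.
have [D1 D2] := poisson_moment3 (adapted_comp cube_meas a0) Y3.
have EB w : (N w)%:R * ((N w)%:R * Y 0%N w ^+ 2) = multiple w ^+ 2.
  by rewrite /multiple; ring.
have EC w : (N w)%:R * ((N w)%:R * (Y 0%N w * `|Y 0%N w|)) = multiple w * `|multiple w|.
  by rewrite /multiple normrM normr_nat; ring.
have ED w : (N w)%:R * ((N w)%:R * ((N w)%:R * `|Y 0%N w| ^+ 3)) = `|multiple w| ^+ 3.
  by rewrite /multiple normrM normr_nat; ring.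
split; split => //.
- exact: (eq_L1 EB B1).
- by rewrite -B2; apply: eq_Rintegral => w _; rewrite -EB.
- exact: (eq_L1 EC C1).
- by rewrite -C2; apply: eq_Rintegral => w _; rewrite -EC.
- exact: (eq_L1 ED D1).
- by rewrite -D2; apply: eq_Rintegral => w _; rewrite -ED.
Qed.

Hypothesis pair_law : forall j, same_law P (fun w => (X j w, Y j w)) (fun w => (X 0%N w, Y 0%N w)).
Hypothesis X1 : L1 P (X 0%N).

(** Both sums run over the same index set, so the triangle inequality and Wald's
    identity for the variables [|Y j - X j|] suffice. *)
Lemma random_sums_distance :
  L1 P (fun w => `|corr_sum w - iid_sum w|) /\
  \int[P]_w `|corr_sum w - iid_sum w| <= lambda * \int[P]_w `|Y 0%N w - X 0%N w|.
Proof.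
pose D j w := `|Y j w - X j w|.
have D1 : L1 P (D 0%N) by exact: (L1_norm (L1B Y1 X1)).
have mg : measurable_fun setT (fun z : R * R => `|z.2 - z.1|).
  apply: (measurableT_comp (@normr_measurable R setT)).
  by apply: measurable_funB; [exact: measurable_snd|exact: measurable_fst].
have aD j : adapted F (D j) by exact: (measurableT_comp mg (adapted_pair j)).
have DE j : (\int[P]_w (D j w)%:E = \int[P]_w (D 0%N w)%:E)%E.
  apply: (same_law_ge0_integral (g := fun z : R * R => (`|z.2 - z.1|)%:E) (mpair j) (mpair 0%N)).
  - exact/measurable_EFinP.
  - by move=> z; rewrite lee_fin.
  - exact: pair_law.
have W : (\int[P]_w (\sum_(j < N w) D j w)%R%:E = lambda%:E * \int[P]_w (D 0%N w)%:E)%E.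
  by apply: wald_ge0 => // n w; exact: normr_ge0.
rewrite (integralE_Rintegral D1) in W.
have S1 : L1 P (fun w => \sum_(j < N w) D j w).
  apply: L1_ge0P; last by rewrite W ltry.
    apply: (@measurable_random_index _ _ _ P N (fun n w => \sum_(j < n) D j w)) => n.
    by apply: measurable_sum => j; exact: (adapted_measurable F_sub).
  by move=> w; rewrite sumr_ge0// => j _; exact: normr_ge0.
have le w : `|corr_sum w - iid_sum w| <= \sum_(j < N w) D j w.
  rewrite /corr_sum /iid_sum -sumrB; apply: (le_trans (ler_norm_sum _ _ _)).
  by apply: ler_sum => j _; rewrite distrC.
have H : L1 P (fun w => `|corr_sum w - iid_sum w|).
  apply: (L1_le S1); last by move=> w; rewrite normr_id.
  apply: (measurableT_comp (@normr_measurable R setT)).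
  by apply: measurable_funB; [exact: measurable_corr_sum|exact: measurable_iid_sum].
split => //.
have WE : \int[P]_w (\sum_(j < N w) D j w) = lambda * \int[P]_w D 0%N w.
  by rewrite /Rintegral W.
by rewrite -WE; exact: Rintegral_le.
Qed.

End random_sums.

(** * Stein functional of the equally correlated sum *)

Section equally_correlated_random_sum.
Context d (T : measurableType d) (R : realType) (P : probability T R).
Variables (lambda rho : R) (N : {RV P >-> nat}) (X Y : nat -> {RV P >-> R}).
Hypothesis lambda0 : 0 < lambda.
Hypothesis Npoisson : forall k : nat, P (N @^-1` [set k]) = (poisson_pmf lambda k)%:E.
Hypothesis Yindep : mutually_independent P (fun j => Y j : T -> R).
Hypothesis Ylaw0 : forall i, same_law P (Y i : T -> R) (Y 0%N).
Hypothesis indepN : independent_of_process P N (fun j w => (X j w, Y j w)).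
Hypothesis Y3 : L1 P (fun w => `|Y 0%N w| ^+ 3).
Hypothesis pair_law : forall j, same_law P (fun w => (X j w, Y j w)) (fun w => (X 0%N w, Y 0%N w)).
Hypothesis X1 : L1 P (X 0%N).
Hypothesis rho01 : 0 <= rho <= 1.
Hypothesis Xcorr : equally_correlated P rho (fun j => X j : T -> R).
Hypothesis Xlaw : forall j, same_law P (X j : T -> R) (Y 0%N).

Notation mean := (\int[P]_w Y 0%N w).
Notation second := (\int[P]_w (Y 0%N w ^+ 2)).
Notation third := (\int[P]_w (`|Y 0%N w| ^+ 3)).
Notation cs := (corr_sum N X).
Notation ys := (iid_sum N Y).
Notation vs := (multiple N Y).

Let mixed (g : R -> R) : measurable_fun setT g -> L1 P (g \o vs) -> L1 P (g \o ys) ->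
  L1 P (g \o cs) /\
  \int[P]_w g (cs w) = rho * \int[P]_w g (vs w) + (1 - rho) * \int[P]_w g (ys w).
Proof.
move=> mg gV gC; apply: Rintegral_law_mixture => //.
- exact: measurable_corr_sum.
- exact: measurable_multiple.
- exact: measurable_iid_sum.
- move=> A mA.
  exact: (corr_sum_law Npoisson Yindep Ylaw0 indepN rho01 Xcorr Xlaw mA).
Qed.

Lemma corr_sum_moments :
  [/\ L1 P cs, \int[P]_w cs w = lambda * mean, L1 P (fun w => cs w ^+ 2) &
      \int[P]_w (cs w ^+ 2) = lambda * (1 + lambda * rho) * second +
        lambda ^+ 2 * (1 - rho) * mean ^+ 2].
Proof.
have [[V1 V1E] [V2 V2E] _ _] := multiple_moments lambda0 Npoisson indepN Y3.
have C1 := L1_iid_sum lambda0 Npoisson Yindep Ylaw0 indepN Y3.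
have C2 := L1_iid_sum_sqr lambda0 Npoisson Yindep Ylaw0 indepN Y3.
have [] := @mixed id (@measurable_id _ R setT) V1 C1.
rewrite /= V1E (iid_sum_mean lambda0 Npoisson Yindep Ylaw0 indepN Y3) => H1 H1E.
have [] := @mixed (fun x => x ^+ 2) (measurable_funX 2 (@measurable_id _ R setT)) V2 C2.
rewrite /= V2E (iid_sum_sqr_mean lambda0 Npoisson Yindep Ylaw0 indepN Y3) => H2 H2E.
by split=> //; [rewrite H1E; ring|rewrite H2E; ring].
Qed.

Let variance := lambda * second + lambda ^+ 2 * rho * (second - mean ^+ 2).

(** The variance is [rho * A + (1 - rho) * lambda * second], with [A] the variance
    of the multiple. Distributing [variance * E f1(Y)] in these proportions
    leaves, for each component of the mixture, its own Stein error plus the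
    cost of replacing [f1 0], respectively [f1] at the i.i.d. sum, by [f1] at
    the correlated sum. *)
Lemma corr_sum_stein (f f1 : R -> R) (L M : R) :
  (forall x : R, is_derive x 1 f (f1 x)) ->
  (forall x y, `|f1 y - f1 x| <= L * `|y - x|) ->
  (forall y, `|f y| <= M) ->
  [/\ L1 P (fun w => (cs w - lambda * mean) * f (cs w)),
      L1 P (fun w => f1 (cs w)) &
  `|variance * \int[P]_w f1 (cs w) - \int[P]_w ((cs w - lambda * mean) * f (cs w))| <=
  rho * (lambda * (second + lambda * (second - mean ^+ 2)) *
      (L * Num.sqrt (\int[P]_w (cs w ^+ 2))) +
    L / 2 * (lambda * ((lambda ^+ 2 + 3 * lambda + 1) * third -
      lambda * (lambda + 1) * mean * \int[P]_w (Y 0%N w * `|Y 0%N w|)))) +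
  (1 - rho) * (lambda * second * (L * (lambda * \int[P]_w `|Y 0%N w - X 0%N w|)) +
    lambda * (L / 2) * third)].
Proof.
move=> fd f1_lip fM; have /andP[rho0 rho1] := rho01.
have L0 : 0 <= L.
  by have := f1_lip 0 1; rewrite subr0 normr1 mulr1; exact: le_trans.
have M0 : 0 <= M by exact: le_trans (fM 0).
have [mf mf1] := lipschitz_measurable fd f1_lip.
have [[V1 V1E] [V2 V2E] [V2n V2nE] [V3 V3E]] := multiple_moments lambda0 Npoisson indepN Y3.
have [H1 H1E H2 _] := corr_sum_moments.
have [Vf Vfb] := monotone_stein_bound fd f1_lip V1 V2 V3.
have fM' y : `|f y| <= M * (1 + `|y|).
  by apply: (le_trans (fM y)); rewrite mulrDr mulr1 lerDl mulr_ge0.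
have [Cf Cf1 Cfb] := iid_sum_stein lambda0 Npoisson Yindep Ylaw0 indepN Y3 fd f1_lip fM'.
rewrite V1E in Vf Vfb.
have mV := measurable_multiple N Y.
have Vf1 : L1 P (fun w => f1 (vs w)).
  apply: (L1_le (L1D (L1_cst P `|f1 0|) (L1Z L (L1_norm V1)))).
    exact: (measurableT_comp mf1 mV).
  by move=> w; exact: (lipschitz_derivative_growth f1_lip).
have maf : measurable_fun setT (fun x : R => (x - lambda * mean) * f x).
  by apply: measurable_funM => //; exact: measurable_funB.
have [Yf YfE] := mixed maf Vf Cf.
have [Yf1 _] := mixed mf1 Vf1 Cf1.
split => //.
have [D1 Dle] := random_sums_distance lambda0 Npoisson indepN Y3 pair_law X1.
set e := \int[P]_w f1 (cs w).
have lip_le (U W : T -> R) : L1 P (fun w => f1 (U w)) -> L1 P (fun w => f1 (W w)) ->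
    L1 P (fun w => `|U w - W w|) ->
    `|\int[P]_w f1 (U w) - \int[P]_w f1 (W w)| <= L * \int[P]_w `|U w - W w|.
  move=> U1 W1 UW; rewrite -RintegralB// -RintegralZl//.
  apply: (le_trans (le_normr_Rintegral measurableT (L1B U1 W1))).
  by apply: Rintegral_le; [exact: (L1_norm (L1B U1 W1))|exact: (L1Z L UW)|].
have e0 : `|e - f1 0| <= L * Num.sqrt (\int[P]_w (cs w ^+ 2)).
  have /(lip_le cs (fun=> 0) Yf1 (L1_cst P _)) : L1 P (fun w => `|cs w - 0|).
    by exact: (L1_norm (L1B H1 (L1_cst P 0))).
  rewrite Rintegral_probability_cst => /le_trans; apply.
  apply: ler_wpM2l => //; under eq_Rintegral do rewrite subr0.
  by apply: Rintegral_norm_le_sqrt => //; exact: measurable_corr_sum.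
have eC : `|e - \int[P]_w f1 (ys w)| <= L * (lambda * \int[P]_w `|Y 0%N w - X 0%N w|).
  apply: (le_trans (lip_le _ _ Yf1 Cf1 D1)).
  exact: ler_wpM2l.
rewrite V2E V2nE V3E in Vfb.
have Y2 : L1 P (fun w => Y 0%N w ^+ 2) by exact: (L1_cube_sqr (measurable_funPT (Y 0%N)) Y3).
have s0 : 0 <= second by apply: Rintegral_ge0 => w _; exact: sqr_ge0.
set A := lambda * (second + lambda * (second - mean ^+ 2)).
have A0 : 0 <= A.
  apply: mulr_ge0; first exact: ltW.
  apply: addr_ge0 => //; apply: mulr_ge0; first exact: ltW.
  by rewrite subr_ge0; exact: (Rintegral_sqr_le (measurable_funPT (Y 0%N)) Y2).
move: Vfb Cfb e0 eC; rewrite [in X in _ -> _ -> _ -> _ -> X <= _](YfE : \int[P]_w ((cs w - lambda * mean) * f (cs w)) = _) /=.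
set v1 := \int[P]_w ((vs w - _) * _).
set c1 := \int[P]_w ((ys w - _) * _).
set ec := \int[P]_w f1 (ys w).
set S := Num.sqrt _; set D := \int[P]_w `|_ - _|; set K := \int[P]_w (_ * `|_|).
move=> Vfb Cfb e0 eC.
have -> : variance * e - (rho * v1 + (1 - rho) * c1) =
    rho * (A * (e - f1 0) - (v1 - f1 0 * A)) +
    (1 - rho) * (lambda * second * (e - ec) - (c1 - lambda * second * ec)).
  by rewrite /variance /A; ring.
have rho1' : 0 <= 1 - rho by lra.
apply: (le_trans (ler_normD _ _)); apply: lerD.
  rewrite normrM (ger0_norm rho0) ler_wpM2l//.
  apply: (le_trans (ler_normB _ _)); apply: lerD.
    by rewrite normrM (ger0_norm A0) ler_wpM2l.
  have -> : A = lambda * (lambda + 1) * second - (lambda * mean) ^+ 2 by rewrite /A; ring.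
  apply: (le_trans Vfb).
  by rewrite le_eqVlt; apply/orP; left; apply/eqP; ring.
have ls0 : 0 <= lambda * second by apply: mulr_ge0 => //; exact: ltW.
rewrite normrM (ger0_norm rho1') ler_wpM2l//.
apply: (le_trans (ler_normB _ _)); apply: lerD => //.
by rewrite normrM (ger0_norm ls0) ler_wpM2l.
Qed.

End equally_correlated_random_sum.

(** * Expectation, variance and the Gaussian law *)

Section standardisation.
Context d (T : measurableType d) (R : realType) (P : probability T R).

Lemma expectation_Rintegral (U : T -> R) : fine 'E_P[U] = \int[P]_w U w.
Proof. by rewrite unlock. Qed.

Lemma variance_Rintegral (U : T -> R) : L1 P U -> L1 P (fun w => U w ^+ 2) ->
  'V_P[U] = (\int[P]_w (U w ^+ 2) - (\int[P]_w U w) ^+ 2)%:E.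
Proof.
move=> U1 U2; rewrite /variance covariance.unlock expectation_Rintegral.
set m := \int[P]_w U w; rewrite expectation.unlock.
have E w : ((U \- cst m) * (U \- cst m)) w = U w ^+ 2 - (2 * m * U w - m ^+ 2).
  by rewrite -[LHS]/((U w - m) * (U w - m)); ring.
have H : L1 P (fun w => 2 * m * U w - m ^+ 2) by exact: (L1B (L1Z _ U1) (L1_cst P _)).
under eq_integral do rewrite E.
rewrite (integralE_Rintegral (L1B U2 H)); congr EFin.
rewrite RintegralB// RintegralB//; [|exact: (L1Z _ U1)|exact: L1_cst].
by rewrite RintegralZl// Rintegral_probability_cst -/m; ring.
Qed.

(** The Gaussian law lives on the copy of the reals on which Lebesgue measure is
    defined, so [Z] is first regarded as a variable with values there. *)
Lemma normal_expectation d' (T' : measurableType d') (Q : probability T' R)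
    (Z : {RV Q >-> R}) (h : R -> R) :
  (forall A : set R, measurable A -> distribution Q Z A = normal_prob 0 1 A) ->
  (forall x y, `|h y - h x| <= `|y - x|) ->
  ('E_Q[h \o Z] = (\int[@lebesgue_measure R]_x (h x * normal_pdf 0 1 x))%R%:E)%E.
Proof.
move=> Zlaw hl; rewrite expectation.unlock.
have mh : measurable_fun setT h := continuous_measurable_fun (lipschitz1_continuous hl).
have mEh : measurable_fun setT (EFin \o h) by exact/measurable_EFinP.
have hphi := L1_lipschitz_normal_pdf01 hl.
rewrite -(integralE_Rintegral hphi) -integral_normal_prob//.
have mZ : measurable_fun setT (Z : T' -> measurableTypeR R) := measurable_funPT Z.
pose m := distribution Q (mfun_of mZ).
have mE (A : set (measurableTypeR R)) : measurable A -> m A = normal_prob 0 1 A.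
  exact: Zlaw.
have hZ : L1 Q (h \o Z).
  have mn : measurable_fun setT (fun x => `|(h x)%:E|%E) by exact: measurableT_comp.
  apply/integrableP; split.
    by apply/measurable_EFinP; exact: (measurableT_comp mh (measurable_funPT Z)).
  have -> : (\int[Q]_w `|(EFin \o (h \o Z)) w| = \int[m]_x `|(h x)%:E|)%E.
    by rewrite ge0_integral_pushforward.
  rewrite (eq_measure_integral (normal_prob 0 1)); last by move=> A mA _; exact: mE.
  rewrite (integral_normal_prob (f := fun x => `|h x|)); last first.
    exact: (measurableT_comp (@normr_measurable R setT) mh).
  have /integrableP[_] := hphi; under eq_integral do rewrite /= normrM (ger0_norm (normal_pdf_ge0 _ _ _)).
  by [].
transitivity (\int[m]_x (h x)%:E)%E; first by rewrite integral_pushforward.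
by apply: eq_measure_integral => A mA _; exact: mE.
Qed.

End standardisation.

(** * Wasserstein distance to the normal law *)

(** Stein's method after undoing the standardisation: with [f] and [f1] the
    solution of Stein's equation and its derivative, rescaled by [a] and [s],
    the test function minus its Gaussian mean at [(y - a) / s] is
    [(s ^+ 2 * f1 y - (y - a) * f y) / s]. *)
Lemma wasserstein_normal_le d (T : measurableType d) (R : realType) (P : probability T R)
    d' (T' : measurableType d') (Q : probability T' R) (Z : {RV Q >-> R})
    (U : T -> R) (a s B : R) :
  (forall A : set R, measurable A -> distribution Q Z A = normal_prob 0 1 A) ->
  measurable_fun setT U -> 0 < s -> L1 P U ->
  (forall (f f1 : R -> R) (M : R),
    (forall x : R, is_derive x 1 f (f1 x)) ->
    (forall x y, `|f1 y - f1 x| <= 2 / s ^+ 2 * `|y - x|) ->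
    (forall y, `|f y| <= M) ->
    [/\ L1 P (fun w => (U w - a) * f (U w)), L1 P (fun w => f1 (U w)) &
      `|s ^+ 2 * \int[P]_w f1 (U w) - \int[P]_w ((U w - a) * f (U w))| <= s * B]) ->
  (wasserstein P (fun w => (U w - a) / s)%R Q Z <= B%:E)%E.
Proof.
move=> Zlaw mU s0 U1 H; have sN0 : s != 0 by rewrite gt_eqF.
apply: ge_ereal_sup => _ [h [hac hd] <-].
have hl := absolutely_continuous_lipschitz hac hd.
rewrite (normal_expectation Zlaw hl).
have [g [g1 [M [gd gl gM gE]]]] := stein_equation hl.
set c := \int[_]_x _ in gE *.
pose std y := (y - a) / s.
have std1 (x : R) : is_derive x 1 std s^-1.
  by apply: trigger_derive; rewrite /= -![_ *: _]/(_ * _); field.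
have [||y|Uf Uf1 Ub] := H (g \o std) (fun y => s^-1 * g1 (std y)) M.
- by move=> x; rewrite mulrC; exact: (@is_derive1_comp R g std x _ _ (gd (std x)) (std1 x)).
- move=> x y; rewrite -mulrBr normrM gtr0_norm ?invr_gt0//.
  have := gl (std x) (std y); rewrite -mulrBl opprB addrA subrK normrM.
  rewrite (gtr0_norm (x := s^-1)) ?invr_gt0// => E.
  rewrite mulrC ler_pdivrMr//; apply: (le_trans E).
  by rewrite le_eqVlt; apply/orP; left; apply/eqP; field.
- exact: gM.
have stdU1 : L1 P (fun w => std (U w)).
  by apply: eq_L1 (L1Z s^-1 (L1B U1 (L1_cst P a))) => w; rewrite /std mulrC.
have mh : measurable_fun setT h := continuous_measurable_fun (lipschitz1_continuous hl).
have hU : L1 P (fun w => h (std (U w))).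
  apply: (L1_le (L1D (L1_cst P `|h 0|) (L1_norm stdU1))).
    exact: (measurableT_comp mh (L1_measurable stdU1)).
  by move=> w; exact: lipschitz1_growth.
rewrite expectation.unlock (integralE_Rintegral hU) -EFinB abse_EFin lee_fin.
rewrite -(ler_pM2l s0).
have -> : \int[P]_w h (std (U w)) - c = \int[P]_w (h (std (U w)) - c).
  by rewrite RintegralB// ?Rintegral_probability_cst//; exact: L1_cst.
rewrite -{1}(gtr0_norm s0) -normrM.
rewrite -RintegralZl//; last exact: (L1B hU (L1_cst P c)).
move: Ub; rewrite -RintegralZl// -RintegralB//; last exact: (L1Z _ Uf1).
congr (`|_| <= _); apply: eq_Rintegral => w _.
by rewrite /= -gE /std; field.
Qed.

Lemma sgn1_sqr (R : realType) (x : R) : x ^+ 2 * sgn1 x = x * `|x|.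
Proof.
by rewrite /sgn1; case: leP => [x0|x0]; [rewrite ger0_norm//; ring|rewrite ltr0_norm//; ring].
Qed.

Theorem theorem2p6 (R : realType) (d : measure_display) (T : measurableType d)
    (P : probability T R) (lambda rho : R)
    (N : {RV P >-> nat}) (X X' : nat -> {RV P >-> R})
    (d' : measure_display) (T' : measurableType d') (Q : probability T' R)
    (Z : {RV Q >-> R}) :
  0 < lambda ->
  (forall k : nat, P (N @^-1` [set k]) = (poisson_pmf lambda k)%:E) ->
  exchangeable P (fun j => X j : T -> R) ->
  independent_of_process P N (fun j => X j : T -> R) ->
  (0 < 'E_P[fun w => (X 0%N w ^+ 2)%R])%E ->
  ('E_P[fun w => (`|X 0%N w| ^+ 3)%R] < +oo)%E ->
  0 <= rho <= 1 ->
  equally_correlated P rho (fun j => X j : T -> R) ->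
  iid_copies P (fun j => X' j : T -> R) (X 0%N) ->
  independent_of_process P N (fun j w => (X j w, X' j w)) ->
  (forall j, same_law P (fun w => (X j w, X' j w))
                        (fun w => (X 0%N w, X' 0%N w))) ->
  (forall A : set R, measurable A -> distribution Q Z A = normal_prob 0 1 A) ->
  let Y := fun w : T => \sum_(j < N w) X j w in
  let EY : R := fine 'E_P[Y] in
  let VarY : R := fine 'V_P[Y] in
  let Ytilde := fun w : T => (Y w - EY) / Num.sqrt VarY in
  let EX : R := fine 'E_P[X 0%N] in
  let EX2 : R := fine 'E_P[fun w => X 0%N w ^+ 2] in
  let EX3 : R := fine 'E_P[fun w => `|X 0%N w| ^+ 3] in
  let EX2sgn : R := fine 'E_P[fun w => X 0%N w ^+ 2 * sgn1 (X 0%N w)] in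
  let VarX : R := fine 'V_P[X 0%N] in
  let EXX' : R := fine 'E_P[fun w => `|X' 0%N w - X 0%N w|] in
  let sigma : R := rho * (EX2 + lambda * VarX) / (EX2 + lambda * rho * VarX) in
  let alpha : R :=
    Num.sqrt (lambda * (1 + lambda * rho) * EX2 +
              lambda ^+ 2 * (1 - rho) * EX ^+ 2) +
    ((lambda ^+ 2 + 3 * lambda + 1) * EX3 -
     lambda * (lambda + 1) * EX * EX2sgn) / (2 * (EX2 + lambda * VarX)) in
  'V_P[Y] = (lambda * EX2 + lambda ^+ 2 * rho * VarX)%:E /\
  (wasserstein P Ytilde Q Z <=
    ((Num.sqrt VarY)^-1 *
     (2 * sigma * alpha + (1 - sigma) * EX3 / EX2 +
      2 * lambda * (1 - sigma) * EXX'))%:E)%E.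
Proof.
move=> lambda0 Npoisson _ _ EX2_gt0 EX3_fin rho01 Xcorr [Yindep Ylaw] indepN pair_law Zlaw.
move=> Y EY VarY Ytilde EX EX2 EX3 EX2sgn VarX EXX' sigma alpha.
have /andP[rho0 rho1] := rho01.
have mX := measurable_funPT (X 0%N); have mX' := measurable_funPT (X' 0%N).
have mcube : measurable_fun setT (fun x : R => `|x| ^+ 3).
  by apply: measurable_funX; exact: normr_measurable.
have msqr : measurable_fun setT (fun x : R => x ^+ 2) by exact: measurable_funX.
have mabs : measurable_fun setT (fun x : R => x * `|x|).
  by apply: measurable_funM => //; exact: normr_measurable.
have X3 : L1 P (fun w => `|X 0%N w| ^+ 3).
  apply: L1_ge0P; [exact: (measurableT_comp mcube mX)| |].
    by move=> w; exact: exprn_ge0.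
  by move: EX3_fin; rewrite expectation.unlock.
have X2 := L1_cube_sqr mX X3; have X1 := L1_sqr_id mX X2.
have Xabs : L1 P (fun w => X 0%N w * `|X 0%N w|).
  apply: (L1_le X2); first exact: (measurableT_comp mabs mX).
  by move=> w; rewrite normrM normr_id -expr2 real_normK ?num_real.
have law := same_law_sym (Ylaw 0%N).
have [Y3 E3] := same_law_L1 mX mX' mcube law X3.
have [_ E2] := same_law_L1 mX mX' msqr law X2.
have [_ E1] := same_law_L1 mX mX' (@measurable_id _ R setT) law X1.
have [_ Eabs] := same_law_L1 mX mX' mabs law Xabs.
rewrite /= in Y3 E3 E2 E1 Eabs.
have Ylaw0 i : same_law P (X' i : T -> R) (X' 0%N).
  exact: (same_law_trans (Ylaw i) law).
have Xlaw j : same_law P (X j : T -> R) (X' 0%N).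
  apply: same_law_trans law.
  exact: (same_law_comp (g := fst) measurable_fst (pair_law j)).
have [S1 S1E S2 S2E] := corr_sum_moments lambda0 Npoisson Yindep Ylaw0 indepN Y3 rho01 Xcorr Xlaw.
have EXE : EX = \int[P]_w X' 0%N w by rewrite /EX expectation_Rintegral E1.
have EX2E : EX2 = \int[P]_w (X' 0%N w ^+ 2) by rewrite /EX2 expectation_Rintegral E2.
have EX3E : EX3 = \int[P]_w (`|X' 0%N w| ^+ 3) by rewrite /EX3 expectation_Rintegral E3.
have EX2sgnE : EX2sgn = \int[P]_w (X' 0%N w * `|X' 0%N w|).
  rewrite /EX2sgn expectation_Rintegral -Eabs.
  by apply: eq_Rintegral => w _; exact: sgn1_sqr.
have EXX'E : EXX' = \int[P]_w `|X' 0%N w - X 0%N w| by rewrite /EXX' expectation_Rintegral.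
have VarXE : VarX = EX2 - EX ^+ 2.
  by rewrite /VarX variance_Rintegral//= EX2E EXE E2 E1.
have EYE : EY = lambda * EX by rewrite /EY expectation_Rintegral EXE.
have EX2_0 : 0 < EX2.
  by move: EX2_gt0; rewrite expectation.unlock (integralE_Rintegral X2) lte_fin /EX2 expectation_Rintegral.
have VarX0 : 0 <= VarX.
  by rewrite VarXE subr_ge0 EXE EX2E -E1 -E2; exact: Rintegral_sqr_le.
have VY : 'V_P[Y] = (lambda * EX2 + lambda ^+ 2 * rho * VarX)%:E.
  rewrite variance_Rintegral// S2E S1E -EXE -EX2E VarXE; congr EFin; ring.
split => //.
have VarYE : VarY = lambda * EX2 + lambda ^+ 2 * rho * VarX by rewrite /VarY VY.
have D0 : 0 < EX2 + lambda * VarX by rewrite ltr_wpDr// mulr_ge0// ltW.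
have D1 : 0 < EX2 + lambda * rho * VarX.
  by rewrite ltr_wpDr// mulr_ge0// mulr_ge0// ltW.
have VarYE' : VarY = lambda * (EX2 + lambda * rho * VarX) by rewrite VarYE; ring.
have VarY0 : 0 < VarY by rewrite VarYE' mulr_gt0.
have sd0 : 0 < Num.sqrt VarY by rewrite sqrtr_gt0.
(* With Lipschitz constant [2 / VarY], the bound of [corr_sum_stein] is exactly the
   stated one; only the fractions in [sigma] and [alpha] remain to be cleared. *)
apply: (wasserstein_normal_le Zlaw _ sd0 S1); first exact: measurable_corr_sum.
rewrite sqr_sqrtr ?(ltW VarY0)// => f f1 M fd fl fM.
have [H1 H2 H3] := corr_sum_stein lambda0 Npoisson Yindep Ylaw0 indepN Y3 pair_law X1
  rho01 Xcorr Xlaw fd fl fM.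
rewrite -EXE -EYE in H1 H3; split => //.
rewrite mulrA divff ?gt_eqF// mul1r.
move: H3; rewrite S2E -EX2E -EX3E -EX2sgnE -EXE -EXX'E -VarXE -VarYE -/(Y _) => /le_trans; apply.
rewrite le_eqVlt; apply/orP; left; apply/eqP.
rewrite /sigma /alpha VarYE'.
set S := Num.sqrt _.
field.
by rewrite !gt_eqF.
Qed.
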